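(* Suppose $G$ is a subgroup of $PL_o(I)$. Then: (1) if $G$ admits a tall tower then $G$ contains a subgroup isomorphic to $(\mathbf{Z}\wr)^{\infty}$; (2) if $G$ admits a deep tower then $G$ contains a subgroup isomorphic to ${}^{\infty}(\wr\mathbf{Z})$; and (3) if $G$ admits a bi-infinite tower then $G$ contains a subgroup isomorphic to $(\wr\mathbf{Z}\wr)^{\infty}$.
   Context: $PL_o(I)$ denotes the group, under composition, of orientation-preserving piecewise-linear homeomorphisms of the unit interval $I=[0,1]$ which admit finitely many breaks in slope. $\mathbf{N}=\{0,1,2,\ldots\}$. Group actions are right actions ($xg$ is the image of $x$ under $g$), composition is from left to right, and $g^h=h^{-1}gh$. Orbitals. For $g\in PL_o(I)$, an orbital of $g$ is a connected component of the open set $\{x\in I\mid xg\neq x\}$. A signed orbital of $G\leq PL_o(I)$ is a pair $(A,g)$ with $g\in G$ and $A$ an orbital of $g$; $A$ is its orbital and $g$ its signature. Signed orbitals are partially ordered lexicographically, using inclusion of open intervals in the first coordinate and then a fixed total order of the group $PL_o(I)$ in the second coordinate. Towers. A tower associated with $G$ is a set $T$ of signed orbitals of $G$ such that (i) $T$ is a chain in the poset of signed orbitals of $PL_o(I)$, and (ii) if $(A,g),(A,h)\in T$ then $g=h$. (Thus distinct elements of $T$ have distinct, nested orbitals, ordered by inclusion.) A tower $T$ is tall if there is an order-preserving injection $\mathbf{N}\to T$, deep if there is an order-reversing injection $\mathbf{N}\to T$, and bi-infinite if there is an order-preserving injection $\mathbf{Z}\to T$. The groups. Define $\alpha,\beta_0\in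 PL_o(I)$ by $$x\alpha=\begin{cases}\frac14x&0\le x<\frac14\\ x-\frac3{16}&\frac14\le x<\frac7{16}\\ 4x-\frac32&\frac7{16}\le x<\frac9{16}\\ x+\frac3{16}&\frac9{16}\le x<\frac34\\ \frac14x+\frac34&\frac34\le x\le1\end{cases}\qquad x\beta_0=\begin{cases}x&0\le x<\frac7{16}\\ 2x-\frac7{16}&\frac7{16}\le x<\frac{15}{32}\\ x+\frac1{32}&\frac{15}{32}\le x<\frac12\\ \frac12x+\frac9{32}&\frac12\le x<\frac9{16}\\ x&\frac9{16}\le x\le1,\end{cases}$$ and $\beta_k=\beta_0^{\alpha^k}=\alpha^{-k}\beta_0\alpha^k$ for $k\in\mathbf{Z}$. Then $(\wr\mathbf{Z}\wr)^{\infty}=\langle\beta_i\mid i\in\mathbf{Z}\rangle$, ${}^{\infty}(\wr\mathbf{Z})=\langle\beta_i\mid i\in\mathbf{Z},\,i<0\rangle$, and $(\mathbf{Z}\wr)^{\infty}=\langle\beta_i\mid i\in\mathbf{N}\rangle$, all as subgroups of $PL_o(I)$. *)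

(* Defs.v *)
From HB Require Import structures.
From mathcomp Require Import all_boot all_order all_algebra.
From mathcomp Require Import all_classical all_reals all_analysis.
From mathcomp Require Import lra.
Import Order.TTheory GRing.Theory Num.Theory.
Import numFieldNormedType.Exports.

Set Implicit Arguments.
Unset Strict Implicit.
Unset Printing Implicit Defensive.

Local Open Scope classical_set_scope.
Local Open Scope ring_scope.

Definition I01 (R : realType) : set R := `[0, 1].
Arguments I01 : clear implicits.

Definition homeomorphism_of_I (R : realType) (f : R -> R) : Prop :=
  [/\ set_bij (I01 R) (I01 R) f,
      {within I01 R, continuous f} &
      exists2 g : R -> R,
        {within I01 R, continuous g} & {in I01 R, cancel f g}].

Definition affine_on (R : realType) (A : set R) (f : R -> R) : Prop :=
  exists m c : R, forall x, A x -> f x = m * x + c.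

(* The finite list s contains every break of f, that is, f is affine on each
   closed subinterval of I whose interior does not meet s. *)
Definition piecewise_linear (R : realType) (f : R -> R) : Prop :=
  exists s : seq R, forall a b : R, 0 <= a -> a <= b -> b <= 1 ->
    {in s, forall t, ~~ (a < t < b)} -> affine_on `[a, b] f.

(* A homeomorphism of I is represented by its extension to R by the identity,
   so that equality of functions R -> R is equality of homeomorphisms of I. *)
Definition is_PLo (R : realType) (f : R -> R) : Prop :=
  [/\ forall x, ~ I01 R x -> f x = x,
      homeomorphism_of_I f,
      {in I01 R &, {homo f : x y / x < y}} &
      piecewise_linear f].

(* PLo R is the group PL_o(I), with the product PLo_mul below. The image of x
   under the right action of g is written g x. *)
Record PLo (R : realType) := MkPLo {
  PLo_fun :> R -> R ;
  PLo_funP : is_PLo PLo_fun }.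

Section PLoTheory.
Variable R : realType.
Local Notation I := (I01 R).
Implicit Types f g : R -> R.

Lemma I01E x : I x <-> 0 <= x <= 1.
Proof. by rewrite /I01 /= in_itv. Qed.

Lemma PLo_ext (f g : PLo R) : PLo_fun f =1 PLo_fun g -> f = g.
Proof.
case: f g => [f Pf] [g Pg] /= /funext fg; move: Pf Pg; rewrite fg => Pf Pg.
by congr MkPLo; exact: Prop_irrelevance.
Qed.

Lemma incr_continuous f g :
  (forall x, I x -> I (f x)) -> (forall x, I x -> I (g x)) ->
  (forall x, I x -> g (f x) = x) -> (forall x, I x -> f (g x) = x) ->
  (forall x y, I x -> I y -> x < y -> f x < f y) ->
  {within I, continuous f}.
Proof.
move=> fI gI fK gK fincr.
have mono : {in `[0, 1]%R &, {mono f : x y / x <= y}}.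
  apply: le_mono_in => x y xI yI; exact: fincr.
have I0 : I 0 by apply/I01E; rewrite lexx ler01.
have I1 : I 1 by apply/I01E; rewrite lexx ler01.
have f0 : f 0 = 0.
  apply/eqP; rewrite eq_le; apply/andP; split; last by case/I01E/andP: (fI _ I0).
  rewrite -[leRHS](gK 0)// mono//; last exact: gI.
  by case/I01E/andP: (gI _ I0).
have f1 : f 1 = 1.
  apply/eqP; rewrite eq_le; apply/andP; split; first by case/I01E/andP: (fI _ I1).
  rewrite -[leLHS](gK 1)// mono//; last exact: gI.
  by case/I01E/andP: (gI _ I1).
apply: segment_inc_surj_continuous => //.
rewrite f0 f1 => y yI; exists (g y); [exact: gI|exact: gK].
Qed.

Lemma is_PLoI f g :
  (forall x, ~ I x -> f x = x) ->
  (forall x, I x -> I (f x)) -> (forall x, I x -> I (g x)) ->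
  (forall x, I x -> g (f x) = x) -> (forall x, I x -> f (g x) = x) ->
  (forall x y, I x -> I y -> x < y -> f x < f y) ->
  piecewise_linear f -> is_PLo f.
Proof.
move=> fid fI gI fK gK fincr fPL.
have gincr x y : I x -> I y -> x < y -> g x < g y.
  move=> xI yI xy; rewrite ltNge; apply/negP; rewrite le_eqVlt => /orP[/eqP|] H.
    by move: xy; rewrite -(gK x)// -(gK y)// H ltxx.
  have := fincr _ _ (gI _ yI) (gI _ xI) H.
  by rewrite !gK// => /(lt_trans xy); rewrite ltxx.
split=> //; last first.
  by move=> x y /set_mem xI /set_mem yI; exact: fincr.
split.
- split=> //.
    move=> x y /set_mem xI /set_mem yI fxy.
    by rewrite -(fK x)// -(fK y)// fxy.
  by move=> y yI; exists (g y); [exact: gI|exact: gK].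
- exact: (incr_continuous fI gI fK gK fincr).
- exists g; first exact: (incr_continuous gI fI gK fK gincr).
  by move=> x /set_mem; exact: fK.
Qed.

Lemma is_PLo_inv f : is_PLo f -> exists g,
  [/\ is_PLo g, cancel f g & cancel g f].
Proof.
move=> [fid [[fI finj fsurj] _ [g0 _ fK0]] fincr [s fs]].
have fK x : I x -> g0 (f x) = x by move=> xI; apply: fK0; exact/mem_set.
have gI x : I x -> I (g0 x) by case/fsurj => y yI <-; rewrite fK.
have gK x : I x -> f (g0 x) = x by case/fsurj => y yI <-; rewrite fK.
pose g x := if x \in I then g0 x else x.
have gE x : I x -> g x = g0 x by move=> xI; rewrite /g mem_set.
have gid x : ~ I x -> g x = x by move=> xI; rewrite /g memNset.
have gincr x y : I x -> I y -> x < y -> g0 x < g0 y.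
  move=> xI yI xy; rewrite ltNge; apply/negP; rewrite le_eqVlt => /orP[/eqP|] H.
    by move: xy; rewrite -(gK x)// -(gK y)// H ltxx.
  have := fincr _ _ (mem_set (gI _ yI)) (mem_set (gI _ xI)) H.
  by rewrite !gK// => /(lt_trans xy); rewrite ltxx.
have gmono : {in I &, {mono g0 : x y / x <= y}}.
  apply: le_mono_in => x y /set_mem xI /set_mem yI; exact: gincr.
exists g; split.
- apply: (@is_PLoI g f) => //.
  + by move=> x xI; rewrite gE//; exact: gI.
  + by move=> x xI; rewrite gE// gK.
  + by move=> x xI; rewrite gE ?fK//; exact: fI.
  + by move=> x y xI yI xy; rewrite !gE//; exact: gincr.
  + exists [seq f t | t <- s & t \in I] => a b a0 ab b1 sab.
    have aI : I a by apply/I01E; rewrite a0 (le_trans ab).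
    have bI : I b by apply/I01E; rewrite b1 (le_trans a0).
    have /I01E/andP[ga0 ga1] := gI _ aI.
    have /I01E/andP[gb0 gb1] := gI _ bI.
    have gab : g0 a <= g0 b by rewrite gmono// mem_set.
    have [|m [c H]] := fs _ _ ga0 gab gb1.
      move=> t ts; apply/negP => /andP[gat tgb].
      have tI : I t by apply/I01E; rewrite !ltW ?(le_lt_trans ga0) ?(lt_le_trans tgb).
      apply: (negP (sab (f t) _)).
        by apply: map_f; rewrite mem_filter ts mem_set.
      apply/andP; split; rewrite ltNge; apply/negP => le.
        move: gat; rewrite ltNge -[t]fK// gmono ?mem_set ?le//; exact: fI.
      move: tgb; rewrite ltNge -[t]fK// gmono ?mem_set ?le//; exact: fI.
    have key x : `[a, b]%classic x -> I x /\ x = m * g0 x + c.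
      rewrite /= in_itv /= => /andP[ax xb].
      have xI : I x by apply/I01E; rewrite (le_trans a0)//= (le_trans xb).
      split=> //; rewrite -H ?gK//= in_itv /=.
      by rewrite !gmono ?mem_set// ax.
    have [m0|m0] := eqVneq m 0.
      exists 1, (g0 c - c) => x /key[xI]; rewrite m0 mul0r add0r => <-.
      by rewrite gE// mul1r addrC subrK.
    exists m^-1, (- (m^-1 * c)) => x /key[xI] e.
    by rewrite gE// [in RHS]e mulrDr mulKf// addrK.
- move=> x; case: (pselect (I x)) => xI; last by rewrite fid// gid.
  by rewrite gE ?fK//; exact: fI.
- move=> x; case: (pselect (I x)) => xI; last by rewrite gid// fid.
  by rewrite gE ?gK.
Qed.

Lemma is_PLo_set f : is_PLo f -> forall x, I x -> I (f x).
Proof. by case=> _ [[]]. Qed.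

Lemma is_PLo_comp f g : is_PLo f -> is_PLo g -> is_PLo (g \o f).
Proof.
move=> Pf Pg; have [f' [Pf' fK f'K]] := is_PLo_inv Pf.
have [g' [Pg' gK g'K]] := is_PLo_inv Pg.
have fI := is_PLo_set Pf; have gI := is_PLo_set Pg.
have f'I := is_PLo_set Pf'; have g'I := is_PLo_set Pg'.
case: Pf => [fid _ fincr [s fs]]; case: Pg => [gid _ gincr [t gt]].
have fmono : {in I &, {mono f : x y / x <= y}} by exact: le_mono_in.
apply: (@is_PLoI _ (f' \o g')) => /=.
- by move=> x xI; rewrite fid// gid.
- by move=> x xI; exact/gI/fI.
- by move=> x xI; exact/f'I/g'I.
- by move=> x xI; rewrite gK fK.
- by move=> x xI; rewrite f'K g'K.
- move=> x y xI yI xy; apply: gincr; rewrite ?mem_set//; try exact: fI.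
  by apply: fincr; rewrite ?mem_set.
- exists (s ++ [seq f' x | x <- t]) => a b a0 ab b1 sab.
  have aI : I a by apply/I01E; rewrite a0 (le_trans ab).
  have bI : I b by apply/I01E; rewrite b1 (le_trans a0).
  have /I01E/andP[fa0 _] := fI _ aI; have /I01E/andP[_ fb1] := fI _ bI.
  have fab : f a <= f b by rewrite fmono// mem_set.
  have [|m [c H]] := fs _ _ a0 ab b1.
    by move=> x xs; apply: sab; rewrite mem_cat xs.
  have [|n [d K]] := gt _ _ fa0 fab fb1.
    move=> x xt; apply/negP => /andP[fax xfb].
    have xI : I x by apply/I01E; rewrite !ltW ?(le_lt_trans fa0) ?(lt_le_trans xfb).
    apply: (negP (sab (f' x) _)).
      by rewrite mem_cat; apply/orP; right; exact: map_f.
    apply/andP; split; rewrite ltNge; apply/negP => le.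
      move: fax; rewrite ltNge -[x]f'K fmono ?mem_set ?le//; exact: f'I.
    move: xfb; rewrite ltNge -[x]f'K fmono ?mem_set ?le//; exact: f'I.
  exists (n * m), (n * c + d) => x xab.
  have fx := H _ xab.
  rewrite /= K; first by rewrite fx mulrDr mulrA addrA.
  move: xab; rewrite /= !in_itv /= => /andP[ax xb].
  have xI : I x by apply/I01E; rewrite (le_trans a0)//= (le_trans xb).
  by rewrite !fmono ?mem_set// ax.
Qed.

Lemma is_PLo_id : is_PLo (@id R).
Proof.
apply: (@is_PLoI _ id) => //.
exists [::] => a b _ _ _ _; exists 1, 0 => x _.
by rewrite mul1r addr0.
Qed.

Definition PLo_one : PLo R := MkPLo is_PLo_id.

(* Composition is from left to right: f * g is "first f, then g". *)
Definition PLo_mul (f g : PLo R) : PLo R :=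
  MkPLo (is_PLo_comp (PLo_funP f) (PLo_funP g)).

Definition PLo_inv (f : PLo R) : PLo R :=
  let: exist _ P := cid (is_PLo_inv (PLo_funP f)) in
  MkPLo (let: And3 Pg _ _ := P in Pg).

Lemma PLo_invK (f : PLo R) : cancel (PLo_fun f) (PLo_fun (PLo_inv f)).
Proof. by rewrite /PLo_inv; case: cid => g []. Qed.

Lemma PLo_invVK (f : PLo R) : cancel (PLo_fun (PLo_inv f)) (PLo_fun f).
Proof. by rewrite /PLo_inv; case: cid => g []. Qed.

Lemma PLo_mulA : associative PLo_mul.
Proof. by move=> f g h; exact: PLo_ext. Qed.

Lemma PLo_mul1 : left_id PLo_one PLo_mul.
Proof. by move=> f; exact: PLo_ext. Qed.

Lemma PLo_mulr1 : right_id PLo_one PLo_mul.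
Proof. by move=> f; exact: PLo_ext. Qed.

Lemma PLo_mulV : left_inverse PLo_one PLo_inv PLo_mul.
Proof. by move=> f; apply: PLo_ext => x /=; rewrite PLo_invVK. Qed.

Lemma PLo_mulrV : right_inverse PLo_one PLo_inv PLo_mul.
Proof. by move=> f; apply: PLo_ext => x /=; rewrite PLo_invK. Qed.

HB.instance Definition _ := gen_eqMixin (PLo R).
HB.instance Definition _ := gen_choiceMixin (PLo R).
HB.instance Definition _ :=
  isGroup.Build (PLo R) PLo_mulA PLo_mul1 PLo_mulr1 PLo_mulV PLo_mulrV.

End PLoTheory.

Section Subgroups.
Variable gT : groupType.
Local Open Scope group_scope.

Definition is_subgroup (G : set gT) : Prop :=
  [/\ G 1, forall x y, G x -> G y -> G (x * y) & forall x, G x -> G x^-1].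

Definition generated (X : set gT) : set gT := smallest is_subgroup X.

Definition isomorphic (H K : set gT) : Prop :=
  exists2 phi : gT -> gT, set_bij H K phi & {in H &, {morph phi : x y / x * y}}.

(* G contains a subgroup isomorphic to H. *)
Definition contains_copy_of (G H : set gT) : Prop :=
  exists K : set gT, [/\ is_subgroup K, K `<=` G & isomorphic H K].

Definition expgz (x : gT) (k : int) : gT :=
  match k with Posz n => x ^+ n | Negz n => x ^- n.+1 end.

End Subgroups.

Section Towers.
Variable R : realType.

Definition is_orbital (g : PLo R) (A : set R) : Prop :=
  let moved := [set x | I01 R x /\ g x <> x] in
  exists2 x, moved x & A = connected_component moved x.

Definition is_signed_orbital (G : set (PLo R)) (o : set R * PLo R) : Prop :=
  G o.2 /\ is_orbital o.2 o.1.

(* ord is the total order of PL_o(I) used in the second coordinate of the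
   lexicographic order of signed orbitals. *)
Variable ord : rel (PLo R).

Definition is_total_order : Prop :=
  [/\ reflexive ord, antisymmetric ord, transitive ord & total ord].

Definition signed_orbital_le (o1 o2 : set R * PLo R) : Prop :=
  o1.1 `<` o2.1 \/ (o1.1 = o2.1 /\ ord o1.2 o2.2).

Definition is_tower (G : set (PLo R)) (T : set (set R * PLo R)) : Prop :=
  [/\ forall o, T o -> is_signed_orbital G o,
      forall o1 o2, T o1 -> T o2 ->
        signed_orbital_le o1 o2 \/ signed_orbital_le o2 o1 &
      forall A g h, T (A, g) -> T (A, h) -> g = h].

Definition is_tall (T : set (set R * PLo R)) : Prop :=
  exists f : nat -> set R * PLo R,
    [/\ forall n, T (f n), injective f &
        forall m n, (m <= n)%N -> signed_orbital_le (f m) (f n)].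

Definition is_deep (T : set (set R * PLo R)) : Prop :=
  exists f : nat -> set R * PLo R,
    [/\ forall n, T (f n), injective f &
        forall m n, (m <= n)%N -> signed_orbital_le (f n) (f m)].

Definition is_bi_infinite (T : set (set R * PLo R)) : Prop :=
  exists f : int -> set R * PLo R,
    [/\ forall n, T (f n), injective f &
        forall m n : int, m <= n -> signed_orbital_le (f m) (f n)].

End Towers.

Section Generators.
Variable R : realType.

Definition alpha_fun (x : R) : R :=
  if ~~ (0 <= x <= 1) then x
  else if x < 1 / 4 then 1 / 4 * x
  else if x < 7 / 16 then x - 3 / 16
  else if x < 9 / 16 then 4 * x - 3 / 2
  else if x < 3 / 4 then x + 3 / 16
  else 1 / 4 * x + 3 / 4.

Definition beta0_fun (x : R) : R :=
  if ~~ (0 <= x <= 1) then x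
  else if x < 7 / 16 then x
  else if x < 15 / 32 then 2 * x - 7 / 16
  else if x < 1 / 2 then x + 1 / 32
  else if x < 9 / 16 then 1 / 2 * x + 9 / 32
  else x.

Let alpha_inv (x : R) : R :=
  if x < 1 / 16 then 4 * x
  else if x < 1 / 4 then x + 3 / 16
  else if x < 3 / 4 then 1 / 4 * x + 3 / 8
  else if x < 15 / 16 then x - 3 / 16
  else 4 * x - 3.

Let beta0_inv (x : R) : R :=
  if x < 7 / 16 then x
  else if x < 1 / 2 then 1 / 2 * x + 7 / 32
  else if x < 17 / 32 then x - 1 / 32
  else if x < 9 / 16 then 2 * x - 9 / 16
  else x.

Let alpha_funP (x : R) : 0 <= x <= 1 ->
  (x < 1 / 4 /\ alpha_fun x = 1 / 4 * x) \/
  (1 / 4 <= x /\ x < 7 / 16 /\ alpha_fun x = x - 3 / 16) \/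
  (7 / 16 <= x /\ x < 9 / 16 /\ alpha_fun x = 4 * x - 3 / 2) \/
  (9 / 16 <= x /\ x < 3 / 4 /\ alpha_fun x = x + 3 / 16) \/
  (3 / 4 <= x /\ alpha_fun x = 1 / 4 * x + 3 / 4).
Proof.
rewrite /alpha_fun => -> /=.
case: (ltP x (1 / 4)) => [?|?]; first by left.
case: (ltP x (7 / 16)) => [?|?]; first by right; left.
case: (ltP x (9 / 16)) => [?|?]; first by right; right; left.
case: (ltP x (3 / 4)) => [?|?]; first by right; right; right; left.
by do 4 right.
Qed.

Let alpha_invP (x : R) :
  (x < 1 / 16 /\ alpha_inv x = 4 * x) \/
  (1 / 16 <= x /\ x < 1 / 4 /\ alpha_inv x = x + 3 / 16) \/
  (1 / 4 <= x /\ x < 3 / 4 /\ alpha_inv x = 1 / 4 * x + 3 / 8) \/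
  (3 / 4 <= x /\ x < 15 / 16 /\ alpha_inv x = x - 3 / 16) \/
  (15 / 16 <= x /\ alpha_inv x = 4 * x - 3).
Proof.
rewrite /alpha_inv.
case: (ltP x (1 / 16)) => [?|?]; first by left.
case: (ltP x (1 / 4)) => [?|?]; first by right; left.
case: (ltP x (3 / 4)) => [?|?]; first by right; right; left.
case: (ltP x (15 / 16)) => [?|?]; first by right; right; right; left.
by do 4 right.
Qed.

Ltac cases5 P := let H := fresh in
  destruct P as [H|[H|[H|[H|H]]]]; decompose [and] H; clear H.

Ltac lra5 P t := cases5 P; generalize dependent t; intros; lra.

Lemma alpha_PLo : is_PLo alpha_fun.
Proof.
apply: (@is_PLoI _ _ alpha_inv).
- by move=> x /I01E/negP xI; rewrite /alpha_fun xI.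
- move=> x /I01E xI; apply/I01E; move/andP: (xI) => [x0 x1].
  by lra5 (alpha_funP xI) (alpha_fun x).
- move=> x /I01E/andP[x0 x1]; apply/I01E.
  by lra5 (alpha_invP x) (alpha_inv x).
- move=> x /I01E xI; move/andP: (xI) => [x0 x1].
  cases5 (alpha_funP xI); generalize dependent (alpha_fun x) => y *;
    lra5 (alpha_invP y) (alpha_inv y).
- move=> x /I01E/andP[x0 x1].
  have yI : 0 <= alpha_inv x <= 1.
    by lra5 (alpha_invP x) (alpha_inv x).
  cases5 (alpha_invP x); generalize dependent (alpha_inv x) => y yI *;
    lra5 (alpha_funP yI) (alpha_fun y).
- move=> x y /I01E xI /I01E yI xy.
  cases5 (alpha_funP xI); generalize dependent (alpha_fun x) => *;
    lra5 (alpha_funP yI) (alpha_fun y).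
exists [:: 1 / 4; 7 / 16; 9 / 16; 3 / 4] => a b a0 ab b1 sab.
have brk c : c \in [:: 1 / 4; 7 / 16; 9 / 16; 3 / 4] -> c < b -> c <= a.
  move=> /sab; rewrite negb_and -!leNgt => /orP[//|] /le_lt_trans h /h.
  by rewrite ltxx.
have aff m c : (forall x, a <= x -> x <= b -> 0 <= x <= 1 ->
    alpha_fun x = m * x + c) -> affine_on `[a, b] alpha_fun.
  move=> H; exists m, c => x; rewrite /= in_itv /= => /andP[ax xb].
  by apply: H => //; rewrite (le_trans a0)//= (le_trans xb).
have [h1|/brk] := leP b (1 / 4).
  by apply: (aff (1 / 4) (0)) => x ax xb xI;
  clear aff brk sab; lra5 (alpha_funP xI) (alpha_fun x).
rewrite !inE eqxx ?orbT => /(_ isT) {}h1.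
have [h2|/brk] := leP b (7 / 16).
  by apply: (aff (1) (- (3 / 16))) => x ax xb xI;
  clear aff brk sab; lra5 (alpha_funP xI) (alpha_fun x).
rewrite !inE eqxx ?orbT => /(_ isT) {}h2.
have [h3|/brk] := leP b (9 / 16).
  by apply: (aff (4) (- (3 / 2))) => x ax xb xI;
  clear aff brk sab; lra5 (alpha_funP xI) (alpha_fun x).
rewrite !inE eqxx ?orbT => /(_ isT) {}h3.
have [h4|/brk] := leP b (3 / 4).
  by apply: (aff (1) (3 / 16)) => x ax xb xI;
  clear aff brk sab; lra5 (alpha_funP xI) (alpha_fun x).
rewrite !inE eqxx ?orbT => /(_ isT) {}h4.
by apply: (aff (1 / 4) (3 / 4)) => x ax xb xI;
  clear aff brk sab; lra5 (alpha_funP xI) (alpha_fun x).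
Qed.

Let beta0_funP (x : R) : 0 <= x <= 1 ->
  (x < 7 / 16 /\ beta0_fun x = x) \/
  (7 / 16 <= x /\ x < 15 / 32 /\ beta0_fun x = 2 * x - 7 / 16) \/
  (15 / 32 <= x /\ x < 1 / 2 /\ beta0_fun x = x + 1 / 32) \/
  (1 / 2 <= x /\ x < 9 / 16 /\ beta0_fun x = 1 / 2 * x + 9 / 32) \/
  (9 / 16 <= x /\ beta0_fun x = x).
Proof.
rewrite /beta0_fun => -> /=.
case: (ltP x (7 / 16)) => [?|?]; first by left.
case: (ltP x (15 / 32)) => [?|?]; first by right; left.
case: (ltP x (1 / 2)) => [?|?]; first by right; right; left.
case: (ltP x (9 / 16)) => [?|?]; first by right; right; right; left.
by do 4 right.
Qed.

Let beta0_invP (x : R) :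
  (x < 7 / 16 /\ beta0_inv x = x) \/
  (7 / 16 <= x /\ x < 1 / 2 /\ beta0_inv x = 1 / 2 * x + 7 / 32) \/
  (1 / 2 <= x /\ x < 17 / 32 /\ beta0_inv x = x - 1 / 32) \/
  (17 / 32 <= x /\ x < 9 / 16 /\ beta0_inv x = 2 * x - 9 / 16) \/
  (9 / 16 <= x /\ beta0_inv x = x).
Proof.
rewrite /beta0_inv.
case: (ltP x (7 / 16)) => [?|?]; first by left.
case: (ltP x (1 / 2)) => [?|?]; first by right; left.
case: (ltP x (17 / 32)) => [?|?]; first by right; right; left.
case: (ltP x (9 / 16)) => [?|?]; first by right; right; right; left.
by do 4 right.
Qed.

Lemma beta0_PLo : is_PLo beta0_fun.
Proof.
apply: (@is_PLoI _ _ beta0_inv).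
- by move=> x /I01E/negP xI; rewrite /beta0_fun xI.
- move=> x /I01E xI; apply/I01E; move/andP: (xI) => [x0 x1].
  by lra5 (beta0_funP xI) (beta0_fun x).
- move=> x /I01E/andP[x0 x1]; apply/I01E.
  by lra5 (beta0_invP x) (beta0_inv x).
- move=> x /I01E xI; move/andP: (xI) => [x0 x1].
  cases5 (beta0_funP xI); generalize dependent (beta0_fun x) => y *;
    lra5 (beta0_invP y) (beta0_inv y).
- move=> x /I01E/andP[x0 x1].
  have yI : 0 <= beta0_inv x <= 1.
    by lra5 (beta0_invP x) (beta0_inv x).
  cases5 (beta0_invP x); generalize dependent (beta0_inv x) => y yI *;
    lra5 (beta0_funP yI) (beta0_fun y).
- move=> x y /I01E xI /I01E yI xy.
  cases5 (beta0_funP xI); generalize dependent (beta0_fun x) => *;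
    lra5 (beta0_funP yI) (beta0_fun y).
exists [:: 7 / 16; 15 / 32; 1 / 2; 9 / 16] => a b a0 ab b1 sab.
have brk c : c \in [:: 7 / 16; 15 / 32; 1 / 2; 9 / 16] -> c < b -> c <= a.
  move=> /sab; rewrite negb_and -!leNgt => /orP[//|] /le_lt_trans h /h.
  by rewrite ltxx.
have aff m c : (forall x, a <= x -> x <= b -> 0 <= x <= 1 ->
    beta0_fun x = m * x + c) -> affine_on `[a, b] beta0_fun.
  move=> H; exists m, c => x; rewrite /= in_itv /= => /andP[ax xb].
  by apply: H => //; rewrite (le_trans a0)//= (le_trans xb).
have [h1|/brk] := leP b (7 / 16).
  by apply: (aff (1) (0)) => x ax xb xI;
  clear aff brk sab; lra5 (beta0_funP xI) (beta0_fun x).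
rewrite !inE eqxx ?orbT => /(_ isT) {}h1.
have [h2|/brk] := leP b (15 / 32).
  by apply: (aff (2) (- (7 / 16))) => x ax xb xI;
  clear aff brk sab; lra5 (beta0_funP xI) (beta0_fun x).
rewrite !inE eqxx ?orbT => /(_ isT) {}h2.
have [h3|/brk] := leP b (1 / 2).
  by apply: (aff (1) (1 / 32)) => x ax xb xI;
  clear aff brk sab; lra5 (beta0_funP xI) (beta0_fun x).
rewrite !inE eqxx ?orbT => /(_ isT) {}h3.
have [h4|/brk] := leP b (9 / 16).
  by apply: (aff (1 / 2) (9 / 32)) => x ax xb xI;
  clear aff brk sab; lra5 (beta0_funP xI) (beta0_fun x).
rewrite !inE eqxx ?orbT => /(_ isT) {}h4.
by apply: (aff (1) (0)) => x ax xb xI;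
  clear aff brk sab; lra5 (beta0_funP xI) (beta0_fun x).
Qed.

Definition alpha : PLo R := MkPLo alpha_PLo.

Definition beta0 : PLo R := MkPLo beta0_PLo.

Definition beta (k : int) : PLo R := (beta0 ^ expgz alpha k)%g.

(* wrZwr_infty, infty_wrZ and Zwr_infty are respectively (≀Z≀)^∞, ^∞(≀Z) and
   (Z≀)^∞. *)
Definition wrZwr_infty : set (PLo R) := generated (range beta).

Definition infty_wrZ : set (PLo R) := generated (beta @` [set i : int | i < 0]).

Definition Zwr_infty : set (PLo R) := generated (range (fun n : nat => beta n%:Z)).

End Generators.

Arguments alpha : clear implicits.
Arguments beta0 : clear implicits.
Arguments beta : clear implicits.
Arguments wrZwr_infty : clear implicits.
Arguments infty_wrZ : clear implicits.
Arguments Zwr_infty : clear implicits.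

(* Main.v *)
Require Import Defs.
From mathcomp Require Import all_boot all_order all_algebra.
From mathcomp Require Import all_classical all_reals all_analysis.
From mathcomp Require Import lra.
Import Order.TTheory GRing.Theory Num.Theory.

(* Call two orbitals that overlap without being nested a chain, and write D(H)
for the elements of H that are the identity near every common fixed point of H;
D(H) contains the commutators because germs at a fixed point are given by
slopes. If a subgroup N has no fixed point on finitely many compact intervals,
then one element of N moves all of them off themselves; this is the source of
all wreath products below. A family (h_i) in which each h_k moves the union of
the supports of the h_i, i < k, off itself under all of its nontrivial powers
satisfies exactly the relations of the iterated wreath product, and the beta_k
form such a family.

With a chain. Let g, h have orbitals (a,b), (c,d) with a < c < b < d, and let
H = <g,h>. Every H-orbit in the component of the support of H around b meets
[c,b]. After passing to a normal subgroup of H inside D(H) that acts trivially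
on as many of the finitely many components as possible while having no fixed
point on this one, there are f and a such that f^a moves the support of f off
itself, so that the f^(a^i), i in Z, are as wanted.

Without chains. Orbitals are nested or disjoint, and strictly nested ones share
no end, for otherwise comparing slopes at the common end produces a chain.
For an ascending tower, let U be the set of points moved by every normal
subgroup that still has all A_n as orbitals. A double commutator
[[z,x],[z,y]] is trivial off U and retains an orbital A_n, which provides a
subgroup L whose elements have their closed orbitals inside the support of L;
in L the h_k are chosen one after the other. For a descending tower, the double
commutators [[z,t],[z,s]] have support inside that of z and again start a
descending tower. A bi-infinite tower is handled by descending inside L and
then ascending in L. *)

Set Implicit Arguments.
Unset Strict Implicit.
Unset Printing Implicit Defensive.

Local Open Scope classical_set_scope.
Local Open Scope ring_scope.

(** * Subgroups of PL_o(I) as groups of increasing maps *)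

Section Basics.
Variable R : realType.
Implicit Types (f g h : PLo R) (x y z : R).

(** The obstacle is that a tower controls an element only on the tower's own orbitals, while the
    wreath product relations need whole supports to be displaced, including the other, unrelated
    orbitals of each signature. These are finitely many, since each contains a break, so finitely
    many choices deal with them. Where they cannot be moved away they are erased by commutators: in
    a double commutator the two inner commutators are arranged to commute on the unwanted set. The
    absence of chains makes this compatible with the tower. An element fixing a point in an orbital
    of another one preserves that orbital and is the identity near its ends, so conjugation by a
    high power of the other element empties any prescribed compact part, and a commutator keeps its
    orbital there. *)

Lemma plM f g x : (f * g)%g x = g (f x). Proof. by []. Qed.
Lemma pl1 x : (1%g : PLo R) x = x. Proof. by []. Qed.
Lemma plK f x : f^-1%g (f x) = x. Proof. exact: PLo_invK. Qed.
Lemma plVK f x : f (f^-1%g x) = x. Proof. exact: PLo_invVK. Qed.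

Lemma pl_out f x : ~~ (0 <= x <= 1) -> f x = x.
Proof.
by move=> xI; case: (PLo_funP f) => fid _ _ _; apply: fid => /I01E; apply/negP.
Qed.

Lemma pl_in f x : 0 <= x <= 1 -> 0 <= f x <= 1.
Proof. by move=> /I01E/(is_PLo_set (PLo_funP f))/I01E. Qed.

Lemma pl_homo f : {homo f : x y / x < y}.
Proof.
move=> x y xy; have [xI|xI] := boolP (0 <= x <= 1); have [yI|yI] := boolP (0 <= y <= 1).
- case: (PLo_funP f) => _ _ + _; apply => //; exact/mem_set/I01E.
- have := pl_in f xI; rewrite (pl_out _ yI); lra.
- have := pl_in f yI; rewrite (pl_out _ xI); lra.
- by rewrite !pl_out.
Qed.

Lemma pl_le f x y : (f x <= f y) = (x <= y).
Proof. exact: (le_mono (@pl_homo f)). Qed.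

Lemma pl_lt f x y : (f x < f y) = (x < y).
Proof. exact: (leW_mono (le_mono (@pl_homo f))). Qed.

Lemma pl_inj f : injective f.
Proof. exact: can_inj (plK f). Qed.

Lemma plV_fix f x : f x = x -> f^-1%g x = x.
Proof. by move=> fx; rewrite -[in LHS]fx plK. Qed.

Lemma plV_fixE f x : (f^-1%g x = x) <-> (f x = x).
Proof. by split=> [H|/plV_fix//]; rewrite -[in LHS]H plVK. Qed.

Lemma plX_fix f x n : f x = x -> (f ^+ n)%g x = x.
Proof. by move=> fx; elim: n => [//|n IH]; rewrite expgSr plM IH. Qed.

Lemma plJ f g x : (f ^ g)%g (g x) = g (f x).
Proof. by rewrite /conjg !plM plK. Qed.

Lemma plJE f g x : (f ^ g)%g x = g (f (g^-1%g x)).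
Proof. by rewrite /conjg !plM. Qed.

Lemma plR f g x : [~ f, g]%g x = (f ^ g)%g (f^-1%g x).
Proof. by []. Qed.

Lemma pl_neq1 f : f <> 1%g -> exists x, f x != x.
Proof.
move=> f1; apply/not_existsP => H; apply: f1; apply: PLo_ext => x.
by apply/eqP/negPn/negP/H.
Qed.

Lemma pl_moved_in f x : f x != x -> 0 <= x <= 1.
Proof. by apply: contraNT => /(pl_out f) ->. Qed.

Lemma subgroup1 (N : set (PLo R)) : is_subgroup N -> N 1%g. Proof. by case. Qed.
Lemma subgroupM (N : set (PLo R)) f g : is_subgroup N -> N f -> N g -> N (f * g)%g.
Proof. by case=> _ + _; apply. Qed.
Lemma subgroupV (N : set (PLo R)) f : is_subgroup N -> N f -> N f^-1%g.
Proof. by case=> _ _; apply. Qed.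
Lemma subgroupX (N : set (PLo R)) f n : is_subgroup N -> N f -> N (f ^+ n)%g.
Proof.
move=> sN Nf; elim: n => [|n IH]; first exact: subgroup1.
by rewrite expgSr; exact: subgroupM.
Qed.
Lemma subgroupJ (N : set (PLo R)) f g : is_subgroup N -> N f -> N g -> N (f ^ g)%g.
Proof.
move=> sN Nf Ng; rewrite /conjg; apply: subgroupM => //; first exact: subgroupV.
exact: subgroupM.
Qed.
Lemma subgroupR (N : set (PLo R)) f g : is_subgroup N -> N f -> N g -> N [~ f, g]%g.
Proof.
move=> sN Nf Ng; rewrite /commg; apply: subgroupM => //; first exact: subgroupV.
exact: subgroupJ.
Qed.

(** Otherwise the N-orbit of y is bounded by z, and its supremum is a common fixed point of N in
    [y, z]. *)
Lemma displace_right (N : set (PLo R)) y z : is_subgroup N ->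
  (forall x, y <= x -> x <= z -> exists2 g, N g & g x <> x) ->
  exists2 g, N g & z < g y.
Proof.
move=> sN fpf; apply: contrapT => H.
have ub g : N g -> g y <= z.
  by move=> Ng; rewrite leNgt; apply/negP => ?; apply: H; exists g.
pose S := [set g y | g in N].
have yS : S y by exists 1%g; [exact: subgroup1|].
have hS : has_sup S.
  split; first by exists y.
  by exists z => _ [g Ng <-]; exact: ub.
have ys : y <= sup S by apply: ub_le_sup => //; case: hS.
have sz : sup S <= z by apply: ge_sup => [|_ [g Ng <-]]; [exists y|exact: ub].
have [g Ng gs] := fpf _ ys sz.
have key m : N m -> ~ m (sup S) < sup S.
  move=> Nm lt; have [|_ [n Nn <-] mn] := @sup_adherent _ S (sup S - m (sup S)) _ hS.
    by rewrite subr_gt0.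
  rewrite opprB addrC subrK in mn.
  have : m^-1%g (n y) <= sup S.
    apply: ub_le_sup; first by case: hS.
    by exists (n * m^-1)%g => //; apply: subgroupM => //; exact: subgroupV.
  by rewrite -(pl_le m) plVK leNgt mn.
apply: gs; apply/eqP; rewrite eq_le !leNgt; apply/andP; split; apply/negP.
  move=> lt; apply: (key g^-1%g); first exact: subgroupV.
  by rewrite -(pl_lt g) plVK.
by move=> lt; apply: (key g).
Qed.

End Basics.

(** * Displacing finitely many compact intervals at once *)

Section Displacement.
Variable R : realType.
Implicit Types (f g h : PLo R) (x y z : R) (N : set (PLo R)) (p : R * R).

Definition fixfree N p : Prop :=
  forall x, p.1 <= x -> x <= p.2 -> exists2 g, N g & g x <> x.

Definition displaces f p : Prop := p.2 < f p.1 \/ f p.2 < p.1.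

(** A common fixed point beyond p is fixed by the increasing map d, so it cannot lie between p and
    the image of p. *)
Lemma fixfree_hull N p (d : PLo R) : is_subgroup N -> N d -> p.1 <= p.2 -> fixfree N p ->
  fixfree N (Num.min p.1 (d p.1), Num.max p.2 (d p.2)).
Proof.
move=> sN Nd pp fp x /= px xp; apply: contrapT => H.
have xfix g : N g -> g x = x.
  by move=> Ng; apply: contrapT => gx; apply: H; exists g.
have dx := xfix _ Nd.
have [x1|x1] := leP p.1 x; first have [x2|x2] := leP x p.2.
- by have [g Ng gx] := fp _ x1 x2; apply: gx; exact: xfix.
- move: xp; rewrite le_max leNgt x2 /= => xp.
  by move: xp; rewrite -dx pl_le leNgt x2.
- move: px; rewrite ge_min leNgt x1 /= => px.
  by move: px; rewrite -dx pl_le leNgt x1.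
Qed.

(** Induction on the number of intervals. Some c moves the first interval to the right; if d
    displaces the hull of every other p with its images under c and its inverse, then both [d * c]
    and [c^-1 * d] displace p. One of the two products displaces the first interval as well,
    depending on the direction in which d moves y. *)
Lemma displace_all N (l : seq (R * R)) : is_subgroup N ->
  (forall p, p \in l -> p.1 <= p.2 /\ fixfree N p) ->
  exists2 g, N g & forall p, p \in l -> displaces g p.
Proof.
move=> sN; elim: {l}(size l) {-2}l (leqnn (size l)) => [|n IH] [|[y z] l] //= sl Hl;
  try by exists 1%g; [exact: subgroup1|].
have [/= yz fyz] := Hl (y, z) (mem_head _ _).
have [c Nc cyz] := displace_right sN fyz.
pose hull p : R * R := (Num.min p.1 (Num.min (c p.1) (c^-1%g p.1)),
  Num.max p.2 (Num.max (c p.2) (c^-1%g p.2))).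
have [|p|d Nd dl] := IH [seq hull p | p <- l]; first by rewrite size_map.
  case/mapP => q ql ->; have [|q12 fq] := Hl q; first by rewrite inE ql orbT.
  split; first by rewrite /= ge_min le_max q12.
  move=> x; rewrite /= !ge_min !le_max => x1 x2.
  have f1 := fixfree_hull sN Nc q12 fq.
  have f2 := fixfree_hull sN (subgroupV sN Nc) q12 fq.
  apply: contrapT => H.
  have xfix g : N g -> g x = x.
    by move=> Ng; apply: contrapT => gx; apply: H; exists g.
  have no1 : ~ (Num.min q.1 (c q.1) <= x <= Num.max q.2 (c q.2)).
    by move=> /andP[xa xb]; have [g Ng []] := f1 _ xa xb; exact: xfix.
  have no2 : ~ (Num.min q.1 (c^-1%g q.1) <= x <= Num.max q.2 (c^-1%g q.2)).
    by move=> /andP[xa xb]; have [g Ng []] := f2 _ xa xb; exact: xfix.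
  have cx := xfix _ Nc; have vx := xfix _ (subgroupV sN Nc).
  have e1 w : (c w <= x) = (w <= x) by rewrite -[in LHS]cx pl_le.
  have e2 w : (x <= c w) = (x <= w) by rewrite -[in LHS]cx pl_le.
  have e3 w : (c^-1%g w <= x) = (w <= x) by rewrite -[in LHS]vx pl_le.
  have e4 w : (x <= c^-1%g w) = (x <= w) by rewrite -[in LHS]vx pl_le.
  apply: no1; rewrite ge_min le_max !(e1,e2,e3,e4) in x1 x2 *.
  by rewrite !orbb in x1 x2 *; rewrite x1 x2.
have dl' p : p \in l -> displaces (d * c)%g p /\ displaces (c^-1 * d)%g p.
  move=> pl; have := dl (hull p) (map_f _ pl); rewrite /displaces /hull /=.
  rewrite !gt_max !lt_min.
  set u := Num.min _ _; set v := Num.max _ _.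
  have u1 : u <= p.1 by rewrite /u ge_min lexx.
  have u2 : u <= c^-1%g p.1 by rewrite /u !ge_min lexx !orbT.
  have v1 : p.2 <= v by rewrite /v le_max lexx.
  have v2 : c^-1%g p.2 <= v by rewrite /v !le_max lexx !orbT.
  rewrite -(pl_le d) in u1; rewrite -(pl_le d) in u2.
  rewrite -(pl_le d) in v1; rewrite -(pl_le d) in v2.
  case=> /and3P[h1 h2 h3]; split; [left|left|right|right].
  - by rewrite -[X in X < _](plVK c) pl_lt (lt_le_trans h3).
  - exact: (lt_le_trans h1).
  - by rewrite -[X in _ < X](plVK c) pl_lt (le_lt_trans _ h3).
  - exact: (le_lt_trans _ h1).
have [yd|yd] := leP y (d y).
  exists (d * c)%g; first exact: subgroupM.
  move=> p; rewrite inE => /orP[/eqP ->|/dl'[]//].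
  by left; rewrite /= (lt_le_trans cyz)// pl_le.
exists (c^-1 * d)%g; first by apply: subgroupM => //; exact: subgroupV.
move=> p; rewrite inE => /orP[/eqP ->|/dl'[]//].
by right; rewrite /= (lt_trans _ yd)// pl_lt -(pl_lt c) plVK.
Qed.

Lemma displaces_pow f p x n : p.1 <= p.2 -> displaces f p -> p.1 <= x <= p.2 ->
  ~~ (p.1 <= (f ^+ n.+1)%g x <= p.2).
Proof.
move=> pp [H|H] /andP[x1 x2]; rewrite negb_and -!ltNge; apply/orP.
  right; elim: n => [|n IH]; first by rewrite expg1 (lt_le_trans H)// pl_le.
  rewrite expgSr plM (lt_trans H)// pl_lt; exact: le_lt_trans IH.
left; elim: n => [|n IH]; first by rewrite expg1 (le_lt_trans _ H)// pl_le.
rewrite expgSr plM (lt_trans _ H)// pl_lt; exact: lt_le_trans IH _.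
Qed.

End Displacement.

(** * Orbitals of elements and components of supports of subgroups *)

Section Orbitals.
Variable R : realType.
Implicit Types (f g h : PLo R) (x y z a b : R) (S N : set (PLo R)).

(* For S = [set g] this says that (a, b) is an orbital of g; for a subgroup S,
   that it is a component of its support. *)
Definition orb S a b : Prop :=
  [/\ a < b, forall g, S g -> g a = a /\ g b = b &
      forall x, a < x -> x < b -> exists2 g, S g & g x <> x].

Lemma orb_ex S x : (exists2 g, S g & g x <> x) ->
  exists a b, [/\ orb S a b, a < x & x < b].
Proof.
move=> [g0 Sg0 gx0].
have xI : 0 <= x <= 1 by apply: (@pl_moved_in _ g0); apply/eqP.
(* All elements are the identity off I, so -1 and 2 are common fixed points and the sets A and B
   below are nonempty. *)
have pI (f : PLo R) : f (-1) = -1 by apply: pl_out; lra.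
have qI (f : PLo R) : f 2 = 2 by apply: pl_out; lra.
pose F := [set y | forall g, S g -> g y = y].
pose A := [set y | F y /\ y <= x]; pose B := [set y | F y /\ x <= y].
have hA : has_sup A by split; [exists (-1); split => //; lra|exists x => y []].
have hB : has_inf B by split; [exists 2; split => //; lra|exists x => y []].
have Asup y : A y -> y <= sup A by move=> ?; apply: ub_le_sup => //; case: hA.
have Binf y : B y -> inf B <= y by move=> ?; apply: ge_inf => //; case: hB.
have FA : F (sup A).
  have key g : (forall y, F y -> g y = y) -> sup A <= g (sup A).
    move=> Fg; apply: ge_sup => [|y [Fy yx]]; first by case: hA.
    by rewrite -[y]Fg// pl_le; exact: Asup.
  move=> g Sg; apply/eqP; rewrite eq_le key ?andbT; last by move=> y; exact.
  by rewrite -(pl_le g^-1%g) plK key// => y Fy; apply: plV_fix; exact: Fy.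
have FB : F (inf B).
  have key g : (forall y, F y -> g y = y) -> g (inf B) <= inf B.
    move=> Fg; apply: lb_le_inf => [|y [Fy yx]]; first by case: hB.
    by rewrite -[y]Fg// pl_le; exact: Binf.
  move=> g Sg; apply/eqP; rewrite eq_le key ?andTb; last by move=> y; exact.
  by rewrite -(pl_le g^-1%g) plK key// => y Fy; apply: plV_fix; exact: Fy.
have Ax : sup A < x.
  rewrite lt_neqAle; apply/andP; split.
    by apply/eqP => e; apply: gx0; rewrite -e; exact: FA.
  by apply: ge_sup => [|y []//]; case: hA.
have xB : x < inf B.
  rewrite lt_neqAle; apply/andP; split.
    by apply/eqP => e; apply: gx0; rewrite e; exact: FB.
  by apply: lb_le_inf => [|y []//]; case: hB.
exists (sup A), (inf B); split => //; split.
- exact: lt_trans xB.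
- by move=> g Sg; split; [exact: FA|exact: FB].
- move=> y y1 y2; apply: contrapT => H.
  have Fy : F y by move=> g Sg; apply: contrapT => gy; apply: H; exists g.
  have [yx|/ltW yx] := leP y x.
    by have := Asup y (conj Fy yx); rewrite leNgt y1.
  by have := Binf y (conj Fy yx); rewrite leNgt y2.
Qed.

Lemma orb_uniq S a b c d : orb S a b -> orb S c d -> a < d -> c < b ->
  a = c /\ b = d.
Proof.
move=> [ab Fab mab] [cd Fcd mcd] ad cb; split.
  have [h|h|//] := ltgtP a c.
    by have [g /Fcd[gc _] []] := mab _ h cb.
  by have [g /Fab[ga _] []] := mcd _ h ad.
have [h|h|//] := ltgtP b d.
  by have [g /Fab[_ gb] []] := mcd _ cb h.
by have [g /Fcd[_ gd] []] := mab _ ad h.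
Qed.

Lemma orb_sub01 S a b : orb S a b -> 0 <= a /\ b <= 1.
Proof.
move=> [ab _ m]; have mI x : a < x -> x < b -> 0 <= x <= 1.
  by move=> ax xb; have [g _ /eqP] := m _ ax xb; exact: pl_moved_in.
split; rewrite leNgt; apply/negP => h.
  have [b0|b0] := leP b 0; first by have := mI ((a + b) / 2); lra.
  by have := mI (a / 2); lra.
have [a1|a1] := leP 1 a; first by have := mI ((a + b) / 2); lra.
by have := mI ((1 + b) / 2); lra.
Qed.

Lemma orb_in S a b g x : orb S a b -> S g -> a < x < b -> a < g x < b.
Proof. by move=> [_ F _] /F[ga gb]; rewrite -{2}ga -{2}gb !pl_lt. Qed.

Lemma orb1P f a b : orb [set f] a b <->
  [/\ a < b, f a = a, f b = b & forall x, a < x -> x < b -> f x <> x].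
Proof.
split=> [[ab /(_ f erefl)[fa fb] m]|[ab fa fb m]]; split => //.
- by move=> x ax xb; have [g ->] := m _ ax xb.
- by move=> g ->.
- by move=> x ax xb; exists f => //; exact: m.
Qed.

(** A map that is affine on the closure of an orbital and fixes both ends would be the identity
    there. This is the source of finiteness: an element has at most as many orbitals as breaks. *)
Lemma breaks f : exists s : seq R, forall a b, orb [set f] a b ->
  exists2 t, t \in s & a < t < b.
Proof.
case: (PLo_funP f) => _ _ _ [s fs]; exists s => a b fab.
have [a0 b1] := orb_sub01 fab; have /orb1P[ab fa fb m] := fab.
apply: contrapT => H; have [|m0 [c fE]] := fs a b a0 (ltW ab) b1.
  by move=> t ts; apply/negP => tab; apply: H; exists t.
have ea := fE a; have eb := fE b; have ec := fE ((a + b) / 2).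
rewrite /= !in_itv /= in ea eb ec.
have {}ea : a = m0 * a + c by rewrite -ea ?fa// lexx ltW.
have {}eb : b = m0 * b + c by rewrite -eb ?fb// lexx ltW.
have {}ec : f ((a + b) / 2) = m0 * ((a + b) / 2) + c by apply: ec; lra.
by apply: (m ((a + b) / 2)); lra.
Qed.

End Orbitals.

(** * Germs *)

Section Germs.
Variable R : realType.
Implicit Types (f g h w : PLo R) (x y z a b s m : R) (S N H : set (PLo R)).

Definition side s : Prop := s = 1 \/ s = -1.

(* s is the side of a on which the slope of f is m: 1 for right, -1 for left. *)
Definition germ s f a m : Prop :=
  exists2 e, 0 < e & forall y, 0 <= y -> y <= e -> f (a + s * y) = a + s * m * y.

Lemma gap (l : seq R) a : exists2 e, 0 < e & forall t, t \in l -> t != a -> e <= `|t - a|.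
Proof.
elim: l => [|t l [e e0 IH]]; first by exists 1.
have [->|ta] := eqVneq t a.
  by exists e => // u; rewrite inE => /orP[/eqP ->|/IH//]; rewrite eqxx.
have ta0 : 0 < `|t - a| by rewrite normr_gt0 subr_eq0.
exists (Num.min e `|t - a|); first by rewrite lt_min e0.
by move=> u; rewrite inE ge_min => /orP[/eqP ->|/IH/[apply] ->//]; rewrite lexx orbT.
Qed.

Lemma germ_fix s f a m : germ s f a m -> f a = a.
Proof. by case=> e e0 /(_ 0 (lexx _) (ltW e0)); rewrite !mulr0 addr0. Qed.

Lemma germ_gt0 s f a m : side s -> germ s f a m -> 0 < m.
Proof.
move=> ss fam; have fa := germ_fix fam; case: fam => e e0 /(_ e (ltW e0) (lexx _)) fe.
case: ss fe => -> fe.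
  have : f a < f (a + 1 * e) by rewrite pl_lt; lra.
  by rewrite fe fa; nra.
have : f (a + -1 * e) < f a by rewrite pl_lt; lra.
by rewrite fe fa; nra.
Qed.

Lemma germ_ex s f a : side s -> f a = a -> exists m, germ s f a m.
Proof.
move=> ss fa; case: (PLo_funP f) => _ _ _ [l fl].
(* 0 and 1 count as breaks, because there f passes to its extension by the identity. *)
have [e e0 le] := gap (0 :: 1 :: l) a.
have leg t : t \in l -> ~~ (a < t < a + e) /\ ~~ (a - e < t < a).
  move=> tl; have [->|ta] := eqVneq t a; first by rewrite !ltxx andbF.
  have := le t; rewrite !inE tl !orbT => /(_ isT ta) et.
  by split; apply/negP; [case: ger0P et; lra|case: ger0P et; lra].
have e_0 : a != 0 -> e <= `|a|.
  by move=> a0; have := le 0; rewrite !inE eqxx sub0r normrN => /(_ isT); apply; rewrite eq_sym.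
have e_1 : a != 1 -> e <= `|1 - a|.
  by move=> a0; have := le 1; rewrite !inE eqxx orbT => /(_ isT); apply; rewrite eq_sym.
have out : (forall y, 0 < y -> y <= e / 2 -> ~~ (0 <= a + s * y <= 1)) ->
    exists m, germ s f a m.
  move=> Ho; exists 1, (e / 2); first lra.
  move=> y; rewrite le_eqVlt => /orP[/eqP <- _|y0 ye]; first by rewrite !mulr0 addr0.
  by rewrite mulr1 pl_out// Ho.
have aff c : 0 <= c -> c + e <= 1 -> (forall t, t \in l -> ~~ (c < t < c + e)) ->
    exists m n : R, forall x, c <= x -> x <= c + e -> f x = m * x + n.
  move=> c0 ce lc; have [|m [n fE]] := fl c (c + e) c0 _ ce lc; first by lra.
  by exists m, n => x cx xe; apply: fE; rewrite /= in_itv /= cx xe.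
case: ss => s1; subst s.
  have [a0|a0] := ltP a 0.
    by apply: out => y y0 ye; have := e_0 (negbT (lt_eqF a0)); rewrite ltr0_norm//; lra.
  have [a1|a1] := leP 1 a.
    by apply: out => y y0 ye; lra.
  have := e_1 (negbT (lt_eqF a1)); rewrite gtr0_norm ?subr_gt0// => ea.
  have [|t tl|m [n fE]] := aff a a0; first lra.
    by case: (leg t tl).
  exists m, e => // y y0 ye; have := fE a (lexx _); have := fE (a + 1 * y).
  rewrite !mul1r fa => -> //; [|lra|lra].
  by move=> H; rewrite mulrDr -addrA [m * y + n]addrC addrA -H//; lra.
have [a0|a0] := ltP 1 a.
  by apply: out => y y0 ye; have := e_1 (negbT (gt_eqF a0)); rewrite ltr0_norm ?subr_lt0//; lra.
have [a1|a1] := leP a 0.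
  by apply: out => y y0 ye; lra.
have := e_0 (negbT (gt_eqF a1)); rewrite gtr0_norm// => ea.
have [||t tl|m [n fE]] := aff (a - e); [lra|lra| |].
  by rewrite subrK; case: (leg t tl).
exists m, e => // y y0 ye; have Ha := fE a; have Hy := fE (a + -1 * y).
have {}Ha : f a = m * a + n by apply: Ha; lra.
by rewrite Hy; [rewrite fa in Ha; lra|lra|lra].
Qed.

Lemma germ_uniq s f a m n : side s -> germ s f a m -> germ s f a n -> m = n.
Proof.
move=> ss [e e0 fe] [d d0 fd]; pose y := Num.min e d.
have y0 : 0 < y by rewrite lt_min e0.
have := fe y (ltW y0); rewrite fd ?(ltW y0)// ?ge_min ?lexx ?orbT// => /(_ isT).
move=> /addrI/(mulIf (lt0r_neq0 y0)) H.
by case: ss H => ->; lra.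
Qed.

Lemma germM s f g a m n : side s -> germ s f a m -> germ s g a n -> germ s (f * g)%g a (m * n).
Proof.
move=> ss fm [d d0 gd]; have m0 := germ_gt0 ss fm; case: fm => e e0 fe.
exists (Num.min e (d / m)); first by rewrite lt_min e0 divr_gt0.
move=> y y0; rewrite le_min => /andP[ye yd].
rewrite plM fe// -mulrA gd; first by rewrite -!mulrA; congr (_ + _ * _); rewrite mulrCA.
  by rewrite mulr_ge0// ltW.
by rewrite mulrC -ler_pdivlMr.
Qed.

Lemma germ1 s a : germ s (1%g : PLo R) a 1.
Proof. by exists 1 => // y _ _; rewrite mulr1. Qed.

Lemma germV s f a m : side s -> germ s f a m -> germ s f^-1%g a m^-1.
Proof.
move=> ss fm; have [n fn] := germ_ex ss (plV_fix (germ_fix fm)).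
suff -> : m^-1 = n by [].
have := germM ss fm fn; rewrite mulgV => /(germ_uniq ss (germ1 s a)) e.
have := lt0r_neq0 (germ_gt0 ss fm) => m0.
by rewrite -[LHS]mulr1 e mulKf.
Qed.

Lemma germX s f a m n : side s -> germ s f a m -> germ s (f ^+ n)%g a (m ^+ n).
Proof.
move=> ss fm; elim: n => [|n IH]; first exact: germ1.
by rewrite expgSr exprSr; exact: germM.
Qed.

Lemma germJ s f w a m : side s -> germ s f a m -> w a = a -> germ s (f ^ w)%g a m.
Proof.
move=> ss fm wa; have [k wk] := germ_ex ss wa.
have := germM ss (germV ss wk) (germM ss fm wk); rewrite mulrCA mulVf ?mulr1//.
by rewrite lt0r_neq0// (germ_gt0 ss wk).
Qed.

Lemma germR s f w a : side s -> f a = a -> w a = a -> germ s [~ f, w]%g a 1.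
Proof.
move=> ss fa wa; have [k fk] := germ_ex ss fa.
have := germM ss (germV ss fk) (germJ ss fk wa); rewrite mulVf//.
by rewrite lt0r_neq0// (germ_gt0 ss fk).
Qed.

Lemma germ1_id s f a : germ s f a 1 ->
  exists2 e, 0 < e & forall y, 0 <= y -> y <= e -> f (a + s * y) = a + s * y.
Proof. by case=> e e0 fe; exists e => // y y0 ye; rewrite fe// mulr1. Qed.

Lemma germ_move s f a m : side s -> germ s f a m -> m != 1 ->
  exists2 e, 0 < e & forall y, 0 < y -> y <= e -> f (a + s * y) <> a + s * y.
Proof.
move=> ss [e e0 fe] m1; exists e => // y y0 ye.
rewrite fe ?(ltW y0)// => /addrI/(mulIf (lt0r_neq0 y0)) H.
by move/eqP: m1; apply; case: ss H => ->; lra.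
Qed.

(** The common kernel of the one-sided slope homomorphisms at the common fixed points of H; slope 1
    means identity near the point on that side. *)
Definition derv H : set (PLo R) := [set f : PLo R | H f /\
  forall s x, side s -> (forall w, H w -> w x = x) -> germ s f x 1].

Lemma derv_sub H f : derv H f -> H f. Proof. by case. Qed.

Lemma derv_subgroup H : is_subgroup H -> is_subgroup (derv H).
Proof.
move=> sH; split; first by split; [exact: subgroup1|move=> *; exact: germ1].
  move=> f g [Hf f1] [Hg g1]; split; first exact: subgroupM.
  by move=> s x ss xH; rewrite -[1]mulr1; apply: germM => //; [exact: f1|exact: g1].
move=> f [Hf f1]; split; first exact: subgroupV.
by move=> s x ss xH; rewrite -[1]invr1; apply: germV => //; exact: f1.
Qed.

Definition normal_in H N : Prop := forall f w, N f -> H w -> N (f ^ w)%g.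

Lemma derv_normal H : is_subgroup H -> normal_in H (derv H).
Proof.
move=> sH f w [Hf f1] Hw; split; first exact: subgroupJ.
by move=> s x ss xH; apply: germJ => //; [exact: f1|exact: xH].
Qed.

Lemma derv_comm H f g : is_subgroup H -> H f -> H g -> derv H [~ f, g]%g.
Proof.
move=> sH Hf Hg; split; first exact: subgroupR.
by move=> s x ss xH; apply: germR => //; exact: xH.
Qed.

Lemma orb_germ_l f a b m : orb [set f] a b -> germ 1 f a m -> m != 1.
Proof.
move=> /orb1P[ab fa fb mv] fm; apply/eqP => m1; subst m; have [e e0 fe] := germ1_id fm.
pose y := Num.min e ((b - a) / 2).
have y0 : 0 < y by rewrite lt_min e0; lra.
have ye : y <= e by rewrite ge_min lexx.
have yb : y <= (b - a) / 2 by rewrite ge_min lexx orbT.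
have := fe y (ltW y0) ye; rewrite mul1r; apply: mv; lra.
Qed.

Lemma orb_germ_r f a b m : orb [set f] a b -> germ (-1) f b m -> m != 1.
Proof.
move=> /orb1P[ab fa fb mv] fm; apply/eqP => m1; subst m; have [e e0 fe] := germ1_id fm.
pose y := Num.min e ((b - a) / 2).
have y0 : 0 < y by rewrite lt_min e0; lra.
have ye : y <= e by rewrite ge_min lexx.
have yb : y <= (b - a) / 2 by rewrite ge_min lexx orbT.
have := fe y (ltW y0) ye; apply: mv; lra.
Qed.

Lemma orb_from_l f a b m : a < b -> germ 1 f a m -> m != 1 -> f b = b ->
  exists2 c, orb [set f] a c & c <= b.
Proof.
move=> ab fm m1 fb; have fa := germ_fix fm.
have [e e0 fe] := germ_move (or_introl erefl) fm m1.
pose y := Num.min e (b - a).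
have y0 : 0 < y by rewrite lt_min e0; lra.
have ye : y <= e by rewrite ge_min lexx.
have yb : y <= b - a by rewrite ge_min lexx orbT.
have fy := fe _ y0 ye; rewrite mul1r in fy.
have [|c [d [fcd cy yd]]] := @orb_ex _ [set f] (a + y); first by exists f.
have /orb1P[_ fc _ mv] := fcd.
have ac : a <= c by rewrite leNgt; apply/negP => ca; apply: (mv a) => //; lra.
have -> : a = c.
  apply/eqP; rewrite eq_le ac leNgt; apply/negP => lt.
  by apply: (fe (c - a)); [lra|lra|]; rewrite mul1r addrC subrK.
exists d => //; rewrite leNgt; apply/negP => bd; apply: (mv b) => //; lra.
Qed.

Lemma orb_from_r f a b m : a < b -> germ (-1) f b m -> m != 1 -> f a = a ->
  exists2 c, orb [set f] c b & a <= c.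
Proof.
move=> ab fm m1 fa; have fb := germ_fix fm.
have [e e0 fe] := germ_move (or_intror erefl) fm m1.
pose y := Num.min e (b - a).
have y0 : 0 < y by rewrite lt_min e0; lra.
have ye : y <= e by rewrite ge_min lexx.
have yb : y <= b - a by rewrite ge_min lexx orbT.
have fy := fe _ y0 ye; rewrite mulN1r in fy.
have [|c [d [fcd cy yd]]] := @orb_ex _ [set f] (b - y); first by exists f.
have /orb1P[_ _ fd mv] := fcd.
have db : d <= b by rewrite leNgt; apply/negP => ca; apply: (mv b) => //; lra.
have -> : b = d.
  apply/eqP; rewrite eq_le db andbT leNgt; apply/negP => lt.
  by apply: (fe (b - d)); [lra|lra|]; rewrite mulN1r opprB addrC subrK.
exists c => //; rewrite leNgt; apply/negP => bd; apply: (mv a) => //; lra.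
Qed.

End Germs.

(** * Chains and shared ends *)

Section Dynamics.
Variable R : realType.
Implicit Types (f g h w : PLo R) (x y z a b c d p q s m : R) (S N H G : set (PLo R)).

(** The supremum of the points of [x, y] that f moves to the right is fixed, by monotonicity of
    f. *)
Lemma ivt_right f x y : x < y -> x < f x -> f y < y -> exists p, [/\ x < p, p < y & f p = p].
Proof.
move=> xy fx fy; pose A := [set t | x <= t <= y /\ t < f t].
have Ax : A x by split => //; rewrite lexx ltW.
have hA : has_sup A by split; [exists x|exists y => t [/andP[]]].
have xs : x <= sup A by apply: ub_le_sup => //; case: hA.
have sy : sup A <= y by apply: ge_sup => [|t [/andP[]]]; first by exists x.
set u := sup A in xs sy *.
have fu : f u = u.
  have [lt|lt|//] := ltgtP (f u) u.
    have [|t [/andP[xt ty] tf]] := @sup_adherent _ A (u - f u) _ hA.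
      by rewrite subr_gt0.
    rewrite -/u opprB addrC subrK => ut.
    have tu : t <= u by apply: ub_le_sup => //; [case: hA|split => //; rewrite xt].
    by move: tu; rewrite -(pl_le f) leNgt (lt_trans ut tf).
  have uy : u < y.
    by rewrite lt_neqAle sy andbT; apply/eqP => uy; move: lt; rewrite uy; lra.
  pose t := Num.min ((u + f u) / 2) ((u + y) / 2).
  have ut : u < t by rewrite lt_min; apply/andP; split; lra.
  have t1 : t <= (u + f u) / 2 by rewrite ge_min lexx.
  have t2 : t <= (u + y) / 2 by rewrite ge_min lexx orbT.
  have ft : f u < f t by rewrite pl_lt.
  have : t <= u by apply: ub_le_sup; [case: hA|split; [apply/andP; split; lra|lra]].
  by rewrite leNgt ut.
exists u; split => //; rewrite lt_neqAle ?xs ?sy ?andbT; apply/eqP => e.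
  by move: fx; rewrite e fu ltxx.
by move: fy; rewrite -e fu ltxx.
Qed.

Lemma ivt_left f x y : x < y -> f x < x -> y < f y -> exists p, [/\ x < p, p < y & f p = p].
Proof.
move=> xy fx fy; have [||p [xp py fp]] := @ivt_right f^-1%g x y xy.
- by rewrite -(pl_lt f) plVK.
- by rewrite -(pl_lt f) plVK.
- by exists p; split => //; rewrite -[in LHS]fp plVK.
Qed.

Lemma orb_dir f a b : orb [set f] a b ->
  (forall x, a < x -> x < b -> x < f x) \/ (forall x, a < x -> x < b -> f x < x).
Proof.
move=> /orb1P[ab fa fb mv]; pose c := (a + b) / 2.
have key x y : a < x -> x < b -> a < y -> y < b -> x < f x -> y < f y.
  move=> ax xb ay yb xf; have [yf|//|e] := ltgtP (f y) y; last by have := mv _ ay yb.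
  have [xy|xy|e] := ltgtP x y; last by move: xf; rewrite e; lra.
    by have [p [? ? /mv[]]] := ivt_right xy xf yf; lra.
  by have [p [? ? /mv[]]] := ivt_left xy yf xf; lra.
have ac : a < c by rewrite /c; lra.
have cb : c < b by rewrite /c; lra.
have [fc|fc|e] := ltgtP (f c) c; last by have := mv _ ac cb.
  right=> x ax xb; have [//|xf|e] := ltgtP (f x) x; last by have := mv _ ax xb.
  by have := key _ _ ax xb ac cb xf; lra.
by left=> x ax xb; exact: (key c).
Qed.

Lemma orb_V f a b : orb [set f] a b -> orb [set f^-1%g] a b.
Proof.
move=> /orb1P[ab fa fb mv]; apply/orb1P; split => //; try exact: plV_fix.
by move=> x ax xb /plV_fixE; exact: mv.
Qed.

Lemma orb_pow f a b n : orb [set f] a b -> orb [set (f ^+ n.+1)%g] a b.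
Proof.
move=> fab; have /orb1P[ab fa fb mv] := fab.
apply/orb1P; split => //; try exact: plX_fix.
move=> x ax xb; have inn k : a < (f ^+ k)%g x < b.
  elim: k => [|k IH]; first by rewrite ax.
  by rewrite expgSr plM; apply: (orb_in fab).
have [lt|lt] := orb_dir fab; apply/eqP.
  rewrite gt_eqF//; elim: n => [|n IH]; first by rewrite expg1 lt.
  have /andP[? ?] := inn n.+1.
  by rewrite expgSr plM (lt_trans IH)// lt.
rewrite lt_eqF//; elim: n => [|n IH]; first by rewrite expg1 lt.
have /andP[? ?] := inn n.+1.
by rewrite expgSr plM (lt_trans _ IH)// lt.
Qed.

Lemma attract_r f a b p c : orb [set f] a b -> (forall x, a < x -> x < b -> x < f x) ->
  a < p -> c < b -> exists n0, forall n, (n0 <= n)%N -> c < (f ^+ n)%g p.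
Proof.
move=> fab fr ap cb; have /orb1P[ab fa fb mv] := fab.
have [bp|pb] := leP b p.
  exists 0%N => n _; rewrite (lt_le_trans cb)// -[X in X <= _](@plX_fix _ f _ n)//.
  by rewrite pl_le.
have inn k : a < (f ^+ k)%g p < b.
  elim: k => [|k IH]; first by rewrite ap.
  by rewrite expgSr plM; apply: (orb_in fab).
suff [n0 Hn] : exists n0, c < (f ^+ n0)%g p.
  exists n0 => n /subnK <-; elim: (n - n0)%N => [//|k IH].
  have /andP[? ?] := inn (k + n0)%N.
  by rewrite addSn expgSr plM (lt_trans IH)// fr.
apply: contrapT => H; pose A := [set (f ^+ n)%g p | n in [set: nat]].
have ub t : A t -> t <= c.
  by case=> n _ <-; rewrite leNgt; apply/negP => ?; apply: H; exists n.
have Ap : A p by exists 0%N.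
have hA : has_sup A by split; [exists p|exists c].
have ps : p <= sup A by apply: ub_le_sup => //; case: hA.
have sc : sup A <= c by apply: ge_sup => //; exists p.
have lt : f^-1%g (sup A) < sup A by rewrite -(pl_lt f) plVK fr//; lra.
have [|_ [n _ <-]] := @sup_adherent _ A (sup A - f^-1%g (sup A)) _ hA.
  by rewrite subr_gt0.
rewrite opprB addrC subrK -(pl_lt f) plVK => sn.
have : (f ^+ n.+1)%g p <= sup A by apply: ub_le_sup; [case: hA|exists n.+1].
by rewrite expgSr plM leNgt sn.
Qed.

Lemma attract_l f a b p c : orb [set f] a b -> (forall x, a < x -> x < b -> f x < x) ->
  p < b -> a < c -> exists n0, forall n, (n0 <= n)%N -> (f ^+ n)%g p < c.
Proof.
move=> fab fr pb ac; have /orb1P[ab fa fb mv] := fab.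
have [bp|ap] := leP p a.
  exists 0%N => n _; rewrite (le_lt_trans _ ac)// -[X in _ <= X](@plX_fix _ f _ n)//.
  by rewrite pl_le.
have inn k : a < (f ^+ k)%g p < b.
  elim: k => [|k IH]; first by rewrite ap.
  by rewrite expgSr plM; apply: (orb_in fab).
suff [n0 Hn] : exists n0, (f ^+ n0)%g p < c.
  exists n0 => n /subnK <-; elim: (n - n0)%N => [//|k IH].
  have /andP[? ?] := inn (k + n0)%N.
  by rewrite addSn expgSr plM (lt_trans _ IH)// fr.
apply: contrapT => H; pose A := [set (f ^+ n)%g p | n in [set: nat]].
have lb t : A t -> c <= t.
  by case=> n _ <-; rewrite leNgt; apply/negP => ?; apply: H; exists n.
have Ap : A p by exists 0%N.
have hA : has_inf A by split; [exists p|exists c].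
have ps : inf A <= p by apply: ge_inf => //; case: hA.
have sc : c <= inf A by apply: lb_le_inf => //; exists p.
have lt : inf A < f^-1%g (inf A) by rewrite -(pl_lt f) plVK fr//; lra.
have [|_ [n _ <-]] := @inf_adherent _ A (f^-1%g (inf A) - inf A) _ hA.
  by rewrite subr_gt0.
rewrite addrC subrK -(pl_lt f) plVK => sn.
have : inf A <= (f ^+ n.+1)%g p by apply: ge_inf; [case: hA|exists n.+1].
by rewrite expgSr plM leNgt sn.
Qed.

Definition chain G : Prop := exists g h a b c d,
  [/\ G g, G h, orb [set g] a b, orb [set h] c d & [/\ a < c, c < b & b < d]].

Lemma pow_small (t c : R) : 0 < t -> t < 1 -> 0 < c -> exists n, t ^+ n < c.
Proof.
move=> t0 t1 c0; pose u := t^-1 - 1.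
have u0 : 0 < u by rewrite subr_gt0 invf_gt1.
have vt : t^-1 = 1 + u by rewrite /u addrC subrK.
have B n : 1 + n%:R * u <= t^-1 ^+ n.
  rewrite vt; elim: n => [|n IH]; first by rewrite mul0r addr0 expr0.
  have u1 : 0 <= 1 + u by rewrite addr_ge0// ltW.
  have n0 : 0 <= n%:R * u * u by rewrite !mulr_ge0 ?ler0n// ltW.
  have := ler_wpM2l u1 IH; rewrite -exprS -natr1; apply: le_trans.
  by move: n0; generalize (n%:R : R) => k; lra.
have [n Hn] : exists n, c^-1 / u < n%:R.
  by exists (Num.bound (c^-1 / u)); apply: archi_boundP; rewrite divr_ge0 ?invr_ge0 ?ltW.
exists n; rewrite -[X in _ < X]invrK -[X in X < _]invrK ltf_pV2 ?posrE ?invr_gt0 ?exprn_gt0//.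
rewrite -exprVn; apply: lt_le_trans (B n).
by rewrite ltr_pdivrMr// in Hn; lra.
Qed.

(* A high power of g or of its inverse makes the product with h move points near e
   in the direction opposite to that in which h moves q. *)
Lemma shared_fix s g h e q tg th : side s -> germ s g e tg -> germ s h e th ->
  tg != 1 -> g q = q -> 0 < s * (q - e) -> h q <> q ->
  exists (g' : PLo R) n p, [/\ g' = g \/ g' = g^-1%g, 0 < s * (p - e),
    s * (p - e) < s * (q - e) & (g' ^+ n * h)%g p = p].
Proof.
move=> ss gg gh tg1 gq eq hq; have tg0 := germ_gt0 ss gg; have th0 := germ_gt0 ss gh.
have key g' n : (g' = g \/ g' = g^-1%g) -> forall t, germ s g' e t ->
    0 < (s * (h q - q)) * (1 - t ^+ n * th) ->
    exists (g' : PLo R) n p, [/\ g' = g \/ g' = g^-1%g, 0 < s * (p - e),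
    s * (p - e) < s * (q - e) & (g' ^+ n * h)%g p = p].
  move=> g'g t g't H; exists g', n.
  have fq : (g' ^+ n * h)%g q = h q.
    by rewrite plM plX_fix//; case: g'g => -> //; exact: plV_fix.
  have [d d0] := germM ss (germX n ss g't) gh.
  set m := t ^+ n * th in H *; set f := (g' ^+ n * h)%g in fq *.
  pose y := Num.min d (s * (q - e) / 2).
  have y0 : 0 < y by rewrite lt_min d0; lra.
  have yd : y <= d by rewrite ge_min lexx.
  have yq : y <= s * (q - e) / 2 by rewrite ge_min lexx orbT.
  move=> /(_ _ (ltW y0) yd) fe.
  case: ss => s1; subst s.
    rewrite !mul1r in H yq eq fe |- *.
    have [lt|lt] := ltP 0 (h q - q).
      have m1 : m < 1 by rewrite pmulr_rgt0// subr_gt0 in H.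
      have [|||p [xp py fp]] := @ivt_left f (e + y) q; rewrite ?fe ?fq; try nra.
      by exists p; rewrite !mul1r; split => //; lra.
    have {}lt : h q - q < 0 by rewrite lt_neqAle lt andbT subr_eq0; apply/eqP.
    have m1 : 1 < m by rewrite nmulr_rgt0// subr_lt0 in H.
    have [|||p [xp py fp]] := @ivt_right f (e + y) q; rewrite ?fe ?fq; try nra.
    by exists p; rewrite !mul1r; split => //; lra.
  rewrite !mulN1r in H yq eq fe |- *.
  have [lt|lt] := ltP 0 (- (h q - q)).
    have m1 : m < 1 by rewrite pmulr_rgt0// subr_gt0 in H.
    have [|||p [xp py fp]] := @ivt_left f q (e - y); rewrite ?fe ?fq; try nra.
    by exists p; rewrite !mulN1r; split => //; lra.
  have {}lt : - (h q - q) < 0.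
    by rewrite lt_neqAle lt andbT oppr_eq0 subr_eq0; apply/eqP.
  have m1 : 1 < m by rewrite nmulr_rgt0// subr_lt0 in H.
  have [|||p [xp py fp]] := @ivt_right f q (e - y); rewrite ?fe ?fq; try nra.
  by exists p; rewrite !mulN1r; split => //; lra.
have [g1 [t1 [g1g g1t t1_0 t1_1]]] : exists (g1 : PLo R) t1,
    [/\ g1 = g \/ g1 = g^-1%g, germ s g1 e t1, 0 < t1 & t1 < 1].
  have [lt|lt] := ltP tg 1; first by exists g, tg; split => //; left.
  exists g^-1%g, tg^-1; split; [by right|exact: germV|by rewrite invr_gt0|].
  by rewrite invf_lt1// lt_neqAle eq_sym tg1.
have [lt|lt] := ltP 0 (s * (h q - q)).
  have [n Hn] := pow_small t1_0 t1_1 (c := th^-1) (eq_ind_r is_true th0 (invr_gt0 _)).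
  apply: (key g1 n g1g t1 g1t); rewrite mulr_gt0// subr_gt0.
  by rewrite -ltr_pdivlMr// mul1r.
have {}lt : s * (h q - q) < 0.
  rewrite lt_neqAle lt andbT mulf_eq0 subr_eq0 negb_or; apply/andP; split.
    by case: ss => ->; rewrite ?oppr_eq0 oner_eq0.
  exact/eqP.
have [n Hn] := pow_small t1_0 t1_1 th0.
have g2g : g1^-1%g = g \/ g1^-1%g = g^-1%g.
  by case: g1g => ->; [right|left; rewrite invgK].
apply: (key _ n g2g _ (germV ss g1t)).
rewrite nmulr_rgt0// subr_lt0 exprVn mulrC ltr_pdivlMr ?mul1r//.
exact: exprn_gt0.
Qed.

(** The element f from [shared_fix] fixes a point p of (a, b) and moves b. Its orbital around b
    therefore starts inside (a, b) and ends beyond b. *)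
Lemma shared_l G g h a b d : is_subgroup G -> G g -> G h ->
  orb [set g] a b -> orb [set h] a d -> b < d -> chain G.
Proof.
move=> sG Gg Gh gab had bd; have /orb1P[ab ga gb mg] := gab; have /orb1P[ad ha hd mh] := had.
have s1 : side (1 : R) by left.
have [tg gg] := germ_ex s1 ga; have [th gh] := germ_ex s1 ha.
have [|g' [n [p [g'g]]]] := shared_fix s1 gg gh (orb_germ_l gab gg) gb _ (mh _ ab bd).
  by rewrite mul1r subr_gt0.
rewrite !mul1r => pa pb fp; set f := (g' ^+ n * h)%g in fp.
have Gf : G f.
  by apply: subgroupM => //; apply: subgroupX => //; case: g'g => ->//; exact: subgroupV.
have fb : f b <> b.
  rewrite /f plM plX_fix; first exact: mh.
  by case: g'g => ->//; exact: plV_fix.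
have [|c [e [fce cb be]]] := @orb_ex _ [set f] b; first by exists f.
exists g, f, a, b, c, e; split => //; split => //.
have /orb1P[_ _ _ mf] := fce.
have : p <= c by rewrite leNgt; apply/negP => ?; apply: (mf p) => //; lra.
lra.
Qed.

Lemma shared_r G g h a b c : is_subgroup G -> G g -> G h ->
  orb [set g] a b -> orb [set h] c b -> c < a -> chain G.
Proof.
move=> sG Gg Gh gab had bd; have /orb1P[ab ga gb mg] := gab; have /orb1P[ad ha hd mh] := had.
have s1 : side (-1 : R) by right.
have [tg gg] := germ_ex s1 gb; have [th gh] := germ_ex s1 hd.
have [|g' [n [p [g'g]]]] := shared_fix s1 gg gh (orb_germ_r gab gg) ga _ (mh _ bd ab).
  by rewrite mulN1r opprB subr_gt0.
rewrite !mulN1r => pa pb fp; set f := (g' ^+ n * h)%g in fp.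
have Gf : G f.
  by apply: subgroupM => //; apply: subgroupX => //; case: g'g => ->//; exact: subgroupV.
have fb : f a <> a.
  rewrite /f plM plX_fix; first exact: mh.
  by case: g'g => ->//; exact: plV_fix.
have [|e1 [e2 [fce cb be]]] := @orb_ex _ [set f] a; first by exists f.
exists f, g, e1, e2, a, b; split => //; split => //.
have /orb1P[_ _ _ mf] := fce.
have : e2 <= p by rewrite leNgt; apply/negP => ?; apply: (mf p) => //; lra.
lra.
Qed.

Definition inner f c d : Prop := exists p q,
  [/\ c < p, p <= q, q < d & forall x, c < x -> x < d -> f x <> x -> p < x /\ x < q].

Lemma germ1_inner f c d : c < d -> germ 1 f c 1 -> germ (-1) f d 1 -> inner f c d.
Proof.
move=> cd /germ1_id[e e0 fe] /germ1_id[e' e'0 fe'].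
pose m := (c + d) / 2.
exists (Num.min m (c + e)), (Num.max m (d - e')); split.
- by rewrite lt_min; apply/andP; split; rewrite /m; lra.
- by rewrite ge_min le_max lexx.
- by rewrite gt_max; apply/andP; split; rewrite /m; lra.
- move=> x cx xd fx; rewrite gt_min lt_max.
  split; apply/orP; right; rewrite ltNge; apply/negP => le.
    by apply: fx; have := fe (x - c); rewrite mul1r [c + _]addrC subrK; apply; lra.
  by apply: fx; have := fe' (d - x); rewrite mulN1r opprB [d + (x - d)]addrC subrK; apply; lra.
Qed.

(** An orbital of f containing c would end before w and form a chain with (c, d); likewise for d. A
    slope of f other than 1 at c would give an orbital of f that starts at c and ends by w, hence
    shares one end with (c, d) and is shorter. *)
Lemma laminar_inner G f g c d (w : R) : is_subgroup G -> ~ chain G -> G f -> G g ->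
  orb [set g] c d -> c < w -> w < d -> f w = w -> [/\ f c = c, f d = d & inner f c d].
Proof.
move=> sG lam Gf Gg gcd cw wd fw; have /orb1P[cd gc gd mg] := gcd.
have fc : f c = c.
  apply: contrapT => fc; have [|a [b [fab ac cb]]] := @orb_ex _ [set f] c; first by exists f.
  have /orb1P[_ _ _ mf] := fab.
  have bw : b <= w by rewrite leNgt; apply/negP => ?; apply: (mf w) => //; lra.
  apply: lam; exists f, g, a, b, c, d; split => //; split => //; lra.
have fd : f d = d.
  apply: contrapT => fd; have [|a [b [fab ac cb]]] := @orb_ex _ [set f] d; first by exists f.
  have /orb1P[_ _ _ mf] := fab.
  have bw : w <= a by rewrite leNgt; apply/negP => ?; apply: (mf w) => //; lra.
  apply: lam; exists g, f, c, d, a, b; split => //; split => //; lra.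
split => //; have s1 : side (1 : R) by left.
have s2 : side (-1 : R) by right.
have [m fm] := germ_ex s1 fc; have [n fn] := germ_ex s2 fd.
have m1 : m = 1.
  apply/eqP/negPn/negP => m1; have [e fce ew] := orb_from_l cw fm m1 fw.
  by apply: lam; apply: (shared_l sG Gf Gg fce gcd); lra.
have n1 : n = 1.
  apply/eqP/negPn/negP => n1; have [e fce ew] := orb_from_r wd fn n1 fw.
  by apply: lam; apply: (shared_r sG Gf Gg fce gcd); lra.
by subst m n; exact: germ1_inner.
Qed.

End Dynamics.

(** * Scattering families and iterated wreath products *)

Section Expgz.
Variable gT : groupType.
Local Open Scope group_scope.
Implicit Types (x y : gT) (c d : int).

Lemma expgz_add1 x c : expgz x (c + 1)%R = expgz x c * x.
Proof.
case: c => [n|[|n]]; first by rewrite -PoszD addn1 /= expgSr.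
  by rewrite /= expg1 mulVg.
rewrite (_ : (Negz n.+1 + 1)%R = Negz n); last by rewrite !NegzE -[n.+2]addn1 PoszD opprD addrK.
by rewrite /= [x ^+ n.+2]expgS invgM -mulgA mulVg mulg1.
Qed.

Lemma expgz_sub1 x c : expgz x (c - 1)%R = expgz x c * x^-1.
Proof. by rewrite -{2}[c](subrK 1%R) expgz_add1 -mulgA mulgV mulg1. Qed.

Lemma expgzD x c d : expgz x (c + d)%R = expgz x c * expgz x d.
Proof.
elim/int_rect: d => [|n IH|n IH]; first by rewrite addr0 mulg1.
  by rewrite -addn1 PoszD addrA !expgz_add1 IH mulgA.
by rewrite -addn1 PoszD opprD addrA !expgz_sub1 IH mulgA.
Qed.

Lemma expgzN x c : expgz x (- c)%R = (expgz x c)^-1.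
Proof. by apply: (@mulgI _ (expgz x c)); rewrite -expgzD subrr mulgV. Qed.

End Expgz.

Section Words.
Variable R : realType.
Implicit Types (f g a : PLo R) (x y z : R) (b h : int -> PLo R) (Idx : set int) (k i : int).
Implicit Types (w : seq (int * bool)) (X : set R).

Definition supp f : set R := [set x | f x <> x].

Lemma suppX f x : supp f x -> supp f (f x).
Proof. by move=> fx /pl_inj. Qed.

Lemma suppV f x : supp f^-1%g x <-> supp f x.
Proof. by split => H /plV_fixE; exact: H. Qed.

(** Positive powers suffice, since a negative power is covered by exchanging the two points. Hence
    the translates of X under distinct powers of f are disjoint. *)
Definition scatters f X : Prop := forall x n, X x -> X ((f ^+ n.+1)%g x) -> False.

Lemma scatters_sub f X Y : X `<=` Y -> scatters f Y -> scatters f X.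
Proof. by move=> XY H x n /XY Yx /XY; exact: H. Qed.

Lemma scattersz f X c d x y : scatters f X -> X x -> X y ->
  expgz f c x = expgz f d y -> c = d /\ x = y.
Proof.
move=> fX Xx Xy e.
have {}e : expgz f (c - d) x = y.
  rewrite expgzD expgzN plM -[RHS](plK (expgz f d)) -e -!plM.
  by rewrite -!expgzN -!expgzD addrC.
have [cd|cd] := eqVneq (c - d) 0.
  by move: e; rewrite cd /= => ->; split => //; apply/eqP; rewrite -subr_eq0 cd.
exfalso; move: cd e; case: (c - d) => [[//|n] _ /= e|n _ /= e].
  by apply: (fX x n) => //; rewrite e.
by apply: (fX y n) => //; rewrite -e plVK.
Qed.

Definition below Idx b k : set R := [set x | exists i, [/\ Idx i, i < k & supp (b i) x]].

Definition nested Idx b : Prop :=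
  forall k, Idx k -> b k <> 1%g /\ scatters (b k) (below Idx b k).

Lemma nested_sub Idx Idx' b : Idx `<=` Idx' -> nested Idx' b -> nested Idx b.
Proof.
move=> II nb k /II /nb[bk sk]; split => //; apply: scatters_sub sk.
by move=> x [i [/II Ii ik bi]]; exists i.
Qed.

Definition letter b (l : int * bool) : PLo R := if l.2 then b l.1 else (b l.1)^-1%g.

Definition ev b w : PLo R := foldr (fun l acc => letter b l * acc)%g 1%g w.

Lemma ev_cat b w w' : ev b (w ++ w') = (ev b w * ev b w')%g.
Proof. by elim: w => [|l w IH] /=; rewrite ?mul1g// IH mulgA. Qed.

Definition winv w : seq (int * bool) := rev [seq (l.1, ~~ l.2) | l <- w].

Lemma ev_inv b w : ev b (winv w) = (ev b w)^-1%g.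
Proof.
elim: w => [|[i s] w IH]; first by rewrite invg1.
rewrite /winv /= rev_cons -cats1 ev_cat IH invgM /= mulg1.
by case: s; rewrite /letter //= invgK.
Qed.

Definition word_in Idx w : Prop := forall l, l \in w -> Idx l.1.

Lemma word_cons Idx l w : word_in Idx (l :: w) <-> Idx l.1 /\ word_in Idx w.
Proof.
split=> [H|[H K] l']; first by split => [|l' lw]; apply: H; rewrite inE ?eqxx ?lw ?orbT.
by rewrite inE => /orP[/eqP ->//|]; exact: K.
Qed.

Lemma word_cat Idx w w' : word_in Idx w -> word_in Idx w' -> word_in Idx (w ++ w').
Proof. by move=> H K l; rewrite mem_cat => /orP[/H|/K]. Qed.

Lemma word_inv Idx w : word_in Idx w -> word_in Idx (winv w).
Proof. by move=> H l; rewrite mem_rev => /mapP[l' /H ? ->]. Qed.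

(* Reading w on a point y b_k^c with y below k, the letters other than k act only
   while the current exponent of b_k is 0; sub selects them and lastexp is the
   final exponent. *)
Fixpoint sub k (c : int) w : seq (int * bool) :=
  if w is l :: w' then
    if l.1 == k then sub k (if l.2 then c + 1 else c - 1) w'
    else if c == 0 then l :: sub k c w' else sub k c w'
  else [::].

Fixpoint lastexp k (c : int) w : int :=
  if w is l :: w' then
    lastexp k (if l.1 == k then if l.2 then c + 1 else c - 1 else c) w'
  else c.

Lemma lastexpD k c w : lastexp k c w = c + lastexp k 0 w.
Proof.
elim: w c => [|[i s] w IH] c /=; first by rewrite addr0.
by case: ifP => _; [case: s|]; rewrite IH [in RHS]IH ?add0r ?addrA.
Qed.

Lemma size_sub k c w : (size (sub k c w) <= size w)%N.
Proof.
elim: w c => [//|l w IH] c /=; case: ifP => _; first exact: leqW.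
by case: ifP => _; [rewrite ltnS|exact: leqW].
Qed.

Lemma size_sub_lt k c w : k \in [seq l.1 | l <- w] -> (size (sub k c w) < size w)%N.
Proof.
elim: w c => [//|l w IH] c /=; rewrite inE eq_sym; case: ifP => _ /=.
  by rewrite ltnS size_sub.
by move=> kw; have := IH c kw; case: ifP => _ /= H; [rewrite ltnS|exact: leqW].
Qed.

Lemma sub_in k c w l : l \in sub k c w -> l \in w /\ l.1 != k.
Proof.
elim: w c => [//|l' w IH] c /=; case: ifPn => lk.
  by move=> /IH[lw ?]; rewrite inE lw orbT.
case: ifP => _; last by move=> /IH[lw ?]; rewrite inE lw orbT.
rewrite inE => /orP[/eqP ->|/IH[lw ?]]; last by rewrite inE lw orbT.
by rewrite mem_head.
Qed.

Section Action.
Variables (Idx : set int) (b h : int -> PLo R) (k : int).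
Hypothesis scat : scatters (b k) (below Idx b k).

Lemma letter_off l x : Idx l.1 -> l.1 < k -> ~ below Idx b k x -> letter b l x = x.
Proof.
move=> Il lk Xx; have lx : b l.1 x = x.
  by apply: contrapT => lx; apply: Xx; exists l.1.
by rewrite /letter; case: l.2 => //; exact: plV_fix.
Qed.

Lemma letter_on l x : Idx l.1 -> l.1 < k -> below Idx b k x -> below Idx b k (letter b l x).
Proof.
move=> Il lk Xx; have [lx|lx] := pselect (letter b l x = x); first by rewrite lx.
exists l.1; split => //; move: lx; rewrite /letter; case: l.2 => lx; first exact: suppX.
by apply/suppV; apply: suppX.
Qed.

Lemma ev_off w x : (forall l, l \in w -> Idx l.1 /\ l.1 < k) -> ~ below Idx b k x ->
  ev b w x = x.
Proof.
elim: w => [//|l w IH] H Xx /=; have [Il lk] := H l (mem_head _ _).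
rewrite ?plM letter_off// IH// => l' l'w; by apply: H; rewrite inE l'w orbT.
Qed.

Lemma letterk l c x : l.1 = k ->
  letter b l (expgz (b k) c x) = expgz (b k) (if l.2 then c + 1 else c - 1) x.
Proof. by rewrite /letter => ->; case: l.2; rewrite ?expgz_add1 ?expgz_sub1 plM. Qed.

Lemma ev_act w c y : (forall l, l \in w -> Idx l.1 /\ l.1 <= k) -> below Idx b k y ->
  ev b w (expgz (b k) c y) = expgz (b k) (lastexp k c w) (ev b (sub k c w) y) /\
  below Idx b k (ev b (sub k c w) y).
Proof.
elim: w c y => [//|l w IH] c y H Xy /=; have [Il lk] := H l (mem_head _ _).
have H' l' : l' \in w -> Idx l'.1 /\ l'.1 <= k.
  by move=> l'w; apply: H; rewrite inE l'w orbT.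
have [lk'|lk'] := eqVneq l.1 k; first by rewrite ?plM letterk//; exact: IH.
have {}lk : l.1 < k by rewrite lt_neqAle lk'.
rewrite ?plM; case: eqVneq => [->|c0].
  by rewrite /= ?plM; apply: (IH 0) => //; exact: letter_on.
rewrite letter_off//; first exact: IH.
by move=> X'; have [] := @scattersz _ _ 0 c _ _ scat X' Xy erefl => e; rewrite e eqxx in c0.
Qed.

Lemma ev_far w c z : (forall l, l \in w -> Idx l.1 /\ l.1 <= k) ->
  (forall d, ~ below Idx b k (expgz (b k) d z)) ->
  ev b w (expgz (b k) c z) = expgz (b k) (lastexp k c w) z.
Proof.
move=> H Xz; elim: w c H => [//|l w IH] c H /=; have [Il lk] := H l (mem_head _ _).
have H' l' : l' \in w -> Idx l'.1 /\ l'.1 <= k.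
  by move=> l'w; apply: H; rewrite inE l'w orbT.
have [lk'|lk'] := eqVneq l.1 k; first by rewrite ?plM letterk//; exact: IH.
by rewrite ?plM letter_off//; [exact: IH|rewrite lt_neqAle lk'].
Qed.

End Action.

Lemma ev_only b k w : (forall l, l \in w -> l.1 = k) -> ev b w = expgz (b k) (lastexp k 0 w).
Proof.
move=> H; suff K c : (expgz (b k) c * ev b w)%g = expgz (b k) (lastexp k c w).
  by rewrite -(K 0) mul1g.
elim: w c H => [|l w IH] c H /=; first by rewrite mulg1.
have lk := H l (mem_head _ _); rewrite lk eqxx mulgA.
rewrite -IH; last by move=> l' l'w; apply: H; rewrite inE l'w orbT.
by congr (_ * _)%g; rewrite /letter lk; case: l.2; rewrite ?expgz_add1 ?expgz_sub1.
Qed.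

Lemma expgz_eq1 f c : f <> 1%g -> expgz f c = 1%g -> c = 0.
Proof.
move=> /pl_neq1[x /eqP fx].
have pow n : (f ^+ n.+1)%g x <> x.
  have [|a [b [fab ax xb]]] := @orb_ex _ [set f] x; first by exists f.
  by have /orb1P[_ _ _] := orb_pow n fab; apply.
case: c => [[//|n]|n] /= e; exfalso.
  by apply: (pow n); rewrite e.
by apply: (pow n); have := plVK (f ^+ n.+1)%g x; rewrite e.
Qed.

Lemma max_letter w : w != [::] -> exists2 l, l \in w & forall l', l' \in w -> l'.1 <= l.1.
Proof.
elim: w => [//|l w IH] _; have [->|/IH[m mw mm]] := eqVneq w [::].
  by exists l => [|l']; rewrite inE // => /eqP ->.
have [lm|lm] := leP l.1 m.1.
  exists m => [|l']; rewrite inE ?mw ?orbT// => /orP[/eqP ->//|]; exact: mm.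
exists l => [|l']; rewrite inE ?eqxx// => /orP[/eqP ->//|/mm].
by move=> /le_lt_trans/(_ lm)/ltW.
Qed.

(** Induction on the length. If k is the largest index in w, then w is trivial exactly when k has
    exponent sum 0 and every [sub k c w] is trivial. These conditions mention only the word, and the
    subwords are shorter, so they pass from b to h. *)
Lemma nested_rel Idx b h w : nested Idx b -> nested Idx h -> word_in Idx w ->
  ev b w = 1%g -> ev h w = 1%g.
Proof.
move=> nb nh; elim: {w}(size w) {-2}w (leqnn (size w)) => [|n IH] w.
  by rewrite leqn0 => /nilP ->.
move=> sw Iw bw; have [->//|w0] := eqVneq w [::].
have [m mw mm] := max_letter w0; set k := m.1 in mm.
have Ik : Idx k by exact: Iw.
have [[bk sbk] [hk shk]] := (nb _ Ik, nh _ Ik).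
(* Without a lower letter, [below Idx b k] may be empty and say nothing about the exponent; then the
   infinite order of [b k] is used. *)
have [H|] := pselect (forall l, l \in w -> l.1 = k).
  have := ev_only b H; rewrite bw => /esym/(expgz_eq1 bk) e.
  by rewrite (ev_only h H) e.
move=> /existsNP[l /not_implyP[lw /eqP lk]].
have {}lk : l.1 < k by rewrite lt_neqAle lk mm.
have Hw l' : l' \in w -> Idx l'.1 /\ l'.1 <= k by move=> l'w; split; [exact: Iw|exact: mm].
have [y0 Xy0] : exists y, below Idx b k y.
  have [bl _] := nb _ (Iw _ lw); have [y /eqP yl] := pl_neq1 bl.
  by exists y, l.1; split => //; exact: Iw.
have key c y : below Idx b k y -> lastexp k c w = c /\ ev b (sub k c w) y = y.
  move=> Xy; have [e X'] := ev_act sbk c Hw Xy; rewrite bw in e.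
  by have [e1 e2] := scattersz sbk Xy X' e; split; exact: esym.
have e0 : lastexp k 0 w = 0 by have [] := key 0 _ Xy0.
have Hsub c l' : l' \in sub k c w -> Idx l'.1 /\ l'.1 < k.
  by move=> /sub_in[l'w l'k]; have [? ?] := Hw _ l'w; split => //; rewrite lt_neqAle l'k.
have hsub c : ev h (sub k c w) = 1%g.
  apply: IH.
  - have := @size_sub_lt k c w; rewrite map_f// => /(_ isT) lt.
    by rewrite -ltnS; exact: leq_trans lt sw.
  - by move=> l' /Hsub[].
  - apply: PLo_ext => y; have [Xy|Xy] := pselect (below Idx b k y).
      by have [] := key c y Xy.
    by rewrite (ev_off (@Hsub c) Xy).
apply: PLo_ext => z; rewrite pl1.
have [[d Xd]|H] := pselect (exists d, below Idx h k (expgz (h k) d z)).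
  have [] := ev_act shk (- d) Hw Xd; rewrite hsub pl1 lastexpD e0 addr0 => + _.
  by rewrite expgzN plK.
(* A point whose orbit under [h k] misses [below Idx h k] is moved only by the letters k, and their
   exponents add up to 0. *)
have := @ev_far Idx h k w 0 z Hw; rewrite e0; apply => d Xd.
by apply: H; exists d.
Qed.

End Words.

(** * Groups generated by nested families *)

Section Iso.
Variable R : realType.
Implicit Types (f g a : PLo R) (b h : int -> PLo R) (Idx : set int) (G : set (PLo R)).

Lemma generated_subgroup (X : set (PLo R)) : is_subgroup (generated X).
Proof.
split; first by move=> M [[M1 _ _] _].
  by move=> x y Hx Hy M HM; have [[_ MM _] _] := HM; apply: MM; [exact: Hx|exact: Hy].
by move=> x Hx M HM; have [[_ _ MV] _] := HM; apply: MV; exact: Hx.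
Qed.

Lemma ev_gen b Idx w : word_in Idx w -> generated (b @` Idx) (ev b w).
Proof.
have sG := generated_subgroup (b @` Idx).
elim: w => [_|l w IH /word_cons[Il /IH Gw]]; first exact: subgroup1.
have Gl : generated (b @` Idx) (b l.1) by apply: (@sub_gen_smallest _ _ (b @` Idx)); exists l.1.
have Gl' : generated (b @` Idx) (letter b l).
  by rewrite /letter; case: l.2 => //; exact: (subgroupV sG).
exact: (subgroupM sG Gl' Gw).
Qed.

Lemma generatedE b Idx : generated (b @` Idx) = [set ev b w | w in word_in Idx].
Proof.
apply/seteqP; split=> [|_ [w Iw <-]]; last exact: ev_gen.
apply: smallest_sub => [|_ [i Ii <-]].
  split; first by exists [::].
    by move=> _ _ [w Iw <-] [w' Iw' <-]; exists (w ++ w'); [exact: word_cat|exact: ev_cat].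
  by move=> _ [w Iw <-]; exists (winv w); [exact: word_inv|exact: ev_inv].
exists [:: (i, true)]; last by rewrite /= mulg1.
by move=> l; rewrite inE => /eqP ->.
Qed.

Lemma nested_iso Idx b h : nested Idx b -> nested Idx h ->
  isomorphic (generated (b @` Idx)) (generated (h @` Idx)).
Proof.
move=> nb nh; rewrite !generatedE.
pose P (x : PLo R) w := word_in Idx w /\ ev b w = x.
have /choice[wd wdP] : forall x, exists w', (exists w, P x w) -> P x w'.
  move=> x; have [[w xw]|H] := pselect (exists w, P x w); first by exists w.
  by exists [::] => /H.
have rel b' h' w w' : nested Idx b' -> nested Idx h' -> word_in Idx w -> word_in Idx w' ->
    ev b' w = ev b' w' -> ev h' w = ev h' w'.
  move=> nb' nh' Iw Iw' e; have := @nested_rel R Idx b' h' (w ++ winv w') nb' nh'.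
  rewrite !ev_cat !ev_inv e mulgV => /(_ _ erefl) H.
  apply: (@mulIg _ (ev h' w')^-1%g); rewrite mulgV; apply: H.
  by apply: word_cat => //; exact: word_inv.
have wdE w : word_in Idx w -> P (ev b w) (wd (ev b w)) by move=> Iw; apply: wdP; exists w.
exists (fun x => ev h (wd x)); [split|].
- by move=> _ [w Iw <-]; have [I' _] := wdE _ Iw; exists (wd (ev b w)).
- move=> x y /set_mem[w Iw <-] /set_mem[w' Iw' <-].
  have [I1 e1] := wdE _ Iw; have [I2 e2] := wdE _ Iw' => e.
  by rewrite -e1 -e2; apply: (rel h b).
- move=> _ [w Iw <-]; exists (ev b w); first by exists w.
  by have [I1 e1] := wdE _ Iw; apply: (rel b h).
move=> x y /set_mem[w Iw <-] /set_mem[w' Iw' <-].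
have [I1 e1] := wdE _ Iw; have [I2 e2] := wdE _ Iw'.
have Iww := word_cat Iw Iw'; have [I3 e3] := wdE _ Iww.
rewrite -[RHS]ev_cat -ev_cat; apply: (rel b h) => //; first exact: word_cat.
by rewrite e3 !ev_cat e1 e2.
Qed.

Lemma nested_copy G Idx b h : is_subgroup G -> nested Idx b -> nested Idx h ->
  (forall i, Idx i -> G (h i)) -> contains_copy_of G (generated (b @` Idx)).
Proof.
move=> sG nb nh Gh; exists (generated (h @` Idx)); split.
- exact: generated_subgroup.
- by apply: smallest_sub => // _ [i Ii <-]; exact: Gh.
- exact: nested_iso.
Qed.

Lemma suppJ f a x : supp (f ^ a)%g (a x) <-> supp f x.
Proof. by rewrite /supp /mkset plJ; split => H e; apply: H; [rewrite e|exact: pl_inj e]. Qed.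

Lemma suppJV f a x : supp (f ^ a)%g x <-> supp f (a^-1%g x).
Proof. by rewrite -{1}[x](plVK a) suppJ. Qed.

Lemma scattersJ f a (X Y : set R) : scatters f X -> (forall x, Y x -> X (a^-1%g x)) ->
  scatters (f ^ a)%g Y.
Proof.
move=> fX YX x n /YX Xx /YX; rewrite -conjXg -{1}[x](plVK a) plJ plK.
exact: fX.
Qed.

(** A point moved by f is moved by [f ^ a], so the supports of the conjugates increase with the
    exponent. Everything below k thus lies in the support of the conjugate number k - 1, and
    conjugation reduces the claim to the hypothesis. *)
Lemma conj_nested f a : f <> 1%g -> scatters (f ^ a)%g (supp f) ->
  nested setT (fun i => f ^ expgz a i)%g.
Proof.
move=> f1 sc.
have sub1 x : supp f x -> supp (f ^ a)%g x.
  move=> fx e; apply: (sc x 0%N fx); by rewrite expg1 e.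
have hS i : (f ^ expgz a (i + 1) = (f ^ a) ^ expgz a i)%g.
  by rewrite addrC expgzD conjgM.
have mono (i : int) n x : supp (f ^ expgz a i)%g x -> supp (f ^ expgz a (i + n%:Z))%g x.
  elim: n => [|n IH]; first by rewrite addr0.
  move=> /IH; rewrite -addn1 PoszD addrA hS !(suppJV _ (expgz a (i + n))).
  exact: sub1.
move=> k _; split; first by move=> /eqP; rewrite conjg_eq1 => /eqP.
have -> : (f ^ expgz a k = (f ^ a) ^ expgz a (k - 1))%g by rewrite -hS subrK.
apply: (scattersJ sc) => x [i [_ ik xi]]; apply/suppJV.
have [n ->] : exists n : nat, k - 1 = i + n%:Z.
  exists (absz (k - 1 - i)%R); rewrite gez0_abs; first by rewrite [i + _]addrC subrK.
  by rewrite subr_ge0 lerBrDr lezD1.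
exact: mono.
Qed.

End Iso.

Section Betas.
Variable R : realType.

Lemma supp_beta0 (x : R) : supp (beta0 R) x -> 7 / 16 < x < 9 / 16.
Proof.
rewrite /supp /mkset /= /beta0_fun; case: ifPn => //= /negPn/andP[x0 x1].
case: ltP => // h1; case: ltP => h2; first by move=> h; apply/andP; split; lra.
case: ltP => h3; first by move=> h; apply/andP; split; lra.
by case: ltP => // h4 h; apply/andP; split; lra.
Qed.

Lemma nested_beta : nested setT (beta R).
Proof.
apply: (@conj_nested R (beta0 R) (alpha R)).
  move=> /(congr1 (fun f : PLo R => f (1 / 2))) /=; rewrite /beta0_fun.
  case: ifPn => [h|_]; first by lra.
  case: ltP => [h|_]; first by lra.
  case: ltP => [h|_]; first by lra.
  by case: ltP => [h|_]; [by lra|]; case: ltP => h; lra.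
set g := (beta0 R ^ alpha R)%g.
(* The conjugate carries the left end of the interval supporting [beta0] to its right end: 31/64 is
   the preimage of 7/16 under [alpha], [beta0] translates it by 1/32 to 33/64, and [alpha] sends
   this to 9/16. *)
have g7 : g (7 / 16) = 9 / 16.
  have -> : 7 / 16 = alpha R (31 / 64).
    rewrite /= /alpha_fun; case: ifPn => [h|_]; first by lra.
    by case: ltP => [h|_]; [by lra|]; case: ltP => [h|_]; [by lra|]; case: ltP => h; lra.
  rewrite plJ /= /beta0_fun; case: ifPn => [h|_]; first by lra.
  case: ltP => [h|_]; [by lra|]; case: ltP => [h|_]; [by lra|]; case: ltP => h'; last by lra.
  rewrite /alpha_fun; case: ifPn => [h2|_]; first by lra.
  by case: ltP => [h2|_]; [by lra|]; case: ltP => [h2|_]; [by lra|]; case: ltP => h2; lra.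
have gn n : 9 / 16 <= (g ^+ n.+1)%g (7 / 16).
  elim: n => [|n IH]; first by rewrite expg1 g7.
  rewrite expgSr plM; apply: (@le_trans _ _ (g (7 / 16))); first by rewrite g7.
  by rewrite pl_le; apply: le_trans IH; lra.
move=> x n /supp_beta0/andP[x1 _] /supp_beta0/andP[_].
by rewrite ltNge (le_trans (gn n))// pl_le ltW.
Qed.

End Betas.

(** * Ascending towers without chains *)

Section Scatter.
Variable R : realType.
Implicit Types (f g : PLo R) (x y z : R) (N L : set (PLo R)) (l : seq (R * R)).

Definition covered l : set R := [set x | exists2 p, p \in l & p.1 <= x <= p.2].

(** Suppose a power carries a point of p into q. If N has no fixed point on the hull of p and q, all
    positive powers displace this hull; otherwise a common fixed point separates p from q and cannot
    be crossed. Both signs of c are offered so that [deep_step] can choose the one with a suitable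
    slope. *)
Lemma scatter_list N l g : is_subgroup N -> N g ->
  (forall p, p \in l -> p.1 <= p.2 /\ fixfree N p) ->
  exists2 c, N c & scatters (c * g)%g (covered l) /\ scatters (c^-1 * g)%g (covered l).
Proof.
move=> sN Ng Hl.
pose hull (p q : R * R) : R * R := (Num.min p.1 q.1, Num.max p.2 q.2).
pose hulls := [seq h <- [seq hull p q | p <- l, q <- l] | `[< fixfree N h >]].
have hullsP h : h \in hulls -> h.1 <= h.2 /\ fixfree N h.
  rewrite mem_filter => /andP[/asboolP fh /allpairsP[[p q] /= [pl ql hE]]].
  split => //; have [p12 _] := Hl _ pl.
  by rewrite hE /= ge_min le_max p12.
(* For both [c * g] and [c^-1 * g] to displace h, it is enough that c displaces the hull of h and
   its preimage under g. *)
pose ext (h : R * R) : R * R := (Num.min h.1 (g^-1%g h.1), Num.max h.2 (g^-1%g h.2)).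
have [_ /mapP[h hh ->]|c Nc Hc] := @displace_all R N [seq ext h | h <- hulls] sN.
  have [h12 fh] := hullsP _ hh; split; first by rewrite /= ge_min le_max h12.
  exact: (fixfree_hull sN (subgroupV sN Ng) h12 fh).
have {}Hc h : h \in hulls -> displaces (c * g)%g h /\ displaces (c^-1 * g)%g h.
  move=> hh; have := Hc (ext h) (map_f _ hh); rewrite /displaces /ext /=.
  rewrite !gt_max !lt_min.
  set u := Num.min _ _; set v := Num.max _ _.
  have u1 : u <= h.1 by rewrite /u ge_min lexx.
  have u2 : u <= g^-1%g h.1 by rewrite /u !ge_min lexx !orbT.
  have v1 : h.2 <= v by rewrite /v le_max lexx.
  have v2 : g^-1%g h.2 <= v by rewrite /v !le_max lexx !orbT.
  case=> /andP[h1 h2]; split.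
  - by left; rewrite -[X in X < _](plVK g) pl_lt (lt_le_trans h2)// pl_le.
  - right; rewrite -[X in _ < X](plVK g) pl_lt -(pl_lt c) plVK.
    by apply: (lt_le_trans h1); rewrite pl_le.
  - by right; rewrite -[X in _ < X](plVK g) pl_lt (le_lt_trans _ h2)// pl_le.
  - left; rewrite -[X in X < _](plVK g) pl_lt -(pl_lt c) plVK.
    by apply: (le_lt_trans _ h1); rewrite pl_le.
have main t : N t -> (forall h, h \in hulls -> displaces t h) -> scatters t (covered l).
  move=> Nt Ht x n [p pl /andP[px xp]] [q ql /andP[qy yq]].
  have Ntn := subgroupX n.+1 sN Nt; set y := (t ^+ n.+1)%g x in qy yq.
  have [p12 _] := Hl _ pl; have [q12 _] := Hl _ ql.
  have [fh|] := pselect (fixfree N (hull p q)).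
    have hh : hull p q \in hulls.
      by rewrite mem_filter; apply/andP; split; [exact/asboolP|apply/allpairsP; exists (p, q)].
    have h12 := (hullsP _ hh).1.
    have := @displaces_pow R t _ x n h12 (Ht _ hh).
    by rewrite -/y /= !ge_min !le_max px xp qy yq !orbT => /(_ isT).
  move=> /existsNP[w /not_implyP[w1 /not_implyP[w2 Hw]]].
  have wfix f : N f -> f w = w.
    by move=> Nf; apply: contrapT => fw; apply: Hw; exists f.
  have np r : r \in l -> ~ (r.1 <= w /\ w <= r.2).
    by move=> /Hl[_ fr] [r1 r2]; have [f Nf] := fr _ r1 r2; apply; exact: wfix.
  have tw := wfix _ Ntn; rewrite /= ge_min le_max in w1 w2.
  have xw : (y < w) = (x < w) by rewrite -[in LHS]tw pl_lt.
  have wx : (w < y) = (w < x) by rewrite -[in LHS]tw pl_lt.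
  have [wp|wp] := ltP w p.1.
    have wq : q.1 <= w by case/orP: w1; lra.
    have qw : q.2 < w by rewrite ltNge; apply/negP => ?; apply: (np q).
    by move: wx; rewrite (lt_le_trans wp px) => /(lt_trans qw); lra.
  have pw : p.2 < w by rewrite ltNge; apply/negP => ?; apply: (np p).
  have wq : w < q.1.
    rewrite ltNge; apply/negP => wq; apply: (np q ql); split => //.
    by case/orP: w2; lra.
  by move: xw; rewrite (le_lt_trans xp pw); lra.
exists c => //; split; apply: main => [|h /Hc[]//]; apply: subgroupM => //.
exact: subgroupV.
Qed.

Lemma orbitals f : exists l, (forall p, p \in l -> orb [set f] p.1 p.2) /\
  forall x, supp f x -> exists2 p, p \in l & p.1 < x < p.2.
Proof.
have [s sf] := breaks f.
have /choice[I IP] : forall t, exists p : R * R, f t <> t ->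
    orb [set f] p.1 p.2 /\ p.1 < t < p.2.
  move=> t; have [ft|ft] := pselect (f t = t); first by exists (0, 0).
  have [|a [b [fab ta tb]]] := @orb_ex _ [set f] t; first by exists f.
  by exists (a, b) => _; rewrite ta tb.
exists [seq I t | t <- s & f t != t]; split.
  by move=> _ /mapP[t + ->]; rewrite mem_filter => /andP[/eqP/IP[]].
move=> x fx; have [|a [b [fab ax xb]]] := @orb_ex _ [set f] x; first by exists f.
have [t ts /andP[at_ tb]] := sf _ _ fab; have /orb1P[_ _ _ mv] := fab.
have ft := mv _ at_ tb; have [fo /andP[ot to]] := IP _ ft.
exists (I t); first by apply: map_f; rewrite mem_filter ts andbT; apply/eqP.
by have [||<- <-] := orb_uniq fab fo; rewrite ?ax//; lra.
Qed.

(** The interval is closed: even the ends of the orbitals are moved by L, which allows L to displace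
    whole supports. *)
Definition star L : Prop := forall f a b, L f -> orb [set f] a b -> fixfree L (a, b).

Lemma star_step L (s : seq (PLo R)) : is_subgroup L -> star L -> (forall f, f \in s -> L f) ->
  exists2 c, L c & scatters c [set x | exists2 f, f \in s & supp f x].
Proof.
move=> sL stL Hs.
have [l [lfree lcov]] : exists l, (forall p, p \in l -> p.1 <= p.2 /\ fixfree L p) /\
    forall f x, f \in s -> supp f x -> covered l x.
  elim: s Hs => [|f s IH] Hs; first by exists [::].
  have [|l [l1 l2]] := IH; first by move=> g gs; apply: Hs; rewrite inE gs orbT.
  have [l' [l'1 l'2]] := orbitals f; exists (l' ++ l); split.
    move=> p; rewrite mem_cat => /orP[/l'1 fp|/l1//]; have [p12 _ _] := fp.
    split; first exact: ltW.
    by rewrite [p]surjective_pairing; apply: stL fp; apply: Hs; rewrite mem_head.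
  move=> g x; rewrite inE => /orP[/eqP ->|gs] gx.
    have [p pl /andP[px xp]] := l'2 x gx.
    by exists p; rewrite ?mem_cat ?pl// !ltW.
  by have [p pl px] := l2 g x gs gx; exists p; rewrite // mem_cat pl orbT.
have [c Lc [_ sc]] := scatter_list sL (subgroup1 sL) lfree.
exists c^-1%g; first exact: subgroupV.
by rewrite mulg1 in sc; apply: scatters_sub sc => x [f fs fx]; exact: lcov fx.
Qed.

Lemma star_tower L f0 : is_subgroup L -> star L -> L f0 -> f0 <> 1%g ->
  exists h : nat -> PLo R, [/\ h 0%N = f0, forall n, L (h n), forall n, h n <> 1%g &
    forall n, scatters (h n.+1) [set x | exists2 i, (i <= n)%N & supp (h i) x]].
Proof.
move=> sL stL Lf0 f01.
have /choice[next nextP] : forall s : seq (PLo R), exists c, (forall f, f \in s -> L f) ->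
    L c /\ scatters c [set x | exists2 f, f \in s & supp f x].
  move=> s; have [Hs|Hs] := pselect (forall f, f \in s -> L f); last by exists 1%g.
  by have [c Lc sc] := star_step sL stL Hs; exists c.
(* [S n] keeps all elements chosen so far, so that the next one is chosen against all their supports
   at once. *)
pose S n := iter n (fun s => next s :: s) [:: f0].
have SL n f : f \in S n -> L f.
  elim: n f => [|n IH] f /=; first by rewrite inE => /eqP ->.
  by rewrite inE => /orP[/eqP ->|/IH//]; exact: (nextP _ IH).1.
pose h n := head f0 (S n).
have hS n : h n \in S n by rewrite /h; case: n => [|n] /=; rewrite mem_head.
have hi i n : (i <= n)%N -> h i \in S n.
  move=> /subnK <-; elim: (n - i)%N => [//|k IH]; by rewrite addSn /= inE IH orbT.
have sc n : scatters (h n.+1) [set x | exists2 i, (i <= n)%N & supp (h i) x].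
  have [_] := nextP _ (SL n); apply: scatters_sub => x [i ni ix].
  by exists (h i) => //; exact: hi.
exists h; split => // [n|n]; first exact: SL (hS n).
case: n => [//|n] e; have [x /eqP fx] := pl_neq1 f01.
by apply: (sc n x 0%N); rewrite ?e ?expg1n; exists 0%N.
Qed.

End Scatter.

(** * Commutation on an invariant set *)

Section Commutation.
Variable R : realType.
Implicit Types (f g : PLo R) (C : set R).

Definition stable C f : Prop := forall q, C q -> C (f q).

Definition commute_on C f g : Prop := forall q, C q -> f (g q) = g (f q).

Lemma stableM C f g : stable C f -> stable C g -> stable C (f * g)%g.
Proof. by move=> Cf Cg q /Cf/Cg. Qed.

Lemma commute_on_sym C f g : commute_on C f g -> commute_on C g f.
Proof. by move=> fg q /fg. Qed.

Lemma commute_onV C f g : stable C f^-1%g -> commute_on C f g -> commute_on C f^-1%g g.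
Proof. by move=> Cf fg q Cq; apply: (@pl_inj _ f); rewrite plVK fg ?plVK//; exact: Cf. Qed.

Lemma commute_onM C f f' g : stable C f -> commute_on C f g -> commute_on C f' g ->
  commute_on C (f * f')%g g.
Proof. by move=> Cf fg f'g q Cq; rewrite !plM fg// f'g//; exact: Cf. Qed.

Lemma commute_on_disjoint C f g : stable C f -> stable C g ->
  (forall q, C q -> f q <> q -> g q = q) -> commute_on C f g.
Proof.
move=> Cf Cg H q Cq; have [fq|fq] := pselect (f q = q).
  rewrite fq; apply: contrapT => fgq; have := H _ (Cg _ Cq) fgq => /pl_inj gq.
  by apply: fgq; rewrite gq.
rewrite (H q)// H//; first exact: Cf.
by move=> /pl_inj.
Qed.

Lemma commute_on_comm C f g q : stable C f^-1%g -> stable C g^-1%g ->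
  commute_on C f g -> C q -> [~ f, g]%g q = q.
Proof.
move=> Cf Cg fg Cq; have -> : [~ f, g]%g q = g (f (g^-1%g (f^-1%g q))) by [].
by rewrite -fg ?plVK//; apply/Cg/Cf.
Qed.

(** [[~ f, g]] equals [(g ^ f)^-1 * g]. *)
Lemma comm_r f g u : (g ^ f)%g u = u -> [~ f, g]%g u = g u.
Proof.
move=> H; have {H}: g (f^-1%g u) = f^-1%g u.
  by apply: (@pl_inj _ f); rewrite plVK -plJE.
by move=> /plV_fix H; rewrite /commg /conjg !plM H plVK.
Qed.

End Commutation.

Section Tall.
Variable R : realType.
Implicit Types (f g h w : PLo R) (u : R) (N L : set (PLo R)).

Lemma germ1J s f w (a : R) : side s -> germ s f a 1 -> germ s (f ^ w)%g (w a) 1.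
Proof.
move=> ss /germ1_id[e e0 fe].
pose e' := s * (w (a + s * e) - w a).
have e'0 : 0 < e'.
  rewrite /e'; case: ss => ->; rewrite ?mul1r ?mulN1r ?opprB subr_gt0 pl_lt; lra.
exists e' => // y y0 ye; rewrite mulr1.
pose v := w^-1%g (w a + s * y).
have wv : w v = w a + s * y by rewrite plVK.
rewrite -wv plJ; congr (w _).
have : 0 <= s * (v - a) <= e.
  move: ye wv; rewrite /e'; case: ss => ->; rewrite ?mul1r ?mulN1r ?opprB => ye wv.
    have h1 : a <= v by rewrite -(pl_le w) wv; lra.
    have h2 : v <= a + e by rewrite -(pl_le w) wv; lra.
    by apply/andP; split; lra.
  have h1 : v <= a by rewrite -(pl_le w) wv; lra.
  have h2 : a - e <= v by rewrite -(pl_le w) wv; lra.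
  by apply/andP; split; lra.
move=> /andP[v0 ve]; have := fe _ v0 ve; rewrite mulrA.
have -> : s * s = 1 by case: ss => ->; rewrite ?mul1r ?mulrNN ?mul1r.
by rewrite mul1r addrC subrK.
Qed.

(** A high power of [y^-1] carries [p, q] so close to one end of (c, d) that it leaves the compact
    part on which f acts. *)
Lemma push f y c d p q : inner f c d -> orb [set y] c d -> c < p -> p <= q -> q < d ->
  exists j0, forall j, (j0 <= j)%N -> forall u, p <= u <= q -> (f ^ (y ^+ j))%g u = u.
Proof.
move=> [p' [q' [cp' p'q' q'd fin]]] ycd cp pq qd.
have yV := orb_V ycd.
have [j0 Hj] : exists j0, forall j, (j0 <= j)%N -> forall u, p <= u <= q ->
    ((y^-1 ^+ j)%g u <= p' \/ q' <= (y^-1 ^+ j)%g u).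
  have [H|H] := orb_dir yV.
    have [j0 Hj] := attract_r yV H cp q'd; exists j0 => j /Hj lt u /andP[pu _]; right.
    by apply: ltW; apply: (lt_le_trans lt); rewrite pl_le.
  have [j0 Hj] := attract_l yV H qd cp'; exists j0 => j /Hj lt u /andP[_ uq]; left.
  by apply: ltW; apply: (le_lt_trans _ lt); rewrite pl_le.
exists j0 => j /Hj {}Hj u upq; rewrite plJE -expVgn.
have -> : f ((y^-1 ^+ j)%g u) = (y^-1 ^+ j)%g u.
  apply: contrapT => fu.
  have uin : c < (y^-1 ^+ j)%g u < d.
    elim: j {Hj fu} => [|j IH]; first by
      move/andP: upq => [? ?]; apply/andP; split; rewrite pl1; lra.
    by rewrite expgSr plM; apply: (orb_in yV).
  move/andP: uin => [u1 u2]; have [u3 u4] := fin _ u1 u2 fu.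
  by case: (Hj u upq); lra.
by rewrite expVgn plVK.
Qed.

Lemma orb_comm x y (a b : R) : orb [set x] a b -> (forall u, a <= u <= b -> (x ^ y)%g u = u) ->
  orb [set [~ x, y]%g] a b.
Proof.
move=> xab H; have xV := orb_V xab; have /orb1P[ab xa xb mv] := xV.
have e u : a <= u <= b -> [~ x, y]%g u = x^-1%g u.
  move=> /andP[au ub]; rewrite plR H//.
  by rewrite -{1}xa -{1}xb !pl_le au.
apply/orb1P; split => //; rewrite ?e ?lexx ?ltW//.
by move=> u au ub; rewrite e ?ltW//; exact: mv.
Qed.

(** Only the step to a larger orbital matters, so the index type is abstract; it becomes nat for
    tall and int for bi-infinite towers. *)
Variables (G : set (PLo R)) (T : Type) (nx : T -> T) (a b : T -> R).
Hypotheses (sG : is_subgroup G) (lam : ~ chain G).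
Hypothesis nx_lt : forall n, a (nx n) < a n /\ b n < b (nx n).
Hypothesis tower : forall n, exists2 g, G g & orb [set g] (a n) (b n).

Definition heavy N : Prop := [/\ is_subgroup N, N `<=` G, normal_in G N &
  forall n, exists2 f, N f & orb [set f] (a n) (b n)].

Lemma heavyG : heavy G.
Proof. by split => // f w Gf Gw; exact: subgroupJ. Qed.

Lemma tower_lt n : a n < b n.
Proof. by have [g _ []] := tower n. Qed.

Lemma comm_orb N1 N2 n : N1 `<=` G -> N2 `<=` G ->
  (exists2 f, N1 f & orb [set f] (a n) (b n)) ->
  (exists2 f, N2 f & orb [set f] (a (nx n)) (b (nx n))) -> is_subgroup N2 ->
  exists x y, [/\ N1 x, N2 y & orb [set [~ x, y]%g] (a n) (b n)].
Proof.
move=> N1G N2G [x N1x xab] [y N2y yab] sN2; have [an bn] := nx_lt n.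
have ab := tower_lt n; have /orb1P[_ xa _ _] := xab.
have [|_ _ xin] := laminar_inner sG lam (N1G _ N1x) (N2G _ N2y) yab an _ xa; first lra.
have [j0 Hj] := push xin yab an (ltW ab) bn.
exists x, (y ^+ j0)%g; split => //; first exact: subgroupX.
by apply: orb_comm => // u; exact: Hj.
Qed.

(** A commutator of an element of N1 with one of N2 lies in both normal subgroups, and by [comm_orb]
    it can be given the required orbital. *)
Lemma heavyI N1 N2 : heavy N1 -> heavy N2 -> heavy (N1 `&` N2).
Proof.
move=> [s1 G1 n1 t1] [s2 G2 n2 t2]; split.
- split; first by split; exact: subgroup1.
    by move=> f g [? ?] [? ?]; split; exact: subgroupM.
  by move=> f [? ?]; split; exact: subgroupV.
- by move=> f [/G1].
- by move=> f w [? ?] Gw; split; [exact: n1|exact: n2].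
- move=> n; have [x [y [N1x N2y xy]]] := comm_orb G1 G2 (t1 n) (t2 (nx n)) s2.
  exists [~ x, y]%g => //; split; last first.
    have -> : [~ x, y]%g = ((y^-1 ^ x) * y)%g by rewrite /commg /conjg !mulgA.
    by apply: subgroupM => //; apply: n2; [exact: subgroupV|exact: G1].
  rewrite /commg; apply: subgroupM => //; first exact: subgroupV.
  by apply: n1 => //; exact: G2.
Qed.

Definition core : set R := [set x | forall N, heavy N -> exists2 g, N g & g x <> x].

Lemma core_inv w (x : R) : G w -> core (w x) -> core x.
Proof.
move=> Gw cx N hN; have [g Ng gx] := cx N hN; have [_ _ nN _] := hN.
exists (g ^ w^-1)%g; first by apply: nN => //; exact: subgroupV.
by rewrite -[in X in X <> _](plK w x) plJ => /(congr1 w); rewrite plVK.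
Qed.

Lemma ncore_act w (x : R) : G w -> ~ core x -> ~ core (w x).
Proof. by move=> Gw cx /(core_inv Gw). Qed.

Lemma ncore_stable w : G w -> stable (~` core) w.
Proof. by move=> Gw x; exact: ncore_act. Qed.

Lemma ncore_stableV w : G w -> stable (~` core) w^-1%g.
Proof. by move=> Gw; apply: ncore_stable; exact: subgroupV. Qed.

(** An orbital of x that leaves [core] is bad. On bad orbitals N is tame: having a fixed point
    inside, its elements preserve the orbital and are the identity near its ends. One heavy N serves
    all bad orbitals of x, since these are finitely many. *)
Definition breaks_bad x N : Prop := forall c d, orb [set x] c d ->
  (exists z, [/\ c < z, z < d & ~ core z]) ->
  exists z, [/\ c < z, z < d & forall g, N g -> g z = z].

Lemma breaker x : G x -> exists2 N, heavy N & breaks_bad x N.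
Proof.
move=> Gx; have [l [l1 l2]] := orbitals x.
have [N hN HN] : exists2 N, heavy N & forall p, p \in l ->
    (exists z, [/\ p.1 < z, z < p.2 & ~ core z]) ->
    exists z, [/\ p.1 < z, z < p.2 & forall g, N g -> g z = z].
  elim: l {l1 l2} => [|p l [N hN HN]]; first by exists G => //; exact: heavyG.
  have [[z [pz zp cz]]|H] := pselect (exists z, [/\ p.1 < z, z < p.2 & ~ core z]); last first.
    by exists N => // q; rewrite inE => /orP[/eqP ->//|/HN].
  have [N' hN' zN'] : exists2 N', heavy N' & forall g, N' g -> g z = z.
    move: cz => /existsNP[N' /not_implyP[hN' H]]; exists N' => // g N'g.
    by apply: contrapT => gz; apply: H; exists g.
  exists (N `&` N'); first exact: heavyI.
  move=> q; rewrite inE => /orP[/eqP -> _|/HN{}HN /HN[y [? ? Hy]]].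
    by exists z; split => // g [_ /zN'].
  by exists y; split => // g [/Hy].
exists N => // c d xcd [z [cz zd nz]].
have /orb1P[_ _ _ mv] := xcd; have [p pl /andP[pz zp]] := l2 z (mv _ cz zd).
have [||-> ->] := orb_uniq xcd (l1 _ pl); [lra|lra|].
by apply: HN => //; exists z.
Qed.

Local Notation cm := (commute_on (~` core)).

(** Off [core], at a fixed point of x the conjugate of Z acts as Z, which commutes with Q there. Any
    other point lies in a bad orbital of x, in which conjugation by a high power of x pushes Z off
    the support of Q. *)
Lemma cm_conj x N Q Z : G x -> heavy N -> breaks_bad x N -> N Q -> N Z -> cm Z Q ->
  exists i0, forall i, (i0 <= i)%N -> cm (Z ^ (x ^+ i))%g Q.
Proof.
move=> Gx [sN NG nN _] xN NQ NZ ZQ.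
have bad_in f c d z : N f -> orb [set x] c d -> c < z -> z < d -> ~ core z ->
    [/\ f c = c, f d = d & inner f c d].
  move=> Nf xcd cz zd nz; have [|w [cw wd Hw]] := xN _ _ xcd; first by exists z.
  exact: (laminar_inner sG lam (NG _ Nf) Gx xcd cw wd (Hw _ Nf)).
have xfix f q : N f -> ~ core q -> x q = q -> x (f q) = f q.
  move=> Nf nq xq; apply: contrapT => xfq.
  have [|c [d [xcd cf fd]]] := @orb_ex _ [set x] (f q); first by exists x.
  have nfq : ~ core (f q) by apply: ncore_act => //; exact: NG.
  have [fc fd' _] := bad_in f _ _ _ Nf xcd cf fd nfq.
  rewrite -fc -fd' !pl_lt in cf fd.
  by have /orb1P[_ _ _ mv] := xcd; apply: (mv q).
have [i0 Hi] : exists i0, forall i, (i0 <= i)%N -> forall c d z, orb [set x] c d ->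
    c < z -> z < d -> ~ core z -> forall u, c < u -> u < d -> Q u <> u ->
    (Z ^ (x ^+ i))%g u = u.
  have [l [l1 l2]] := orbitals x.
  have [i0 Hi] : exists i0, forall i, (i0 <= i)%N -> forall p z, p \in l ->
      p.1 < z -> z < p.2 -> ~ core z -> forall u, p.1 < u -> u < p.2 -> Q u <> u ->
      (Z ^ (x ^+ i))%g u = u.
    elim: l l1 {l2} => [|p l IH] l1; first by exists 0%N.
    have [|i0 Hi] := IH; first by move=> q ql; apply: l1; rewrite inE ql orbT.
    have xp := l1 _ (mem_head _ _).
    have [[z [pz zp cz]]|H] := pselect (exists z, [/\ p.1 < z, z < p.2 & ~ core z]); last first.
      exists i0 => i /Hi{}Hi q z; rewrite inE => /orP[/eqP ->|/Hi]; last exact.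
      by move=> ? ? ?; case: H; exists z.
    have [_ _ [q1 [q2 [pq1 q12 qp2 Qin]]]] := bad_in Q _ _ _ NQ xp pz zp cz.
    have [_ _ Zin] := bad_in Z _ _ _ NZ xp pz zp cz.
    have [i1 Hi1] := push Zin xp pq1 q12 qp2.
    exists (maxn i0 i1) => i; rewrite geq_max => /andP[/Hi{}Hi /Hi1{}Hi1] q z'.
    rewrite inE => /orP[/eqP ->|/Hi]; last exact.
    move=> _ _ _ u pu up Qu; apply: Hi1; have [? ?] := Qin u pu up Qu.
    by rewrite !ltW.
  exists i0 => i /Hi{}Hi c d z xcd cz zd nz.
  have /orb1P[_ _ _ mv] := xcd; have [p pl /andP[pz zp]] := l2 z (mv _ cz zd).
  have [||-> ->] := orb_uniq xcd (l1 _ pl); [lra|lra|].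
  exact: (Hi p z).
exists i0 => i /Hi{}Hi q nq.
have NZi : N (Z ^ (x ^+ i))%g by apply: nN => //; exact: subgroupX.
have [xq|xq] := pselect (x q = q).
  have ZE r : ~ core r -> x r = r -> (Z ^ (x ^+ i))%g r = Z r.
    move=> nr xr; rewrite -{1}[r](@plX_fix _ x _ i xr) plJ plX_fix//.
    exact: xfix.
  have nQq : ~ core (Q q) by apply: ncore_act => //; exact: NG.
  by rewrite !ZE// ?ZQ//; exact: xfix.
have [|c [d [xcd cq qd]]] := @orb_ex _ [set x] q; first by exists x.
have {}Hi := Hi _ _ _ xcd cq qd nq.
pose C := [set r | c < r < d].
have Cst f : N f -> stable C f.
  move=> Nf r /andP[cr rd]; have [fc fd _] := bad_in f _ _ _ Nf xcd cq qd nq.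
  by rewrite /C /= -{1}fc -{1}fd !pl_lt cr.
have : commute_on C Q (Z ^ (x ^+ i))%g.
  apply: commute_on_disjoint; [exact: Cst|exact: Cst|].
  by move=> r /andP[cr rd]; exact: Hi.
by move=> /(_ q) ->//; rewrite /C /= cq.
Qed.

(* On A_(n+1) the elements P and Q below coincide with powers of x and y, so [P, Q]
   has orbital A_n. Off core they commute: there y and z preserve each orbital of x,
   and z each orbital of y, and high powers of x and y separate the supports. *)
Lemma tall_key n : exists2 k, G k & orb [set k] (a n) (b n) /\ forall q, ~ core q -> k q = q.
Proof.
have [x Gx xab] := tower n.
have [Nx hNx xNx] := breaker Gx; have [sNx NxG nNx tNx] := hNx.
have [y Nxy yab] := tNx (nx n); have Gy := NxG _ Nxy.
have [Ny hNy yNy] := breaker Gy.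
have hNxy := heavyI hNx hNy; have [sNxy _ _ tNxy] := hNxy.
have [z Nz zab] := tNxy (nx (nx n)); have Gz := NxG _ Nz.1.
have [a1 b1] := nx_lt n; have [a2 b2] := nx_lt (nx n).
have ab0 := tower_lt n; have ab1 := tower_lt (nx n).
have /orb1P[_ xa xb _] := xab; have /orb1P[_ ya yb _] := yab.
have [||_ _ xin2] := laminar_inner sG lam Gx Gz zab _ _ xa; [lra|lra|].
have [||_ _ yin2] := laminar_inner sG lam Gy Gz zab _ _ ya; [lra|lra|].
have [||xa1 xb1 xin1] := laminar_inner sG lam Gx Gy yab _ _ xa; [lra|lra|].
have [l1 Hl1] := push xin2 zab a2 (ltW ab1) b2.
have [l2 Hl2] := push yin2 zab a2 (ltW ab1) b2.
pose Z := (z ^+ (maxn l1 l2))%g.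
have NZ : (Nx `&` Ny) Z by exact: subgroupX.
have [NxZ NyZ] := NZ; have GZ := NxG _ NxZ.
have [j1 Hj1] := cm_conj Gy hNy yNy NyZ NyZ (fun q _ => erefl).
have [j2 Hj2] := push xin1 yab a1 (ltW ab0) b1.
pose Y := (y ^+ (maxn j1 j2))%g; have NxY : Nx Y by exact: subgroupX.
have GY := NxG _ NxY.
pose Q := [~ Z, Y]%g; have NxQ : Nx Q by exact: subgroupR.
have GQ := NxG _ NxQ.
have ZQ : cm Z Q.
  apply: commute_on_sym; rewrite /Q /commg; apply: commute_onM.
  - exact: ncore_stableV.
  - by apply: commute_onV => //; exact: ncore_stableV.
  - by apply: Hj1; rewrite leq_maxl.
have [i0 Hi] := cm_conj Gx hNx xNx NxQ NxZ ZQ.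
(* The successor keeps the exponent positive, so that X still has the orbital (a n, b n). *)
pose X := (x ^+ i0.+1)%g; have GX : G X by exact: subgroupX.
pose P := [~ Z, X]%g; have GP : G P by exact: subgroupR.
have PQ : cm P Q.
  rewrite /P /commg; apply: commute_onM; last exact: Hi.
    exact: ncore_stableV.
  by apply: commute_onV => //; exact: ncore_stableV.
exists [~ P, Q]%g; first exact: subgroupR.
split; last first.
  by move=> q nq; apply: (@commute_on_comm _ (~` core)) => //;
    exact: ncore_stableV.
have Xab : orb [set X] (a n) (b n) by exact: orb_pow.
have PE u : a (nx n) <= u <= b (nx n) -> P u = X u.
  move=> uab; apply: comm_r; rewrite conjXg; apply: plX_fix; apply: Hl1 => //.
  by rewrite leq_maxl.
have QE u : a (nx n) <= u <= b (nx n) -> Q u = Y u.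
  move=> uab; apply: comm_r; rewrite conjXg; apply: plX_fix; apply: Hl2 => //.
  by rewrite leq_maxr.
have inv f (c d : R) u : f c = c -> f d = d -> c <= u <= d -> c <= f u <= d.
  by move=> fc fd; rewrite -{2}fc -{2}fd !pl_le.
have XVab := orb_V Xab; have /orb1P[_ XVa XVb mv] := XVab.
(* There P and Q act as X and Y, and [X ^ Y] is trivial, so the commutator [X^-1 * X ^ Y] acts as
   [X^-1]. *)
have kE u : a n <= u <= b n -> [~ P, Q]%g u = X^-1%g u.
  move=> uab; have v1 := inv _ _ _ u XVa XVb uab.
  have sub v : a n <= v <= b n -> a (nx n) <= v <= b (nx n).
    by move=> /andP[? ?]; apply/andP; split; lra.
  have -> : [~ P, Q]%g u = Q (P (Q^-1%g (P^-1%g u))) by [].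
  have -> : P^-1%g u = X^-1%g u.
    by apply: (@pl_inj _ P); rewrite plVK PE ?plVK//; exact: sub.
  set v := X^-1%g u in v1 *; have v2 := sub _ v1.
  have Yv : a (nx n) <= Y^-1%g v <= b (nx n).
    by apply: inv => //; apply: plV_fix; exact: plX_fix.
  have -> : Q^-1%g v = Y^-1%g v.
    by apply: (@pl_inj _ Q); rewrite plVK QE ?plVK.
  rewrite PE// QE; last by apply: inv => //; exact: plX_fix.
  rewrite -plJE conjXg; apply: plX_fix; apply: Hj2 => //.
  by rewrite leq_maxr.
apply/orb1P; split => //; rewrite ?kE ?lexx ?ltW//.
by move=> u au ub; rewrite kE ?ltW//; exact: mv.
Qed.

(** L is D(K), where K consists of the elements trivial off [core]. As L is itself heavy, its common
    fixed points lie off [core] and are fixed by K. Such a point cannot lie inside an orbital of an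
    element of L, nor be an end of one, because elements of D(K) have slope 1 there. *)
Lemma laminar_star : exists L, [/\ is_subgroup L, L `<=` G, star L &
  forall n, exists2 f, L f & orb [set f] (a n) (b n)].
Proof.
pose K := [set f : PLo R | G f /\ forall q, ~ core q -> f q = q].
have sK : is_subgroup K.
  split; first by split => //; exact: subgroup1.
    move=> f g [Gf fq] [Gg gq]; split; first exact: subgroupM.
    by move=> q nq; rewrite plM fq// gq.
  move=> f [Gf fq]; split; first exact: subgroupV.
  by move=> q nq; apply: plV_fix; exact: fq.
have nK : normal_in G K.
  move=> f w [Gf fq] Gw; split; first exact: subgroupJ.
  move=> q nq; rewrite plJE fq ?plVK//.
  by apply: ncore_act => //; exact: subgroupV.
have hK : heavy K.
  split => //; first by move=> f [].
  by move=> n; have [k Gk [kab kq]] := tall_key n; exists k.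
have KG : K `<=` G by move=> f [].
pose L := derv K; have LK : L `<=` K by move=> f; exact: derv_sub.
have hL : heavy L.
  split; [exact: derv_subgroup|by move=> f /LK/KG| |].
    move=> f w [Kf f1] Gw; split; first exact: nK.
    move=> s p ss Hp; rewrite -[p](plVK w); apply: germ1J => //; apply: f1 => // g Kg.
    apply: (@pl_inj _ w); rewrite plVK -plJE; apply: Hp; exact: nK.
  move=> n; have [_ _ _ tK] := hK.
  have [x [y [Kx Ky xy]]] := comm_orb KG KG (tK n) (tK (nx n)) sK.
  by exists [~ x, y]%g => //; exact: derv_comm.
have [sL LG _ tL] := hL.
exists L; split => // f c d Lf fcd x /= cx xd.
apply: contrapT => H.
have Lx g : L g -> g x = x by move=> Lg; apply: contrapT => gx; apply: H; exists g.
have ncx : ~ core x by move=> /(_ L hL)[g /Lx].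
have Kx g : K g -> g x = x by move=> [_]; apply.
have [_ f1] := Lf; have /orb1P[cd fc fd mv] := fcd.
have [xc|xc] := eqVneq x c.
  have := orb_germ_l fcd (f1 1 c (or_introl erefl) _); rewrite -xc => /(_ Kx).
  by rewrite eqxx.
have [xd'|xd'] := eqVneq x d.
  have := orb_germ_r fcd (f1 (-1) d (or_intror erefl) _); rewrite -xd' => /(_ Kx).
  by rewrite eqxx.
by apply: (mv x); rewrite ?lt_neqAle ?xd ?xd' ?cx ?andbT// ?[c == x]eq_sym//; exact: Lx.
Qed.

End Tall.

(** * Descending towers without chains *)

Section Deep.
Variable R : realType.
Implicit Types (f g w : PLo R) (N L : set (PLo R)).

Lemma orbJ f w (a b : R) : orb [set f] a b -> orb [set (f ^ w)%g] (w a) (w b).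
Proof.
move=> /orb1P[ab fa fb mv]; apply/orb1P; split; rewrite ?pl_lt ?plJ ?fa ?fb//.
move=> x ax xb; rewrite -[x](plVK w) plJ => /pl_inj; apply: mv.
  by rewrite -(pl_lt w) plVK.
by rewrite -(pl_lt w) plVK.
Qed.

Variable G : set (PLo R).
Hypotheses (sG : is_subgroup G) (lam : ~ chain G).

(** Here u may be an end of (c, d). An orbital of f over c ends at the latest at u; it forms a chain
    with (c, d) or shares the end d with it. *)
Lemma laminar_fix_ends f z (c d u : R) : G f -> G z -> orb [set z] c d ->
  c <= u <= d -> f u = u -> f c = c /\ f d = d.
Proof.
move=> Gf Gz zcd /andP[cu ud] fu; split; apply: contrapT => fc.
  have [|a [b [fab ac cb]]] := @orb_ex _ [set f] c; first by exists f.
  have /orb1P[_ _ fb mf] := fab.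
  have bu : b <= u by rewrite leNgt; apply/negP => ?; apply: (mf u) => //; lra.
  have [bd|db] := ltP b d.
    by apply: lam; exists f, z, a, b, c, d; split => //; split.
  have e : b = d by lra.
  by subst b; apply: lam; exact: (shared_r sG Gz Gf zcd fab).
have [|a [b [fab ac cb]]] := @orb_ex _ [set f] d; first by exists f.
have /orb1P[_ _ fb mf] := fab.
have bu : u <= a by rewrite leNgt; apply/negP => ?; apply: (mf u) => //; lra.
have [bd|db] := ltP c a.
  by apply: lam; exists z, f, c, d, a, b; split => //; split.
have e : c = a by lra.
by subst c; apply: lam; exact: (shared_l sG Gz Gf zcd fab).
Qed.

Definition descending (a b : nat -> R) (g : nat -> PLo R) : Prop :=
  forall n, [/\ a n < a n.+1, b n.+1 < b n, G (g n) & orb [set (g n)] (a n) (b n)].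

Lemma displace_inner (z : PLo R) (c d p q : R) : orb [set z] c d -> c < p -> p <= q -> q < d ->
  exists M, forall j, (M <= j)%N -> displaces (z ^+ j)%g (p, q).
Proof.
move=> zcd cp pq qd; have [H|H] := orb_dir zcd.
  by have [M HM] := attract_r zcd H cp qd; exists M => j /HM; left.
by have [M HM] := attract_l zcd H qd cp; exists M => j /HM; right.
Qed.

(** Powers of z preserve its orbitals, so it suffices to displace one compact part of each, and one
    exponent serves these finitely many parts. *)
Lemma expg_scatters (z : PLo R) (l : seq (R * R)) (X : set R) :
  (forall p, p \in l -> orb [set z] p.1 p.2) ->
  (forall p, p \in l -> exists q1 q2, [/\ p.1 < q1, q1 <= q2, q2 < p.2 &
     forall x, p.1 < x -> x < p.2 -> X x -> q1 < x /\ x < q2]) ->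
  (forall x, X x -> exists2 p, p \in l & p.1 < x < p.2) ->
  exists M, scatters (z ^+ M.+1)%g X.
Proof.
move=> zl inl Xl.
have [M HM] : exists M, forall j, (M <= j)%N -> forall p, p \in l ->
    exists q : R * R, [/\ q.1 <= q.2, displaces (z ^+ j)%g q &
      forall x, p.1 < x -> x < p.2 -> X x -> q.1 <= x <= q.2].
  elim: l zl inl {Xl} => [|p l IH] zl inl; first by exists 0%N.
  have [||M HM] := IH; [by move=> q ql; apply: zl; rewrite inE ql orbT|
    by move=> q ql; apply: inl; rewrite inE ql orbT|].
  have [q1 [q2 [pq1 q12 qp2 Hq]]] := inl _ (mem_head _ _).
  have [M' HM'] := displace_inner (zl _ (mem_head _ _)) pq1 q12 qp2.
  exists (maxn M M') => j; rewrite geq_max => /andP[/HM{}HM /HM'{}HM'] p'.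
  rewrite inE => /orP[/eqP ->|/HM//]; exists (q1, q2); split => // x px xp Xx.
  by have [? ?] := Hq x px xp Xx; rewrite /= !ltW.
exists M => x n Xx Xy; have [p pl /andP[px xp]] := Xl _ Xx.
have [q [q12 dq Hq]] := HM M.+1 (leqnSn _) p pl.
have /andP[py yp] : p.1 < ((z ^+ M.+1) ^+ n.+1)%g x < p.2.
  rewrite -expgnA; have := orb_pow (M.+1 * n.+1).-1 (zl p pl).
  rewrite prednK ?muln_gt0// => H; apply: (orb_in H) => //; exact/andP.
by have := displaces_pow n q12 dq (Hq _ px xp Xx); rewrite Hq.
Qed.

(* An orbital of z is good if some K m has a fixed point in its closure; then K m
   preserves it. On the bad ones t, hence also tau and s, can be taken to move z
   away, so that the double commutator k is trivial there; on (a m, b m) it is the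
   commutator of tau and s. *)
Lemma deep_step a b (g : nat -> PLo R) : descending a b g -> exists a' b' (g' : nat -> PLo R) M,
  [/\ descending a' b' g', scatters (g 0%N ^+ M.+1)%g (supp (g' 0%N)) &
      supp (g' 0%N) `<=` supp (g 0%N)].
Proof.
move=> dg; pose z := g 0%N.
have Gg n : G (g n) by case: (dg n).
have gab n : orb [set (g n)] (a n) (b n) by case: (dg n).
have ab n : a n < b n by case: (gab n).
have mono i k : a i < a (i + k.+1)%N /\ b (i + k.+1)%N < b i.
  elim: k => [|k [IH1 IH2]]; first by rewrite addn1; case: (dg i).
  by have [h1 h2 _ _] := dg (i + k.+1)%N; rewrite addnS; split; lra.
have mono' i n : (i < n)%N -> a i < a n /\ b n < b i.
  by move=> /subnK <-; rewrite addnC addSnnS; exact: mono.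
(* K m decreases with m and contains the tower from m on. *)
pose K m := [set f : PLo R | G f /\ forall i, (i <= m)%N -> f (a i) = a i /\ f (b i) = b i].
have sK m : is_subgroup (K m).
  split; first by split => //; exact: subgroup1.
    move=> f h [Gf fi] [Gh hi]; split; first exact: subgroupM.
    by move=> i im; have [f1 f2] := fi _ im; have [h1 h2] := hi _ im; rewrite !plM f1 f2.
  move=> f [Gf fi]; split; first exact: subgroupV.
  by move=> i im; have [f1 f2] := fi _ im; rewrite !plV_fix.
have KG m : K m `<=` G by move=> f [].
have Kle m n : (m <= n)%N -> K n `<=` K m.
  by move=> mn f [Gf fi]; split => // i im; apply: fi; exact: leq_trans mn.
have Kg m n : (m <= n)%N -> K m (g n).
  move=> mn; split => // i im; have /orb1P[_ ga gb _] := gab n.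
  have := leq_trans im mn; rewrite leq_eqVlt => /orP[/eqP ->//|/mono'[ai bi]].
  have [|? ?//] := laminar_fix_ends (Gg n) (Gg i) (gab i) _ ga.
  by apply/andP; split; have := ab n; lra.
have [l [l1 l2]] := orbitals z.
pose good m (p : R * R) := exists2 u, p.1 <= u <= p.2 & forall f, K m f -> f u = u.
(* Being good is monotone in m, so one m settles the finitely many orbitals of z. With [0 < m], the
   point a 1 inside (a 0, b 0) is fixed by K m. *)
have [m [m0 Hm]] : exists m, (0 < m)%N /\ forall p, p \in l -> (exists m', good m' p) -> good m p.
  elim: l {l1 l2} => [|p l [m [m0 Hm]]]; first by exists 1%N.
  have [[m' gm']|H] := pselect (exists m', good m' p); last first.
    by exists m; split => // q; rewrite inE => /orP[/eqP -> /H|/Hm].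
  have goodle i j q : (i <= j)%N -> good i q -> good j q.
    by move=> ij [u uq Hu]; exists u => // f /(Kle _ _ ij)/Hu.
  exists (maxn m m'); split; first by rewrite leq_max m0.
  move=> q; rewrite inE => /orP[/eqP -> _|/Hm{}Hm /Hm].
    by apply: goodle gm'; exact: leq_maxr.
  by apply: goodle; exact: leq_maxl.
have zfix p : p \in l -> z p.1 = p.1 /\ z p.2 = p.2.
  by move=> /l1/orb1P[].
have good_fix p f : p \in l -> good m p -> K m f -> f p.1 = p.1 /\ f p.2 = p.2.
  move=> pl [u up Hu] Kf.
  exact: (laminar_fix_ends (KG _ _ Kf) (Gg 0%N) (l1 _ pl) up (Hu _ Kf)).
pose lb := [seq p <- l | ~~ `[< good m p >]].
pose g' := g m.+1; have Kg' : K m g' by exact: Kg.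
have lbfree p : p \in lb -> p.1 <= p.2 /\ fixfree (K m) p.
  rewrite mem_filter => /andP[/asboolPn ng pl]; split.
    by have [/ltW] := l1 _ pl.
  move=> x px xp; apply: contrapT => H; apply: ng; exists x; first exact/andP.
  by move=> f Kf; apply: contrapT => fx; apply: H; exists f.
(* The images under g' are included because s below first applies g'. *)
pose lX := lb ++ [seq (g' p.1, g' p.2) | p <- lb].
have lXfree p : p \in lX -> p.1 <= p.2 /\ fixfree (K m) p.
  rewrite mem_cat => /orP[/lbfree//|/mapP[q /lbfree[q12 fq] ->]].
  split; first by rewrite /= pl_le.
  move=> x /= qx xq.
  have [||f Kf fx] := fq (g'^-1%g x); rewrite -1?(pl_le g') ?plVK//.
  exists (f ^ g')%g; first exact: subgroupJ.
  by rewrite -[x](plVK g') plJ => /pl_inj.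
have Kgm : K m (g m) by exact: Kg.
have [c Kc [sc1 sc2]] := scatter_list (sK m) Kgm lXfree.
have s1 : side (1 : R) by left.
have [t Kt [st tab]] : exists2 t, K m t & scatters t (covered lX) /\ orb [set t] (a m) (b m).
  have /orb1P[_ ga gb _] := gab m.
  have [mg gmg] := germ_ex s1 ga; have mg1 := orb_germ_l (gab m) gmg.
  have mg0 := germ_gt0 s1 gmg.
  have [ca cb] := Kc.2 m (leqnn _).
  have [mc cmc] := germ_ex s1 ca; have mc0 := germ_gt0 s1 cmc.
  have full f k : K m f -> germ 1 f (a m) k -> k != 1 -> orb [set f] (a m) (b m).
    move=> Kf fk k1; have [e fae] := orb_from_l (ab m) fk k1 (Kf.2 m (leqnn _)).2.
    rewrite le_eqVlt => /orP[/eqP <-//|eb].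
    by exfalso; apply: lam; exact: (shared_l sG (KG _ _ Kf) (Gg m) fae (gab m) eb).
  (* The two candidates have slopes [mc * mg] and [mc^-1 * mg] at a m. Both cannot be 1, as mg is
     positive and differs from 1. A slope other than 1 makes (a m, b m) an orbital, for a shorter
     one would share the end a m. *)
  have [e1|n1] := eqVneq (mc * mg) 1; last first.
    exists (c * g m)%g; first exact: subgroupM.
    by split => //; apply: full n1; [exact: subgroupM|exact: germM].
  have Kcg : K m (c^-1 * g m)%g by apply: subgroupM => //; exact: subgroupV.
  exists (c^-1 * g m)%g => //; split => //.
  apply: (full _ (mc^-1 * mg) Kcg); first by apply: germM => //; exact: germV.
  apply/eqP => e2; move/eqP: mg1; apply.
  have mcE : mg = mc by rewrite -[LHS]mul1r -(mulfV (lt0r_neq0 mc0)) -mulrA e2 mulr1.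
  by rewrite mcE in e1 mg0 *; nra.
have /orb1P[_ g'a g'b _] := gab m.+1.
have [aS bS] := mono' m m.+1 (leqnn _).
have [||_ _ g'in] := laminar_inner sG lam (Gg m.+1) (KG _ _ Kt) tab _ _ g'a => //.
  by have := ab m.+1; lra.
have [i0 Hi0] := push g'in tab aS (ltW (ab _)) bS.
pose tau := (t ^+ i0.+1)%g; have Ktau : K m tau by exact: subgroupX.
have tauab : orb [set tau] (a m) (b m) by exact: orb_pow.
have g'tau u : a m.+1 <= u <= b m.+1 -> (g' ^ tau)%g u = u by apply: Hi0; rewrite leqnSn.
have stau : scatters tau (covered lX).
  by move=> x n Xx; rewrite -expgnA mulSn addSn; exact: st.
(* The square separates the supports of [Z ^ tau] and [Z ^ s] off the good orbitals; with g' tau in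
   place of s they could meet. On (a m, b m) the commutator of tau and s is the conjugate by tau2 of
   [(g'^-1 ^ tau) * g'], and this product acts as g' on (a m.+1, b m.+1). *)
pose tau2 := (tau * tau)%g; have Ktau2 : K m tau2 by exact: subgroupM.
pose s := (g' * tau2)%g; have Ks : K m s by exact: subgroupM.
have covb x : covered lb x -> covered lX x.
  by move=> [p pl px]; exists p; rewrite // mem_cat pl.
have covg x : covered lb x -> covered lX (g' x).
  move=> [p pl /andP[px xp]]; exists (g' p.1, g' p.2); last by rewrite /= !pl_le px.
  by rewrite mem_cat; apply/orP; right; apply/mapP; exists p.
have Btau x : covered lb x -> ~ covered lb (tau x).
  by move=> Bx /covb Bt; apply: (stau x 0%N (covb _ Bx)); rewrite expg1.
have Bs x : covered lb x -> ~ covered lb (s x).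
  by move=> Bx /covb By; apply: (stau (g' x) 1%N (covg _ Bx)); rewrite expgS expg1.
have Btaus x y : covered lb x -> covered lb y -> tau x <> s y.
  move=> Bx By e; apply: (stau (g' y) 0%N (covg _ By)); rewrite expg1.
  have -> : tau (g' y) = x by apply: (@pl_inj _ tau).
  exact: covb.
have [a01 b01] := mono' 0%N 1%N isT; have [a0m b0m] := mono' 0%N m m0.
have Kinner f : K m f -> inner f (a 0%N) (b 0%N).
  move=> Kf; have [f1 _] := Kf.2 1%N m0.
  have [||//] := laminar_inner sG lam (KG _ _ Kf) (Gg 0%N) (gab 0%N) _ _ f1 => //.
  by have := ab 1%N; lra.
have [j1 Hj1] := push (Kinner _ Ktau) (gab 0%N) a0m (ltW (ab m)) b0m.
have [j2 Hj2] := push (Kinner _ Ks) (gab 0%N) a0m (ltW (ab m)) b0m.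
pose Z := (z ^+ (maxn j1 j2))%g; have GZ : G Z by exact: (subgroupX _ sG (Gg 0%N)).
pose P := [~ Z, tau]%g; pose Q := [~ Z, s]%g; pose k := [~ P, Q]%g.
have [Gtau Gs] := (KG _ _ Ktau, KG _ _ Ks).
have GP : G P by exact: (subgroupR sG GZ Gtau).
have GQ : G Q by exact: (subgroupR sG GZ Gs).
have Gk : G k by exact: subgroupR.
have good_all f p : (f = z \/ K m f) -> p \in l -> good m p -> f p.1 = p.1 /\ f p.2 = p.2.
  by move=> [->|Kf] pl gp; [exact: zfix|exact: good_fix].
pose C := [set x | forall p, p \in l -> good m p -> ~ (p.1 < x < p.2)].
have Cst f : (f = z \/ K m f) -> stable C f.
  move=> Hf x Cx p pl gp; have [f1 f2] := good_all f p Hf pl gp.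
  by rewrite -{1}f1 -{1}f2 !pl_lt; exact: Cx.
have CstV f : (f = z \/ K m f) -> stable C f^-1%g.
  move=> Hf x Cx p pl gp; have [f1 f2] := good_all f p Hf pl gp.
  by rewrite -{1}(plV_fix f1) -{1}(plV_fix f2) !pl_lt; exact: Cx.
have CZ : stable C Z.
  rewrite /Z; elim: (maxn j1 j2) => [//|n IH] x Cx.
  by rewrite expgSr plM; apply: Cst; [left|exact: IH].
have CZV : stable C Z^-1%g.
  rewrite /Z -expVgn; elim: (maxn j1 j2) => [//|n IH] x Cx.
  by rewrite expgSr plM; apply: CstV; [left|exact: IH].
have CJ f : K m f -> stable C (Z ^ f)%g.
  move=> Kf; rewrite /conjg; apply: stableM; first by apply: CstV; right.
  by apply: stableM => //; apply: Cst; right.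
have CJV f : K m f -> stable C (Z ^ f)^-1%g.
  move=> Kf; rewrite -conjVg /conjg; apply: stableM; first by apply: CstV; right.
  by apply: stableM => //; apply: Cst; right.
have ZB x : C x -> Z x <> x -> covered lb x.
  move=> Cx Zx; have zx : z x <> x by move=> zx; apply: Zx; exact: plX_fix.
  have [p pl /andP[px xp]] := l2 _ zx; exists p; last by rewrite !ltW.
  rewrite mem_filter pl andbT; apply/asboolPn => gp; apply: (Cx p) => //; exact/andP.
have ZJB f x : K m f -> C x -> (Z ^ f)%g x <> x -> covered lb (f^-1%g x).
  move=> Kf Cx; rewrite -{1 2}[x](plVK f) plJ => H; apply: ZB; first by apply: CstV => //; right.
  by move=> e; apply: H; rewrite e.
have cm1 : commute_on C Z (Z ^ tau)%g.
  apply: commute_on_disjoint => //; first exact: CJ.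
  move=> x Cx Zx; apply: contrapT => Jx; have := Btau _ (ZJB _ _ Ktau Cx Jx).
  by apply; rewrite plVK; exact: ZB.
have cm2 : commute_on C Z (Z ^ s)%g.
  apply: commute_on_disjoint => //; first exact: CJ.
  move=> x Cx Zx; apply: contrapT => Jx; have := Bs _ (ZJB _ _ Ks Cx Jx).
  by apply; rewrite plVK; exact: ZB.
have cm3 : commute_on C (Z ^ tau)%g (Z ^ s)%g.
  apply: commute_on_disjoint; [exact: CJ|exact: CJ|].
  move=> x Cx Zx; apply: contrapT => Jx.
  by apply: (Btaus _ _ (ZJB _ _ Ktau Cx Zx) (ZJB _ _ Ks Cx Jx)); rewrite !plVK.
have CP : stable C P by apply: stableM => //; exact: CJ.
have kC x : C x -> k x = x.
  apply: commute_on_comm.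
  - by rewrite /P /commg invgM; apply: stableM; [exact: CJV|rewrite invgK].
  - by rewrite /Q /commg invgM; apply: stableM; [exact: CJV|rewrite invgK].
  have cmQ f : commute_on C Z f -> commute_on C (Z ^ s)%g f -> commute_on C Q f.
    by move=> Zf sf; apply: commute_onM => //; exact: commute_onV.
  have ZQ : commute_on C Z Q.
    by apply: commute_on_sym; apply: cmQ => //; exact: commute_on_sym.
  rewrite /P /commg; apply: commute_onM => //; first exact: commute_onV.
  by apply: commute_on_sym; apply: cmQ => //; exact: commute_on_sym.
have kl x : supp k x -> exists2 p, p \in l & good m p /\ p.1 < x < p.2.
  move=> kx; apply: contrapT => H; apply: kx; apply: kC => p pl gp px.
  by apply: H; exists p.
have [M HM] : exists M, scatters (z ^+ M.+1)%g (supp k).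
  apply: (@expg_scatters z [seq p <- l | `[< good m p >]]).
  - by move=> p; rewrite mem_filter => /andP[_ /l1].
  - move=> p; rewrite mem_filter => /andP[/asboolP gp pl].
    have [z1 z2] := zfix _ pl; have [t1 t2] := good_fix _ _ pl gp Ktau.
    have [s'1 s'2] := good_fix _ _ pl gp Ks.
    have fixR (f h : PLo R) x : f x = x -> h x = x -> [~ f, h]%g x = x.
      by move=> fx hx; rewrite plR plJE !(plV_fix fx, plV_fix hx) fx hx.
    have [q1 [q2 [? ? ? Hq]]] : inner k p.1 p.2.
      apply: germ1_inner; first by have [] := l1 _ pl.
        by apply: germR; [left|apply: fixR => //; exact: plX_fix|
          apply: fixR => //; exact: plX_fix].
      by apply: germR; [right|apply: fixR => //; exact: plX_fix|
        apply: fixR => //; exact: plX_fix].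
    by exists q1, q2.
  - move=> x /kl[p pl [gp px]]; exists p => //.
    by rewrite mem_filter pl andbT; apply/asboolP.
have PE u : a m <= u <= b m -> P u = tau u.
  by move=> uab; apply: comm_r; apply: Hj1 => //; rewrite leq_maxl.
have QE u : a m <= u <= b m -> Q u = s u.
  by move=> uab; apply: comm_r; apply: Hj2 => //; rewrite leq_maxr.
have invK f u : K m f -> a m <= u <= b m -> a m <= f u <= b m.
  by move=> [_ /(_ m (leqnn _))[fa fb]]; rewrite -{2}fa -{2}fb !pl_le.
have kE v : a m.+1 <= v <= b m.+1 -> k (tau2 v) = tau2 (g' v).
  move=> v1; have v0 : a m <= v <= b m by move/andP: v1 => [? ?]; apply/andP; split; lra.
  have -> : k (tau2 v) = Q (P (Q^-1%g (P^-1%g (tau2 v)))) by [].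
  have -> : P^-1%g (tau2 v) = tau v.
    by apply: (@pl_inj _ P); rewrite plVK PE//; exact: invK.
  have w0 : a m <= g'^-1%g (tau^-1%g v) <= b m.
    exact: (invK _ _ (subgroupV (sK m) Kg') (invK _ _ (subgroupV (sK m) Ktau) v0)).
  have -> : Q^-1%g (tau v) = g'^-1%g (tau^-1%g v).
    by apply: (@pl_inj _ Q); rewrite plVK QE// /s /tau2 !plM !plVK.
  rewrite PE// QE; last exact: invK.
  have -> : tau (g'^-1%g (tau^-1%g v)) = v.
    by rewrite -plJE conjVg; apply: plV_fix; exact: g'tau.
  by rewrite /s /tau2 !plM.
(* The new tower is the tail from m + 1 on, carried along by tau2, with k as its first signature. *)
exists (fun n => tau2 (a (m.+1 + n)%N)), (fun n => tau2 (b (m.+1 + n)%N)),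
  (fun n => if n is n'.+1 then (g (m.+1 + n)%N ^ tau2)%g else k), M; split.
- move=> n; have [a1 b1 _ _] := dg (m.+1 + n)%N; rewrite !pl_lt addnS; split => //.
    by case: n {a1 b1} => [//|n]; apply: subgroupJ => //; exact: KG Ktau2.
  case: n {a1 b1} => [|n]; last by apply: orbJ; rewrite addnS.
  rewrite addn0; have /orb1P[_ _ _ mv] := gab m.+1; have abS := ab m.+1.
  apply/orb1P; split; rewrite ?pl_lt// ?kE ?g'a ?g'b ?lexx ?ltW//.
  move=> x ax xb; rewrite -[x](plVK tau2) kE.
    by move=> /pl_inj; apply: mv; rewrite -(pl_lt tau2) plVK.
  by apply/andP; split; rewrite -(pl_le tau2) plVK ltW.
- exact: HM.
- by move=> x /kl[p pl [_ /andP[px xp]]]; have /orb1P[_ _ _] := l1 _ pl; apply.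
Qed.

(** [deep_step] is iterated on whole towers. The exponent of h n comes from the step after stage n;
    positive powers have the same support, so inclusions of supports are not affected. *)
Lemma laminar_deep a b (g : nat -> PLo R) : descending a b g -> exists h : nat -> PLo R,
  [/\ forall n, G (h n), forall n, h n <> 1%g, forall n, supp (h n.+1) `<=` supp (h n) &
      forall n, scatters (h n) (supp (h n.+1))].
Proof.
move=> dg.
pose St := ((nat -> R) * (nat -> R) * (nat -> PLo R))%type.
pose ok (t : St) := descending t.1.1 t.1.2 t.2.
have /choice[next nextP] : forall t : St, exists u : St * nat, ok t ->
    [/\ ok u.1, scatters (t.2 0%N ^+ u.2.+1)%g (supp (u.1.2 0%N)) &
      supp (u.1.2 0%N) `<=` supp (t.2 0%N)].
  move=> t; have [okt|] := pselect (ok t); last by exists (t, 0%N).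
  have [a' [b' [g' [M [d' s' p']]]]] := deep_step okt.
  by exists (a', b', g', M).
pose S n := iter n (fun t => (next t).1) (a, b, g).
have okS n : ok (S n) by elim: n => [//|n IH] /=; have [] := nextP _ IH.
pose h n := ((S n).2 0%N ^+ (next (S n)).2.+1)%g.
have hsupp n x : supp (h n) x <-> supp ((S n).2 0%N) x.
  split=> [hx e|fx]; first by apply: hx; exact: plX_fix.
  have [|c [d [fcd cx xd]]] := @orb_ex _ [set ((S n).2 0%N)] x; first by exists ((S n).2 0%N).
  by have /orb1P[_ _ _] := orb_pow (next (S n)).2 fcd; apply.
exists h; split.
- by move=> n; have [_ _ Gn _] := okS n 0%N; exact: subgroupX.
- move=> n; have [_ _ _ /orb1P[cd _ _ mv]] := okS n 0%N.
  set c := (S n).1.1 0%N in cd mv; set d := (S n).1.2 0%N in cd mv.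
  have : supp (h n) ((c + d) / 2) by apply/hsupp; apply: mv; lra.
  by move=> hx e; apply: hx; rewrite e.
- by move=> n x /hsupp; have [_ _ H] := nextP _ (okS n) => /H/hsupp.
- by move=> n; have [_ H _] := nextP _ (okS n); apply: scatters_sub H => x /hsupp.
Qed.

End Deep.

(** * Groups with a chain *)

Section Ergodic.
Variable R : realType.
Implicit Types (f g u k w : PLo R) (x y z t : R) (N M A : set (PLo R)).

Lemma move_nbhd f x : f x <> x -> exists v1 v2, [/\ v1 < x, x < v2 & displaces f (v1, v2)].
Proof.
move=> fx; have [lt|lt|//] := ltgtP (f x) x.
  pose m := (f x + x) / 2.
  have m1 : f x < m by rewrite /m; lra.
  have m2 : m < x by rewrite /m; lra.
  have m3 : x < f^-1%g m by rewrite -(pl_lt f) plVK.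
  exists m, ((x + f^-1%g m) / 2); split => //; first by lra.
  by right; rewrite /= -[X in _ < X](plVK f) pl_lt; lra.
pose m := (f x + x) / 2.
have m1 : x < m by rewrite /m; lra.
have m2 : m < f x by rewrite /m; lra.
have m3 : f^-1%g m < x by rewrite -(pl_lt f) plVK.
exists ((x + f^-1%g m) / 2), m; split => //; first by lra.
by left; rewrite /= -[X in X < _](plVK f) pl_lt; lra.
Qed.

Lemma displaces_moves f (p : R * R) x : p.1 <= x <= p.2 -> displaces f p -> f x <> x.
Proof.
move=> /andP[px xp] [H|H] e.
  by move: px; rewrite -(pl_le f) e; lra.
by move: xp; rewrite -(pl_le f) e; lra.
Qed.

Variables (H : set (PLo R)) (l0 r0 c b : R).
Hypotheses (sH : is_subgroup H) (H0 : orb H l0 r0) (l0c : l0 < c) (cb : c <= b) (br0 : b < r0).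
(* For H = <g, h> and a chain a < c < b < d, (l0, r0) is the component around b. *)
Hypothesis cocompact : forall x, l0 < x -> x < r0 -> exists2 w, H w & c <= w x <= b.

Local Notation D := (derv H).

Definition nofix N : Prop := forall x, l0 < x -> x < r0 -> exists2 f, N f & f x <> x.

Definition big A N : Prop := [/\ is_subgroup N, N `<=` D, normal_in A N & nofix N].

Lemma cb_in t : c <= t <= b -> l0 < t < r0.
Proof. by move=> /andP[ct tb]; rewrite (lt_le_trans l0c)//= (le_lt_trans tb). Qed.

Lemma H_in l r w x : orb H l r -> H w -> l < x < r -> l < w x < r.
Proof. exact: orb_in. Qed.

Lemma derv_inner u l r : D u -> orb H l r -> inner u l r.
Proof.
move=> [_ u1] [lr Hlr _]; apply: germ1_inner => //; apply: u1.
- by left.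
- by move=> w /Hlr[].
- by right.
- by move=> w /Hlr[].
Qed.

(** n carries the support of u in (l, r) off itself, so the conjugate of u by n is trivial on that
    support. *)
Lemma comm_displaced u n l r y z x : orb H l r -> H u -> H n ->
  (forall x, l < x -> x < r -> u x <> x -> y < x /\ x < z) -> z < n y ->
  l < x < r -> u x <> x -> [~ u, n]%g x = u^-1%g x.
Proof.
move=> lr Hu Hn Hyz zn xlr ux.
have ux' : u (u^-1%g x) <> u^-1%g x.
  by rewrite plVK => e; apply: ux; rewrite {1}e plVK.
have /andP[x1 x2] := H_in lr (subgroupV sH Hu) xlr.
have [_ xz] := Hyz _ x1 x2 ux'.
rewrite plR plJE; have -> : u (n^-1%g (u^-1%g x)) = n^-1%g (u^-1%g x).
  apply: contrapT => un; have /andP[v1 v2] : l < n^-1%g (u^-1%g x) < r.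
    by apply: (H_in lr (subgroupV sH Hn)); rewrite x1.
  have [+ _] := Hyz _ v1 v2 un; rewrite -(pl_lt n) plVK; lra.
by rewrite plVK.
Qed.

Lemma nofix_right N y z : is_subgroup N -> nofix N -> l0 < y -> z < r0 ->
  exists2 n, N n & z < n y.
Proof.
move=> sN nN ly zr; apply: displace_right => // x yx xz; apply: nN; lra.
Qed.

(** If u in N1 moves x and n in N2 moves the support of u in (l0, r0) off itself, then their
    commutator lies in both subgroups and acts at x as [u^-1]. *)
Lemma bigI A N1 N2 : A `<=` H -> N1 `<=` A -> N2 `<=` A ->
  big A N1 -> big A N2 -> big A (N1 `&` N2).
Proof.
move=> AH N1A N2A [s1 D1 n1 f1] [s2 D2 n2 f2]; split.
- split; first by split; exact: subgroup1.
    by move=> f g [? ?] [? ?]; split; exact: subgroupM.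
  by move=> f [? ?]; split; exact: subgroupV.
- by move=> f [/D1].
- by move=> f w [? ?] Aw; split; [exact: n1|exact: n2].
- move=> x lx xr; have [u N1u ux] := f1 x lx xr.
  have [y [z [ly yz zr Hyz]]] := derv_inner (D1 _ N1u) H0.
  have [n N2n zn] := nofix_right s2 f2 ly zr.
  exists [~ u, n]%g.
    split.
      rewrite /commg; apply: subgroupM => //; first exact: subgroupV.
      by apply: n1 => //; exact: N2A.
    have -> : [~ u, n]%g = ((n^-1 ^ u) * n)%g by rewrite /commg /conjg !mulgA.
    by apply: subgroupM => //; apply: n2; [exact: subgroupV|exact: N1A].
  rewrite (@comm_displaced _ _ _ _ y z _ H0) ?lx//; try exact/AH/N1A; try exact/AH/N2A.
  by move=> /plV_fixE.
Qed.

Hypothesis nofixD : nofix D.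

Lemma bigD : big H D.
Proof. by split => //; [exact: derv_subgroup|exact: derv_normal]. Qed.

Definition trivial_on N (p : R * R) : Prop := forall f x, N f -> p.1 < x < p.2 -> f x = x.

Definition unkillable (p : R * R) : Prop := forall N, big H N -> ~ trivial_on N p.

Lemma kill (cs : seq (R * R)) : exists2 N, big H N &
  forall p, p \in cs -> trivial_on N p \/ unkillable p.
Proof.
elim: cs => [|p cs [N bN HN]]; first by exists D => //; exact: bigD.
have [up|] := pselect (unkillable p).
  by exists N => // q; rewrite inE => /orP[/eqP ->|/HN//]; right.
move=> /existsNP[N' /not_implyP[bN' /contrapT tN']].
have sub N0 : big H N0 -> N0 `<=` H by move=> [_ N0D _ _] f /N0D; exact: derv_sub.
exists (N `&` N'); first by apply: bigI => //; exact: sub.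
move=> q; rewrite inE => /orP[/eqP ->|/HN[tN|?]].
- by left=> f x [_]; exact: tN'.
- by left=> f x [+ _]; exact: tN.
- by right.
Qed.

(** By cocompactness, conjugates of k move every point of (l0, r0). The elements of N trivial on p
    would then form a big subgroup. *)
Lemma unkillable_false N k w (p : R * R) : big H N -> orb H p.1 p.2 -> unkillable p ->
  N k -> H w -> (forall t, c <= t <= b -> k (w t) <> w t) ->
  (forall x, p.1 < x < p.2 -> k x = x) -> False.
Proof.
move=> [sN ND nN _] Hp up Nk Hw kw kp.
pose M := [set f : PLo R | N f /\ forall x, p.1 < x < p.2 -> f x = x].
apply: (up M); last by move=> f x [_]; apply.
split.
- split; first by split => //; exact: subgroup1.
    move=> f g [Nf fp] [Ng gp]; split; first exact: subgroupM.
    by move=> x px; rewrite plM fp// gp.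
  move=> f [Nf fp]; split; first exact: subgroupV.
  by move=> x px; rewrite plV_fix// fp.
- by move=> f [/ND].
- move=> f v [Nf fp] Hv; split; first exact: nN.
  move=> x px; rewrite plJE fp ?plVK//.
  by apply: (H_in Hp) => //; exact: subgroupV.
- move=> x lx xr; have [v Hv vx] := cocompact lx xr.
  have Hvw : H (v * w)^-1%g by apply: subgroupV => //; exact: subgroupM.
  exists (k ^ (v * w)^-1)%g.
    split; first exact: nN.
    move=> y py; rewrite plJE invgK kp ?plK//.
    by apply: (H_in Hp) => //; rewrite -[(v * w)%g]invgK; exact: subgroupV.
  by rewrite -[in X in X <> _](plK (v * w)%g x) plJ => /(congr1 (v * w)%g); rewrite plVK; exact: kw.
Qed.

(** Suppose g moves j to the right. Some n in N carries j beyond [g j], so [g * n^-1] moves j to the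
    left, while near r0, where n is the identity, it still moves points to the right; a fixed point
    lies in between. The other case is symmetric. *)
Lemma fix_correct N g : big H N -> H g ->
  exists2 f, N f & exists x, [/\ l0 < x, x < r0 & f (g x) = x].
Proof.
move=> [sN ND _ nN] Hg.
have [[x [lx xr gx]]|nf] := pselect (exists x, [/\ l0 < x, x < r0 & g x = x]).
  by exists 1%g; [exact: subgroup1|exists x].
have lr : l0 < r0 by exact: lt_trans l0c (le_lt_trans cb br0).
pose j := (l0 + r0) / 2.
have jlr : l0 < j < r0 by rewrite /j; apply/andP; split; lra.
have /andP[lj jr] := jlr; have /andP[lgj gjr] := H_in H0 Hg jlr.
have [lt|lt|e] := ltgtP j (g j); last by case: nf; exists j.
  have [n Nn jn] := nofix_right sN nN lj gjr.
  have [y [z [ly yz zr Hyz]]] := derv_inner (ND _ (subgroupV sN Nn)) H0.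
  exists n^-1%g; first exact: subgroupV.
  pose m := Num.max j (g^-1%g z).
  have mr : m < r0.
    by rewrite gt_max jr -(pl_lt g) plVK; have [_ /(_ _ Hg)[_ ->] _] := H0.
  pose j' := (m + r0) / 2.
  have mj' : m < j' by rewrite /j'; lra.
  have j'r : j' < r0 by rewrite /j'; lra.
  have jj' : j < j' by apply: le_lt_trans mj'; rewrite le_max lexx.
  have zj' : z < g j'.
    by rewrite -(plVK g z) pl_lt; apply: le_lt_trans mj'; rewrite le_max lexx orbT.
  have gj' : j' < g j'.
    have [//|h|h] := ltgtP j' (g j'); last by case: nf; exists j'; split => //; lra.
    have [p [jp pj' gp]] := ivt_right jj' lt h.
    by case: nf; exists p; split => //; lra.
  have nj' : n^-1%g (g j') = g j'.
    have /andP[w1 w2] : l0 < g j' < r0 by apply: (H_in H0 Hg); apply/andP; split; lra.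
    by apply: contrapT => nn; have [_ ?] := Hyz _ w1 w2 nn; lra.
  have [||p [jp pj' fp]] := @ivt_left _ (g * n^-1)%g j j' jj'.
  - by rewrite plM -(pl_lt n) plVK.
  - by rewrite plM nj'.
  by exists p; split => //; lra.
have [n Nn jn] := nofix_right sN nN lgj jr.
have [y [z [ly yz zr Hyz]]] := derv_inner (ND _ Nn) H0.
exists n => //.
pose m := Num.min j (g^-1%g y).
have lm : l0 < m.
  by rewrite lt_min lj -(pl_lt g) plVK; have [_ /(_ _ Hg)[-> _] _] := H0.
pose j' := (l0 + m) / 2.
have mj' : j' < m by rewrite /j'; lra.
have lj' : l0 < j' by rewrite /j'; lra.
have jj' : j' < j by apply: (lt_le_trans mj'); rewrite ge_min lexx.
have yj' : g j' < y.
  by rewrite -(plVK g y) pl_lt; apply: (lt_le_trans mj'); rewrite ge_min lexx orbT.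
have gj' : g j' < j'.
  have [h|//|h] := ltgtP j' (g j'); last by case: nf; exists j'; split => //; lra.
  have [p [jp pj' gp]] := ivt_right jj' h lt.
  by case: nf; exists p; split => //; lra.
have nj' : n (g j') = g j'.
  have /andP[w1 w2] : l0 < g j' < r0 by apply: (H_in H0 Hg); apply/andP; split; lra.
  by apply: contrapT => nn; have [? _] := Hyz _ w1 w2 nn; lra.
have [||p [jp pj' fp]] := @ivt_left _ (g * n)%g j' j jj'.
- by rewrite plM nj'.
- by rewrite plM.
by exists p; split => //; lra.
Qed.

Lemma monotone_orbit f x y : f y = y -> exists2 g, g = f \/ g = f^-1%g &
  forall i, Num.min x y <= (g ^+ i)%g x <= Num.max x y.
Proof.
move=> fy.
have up g : g y = y -> x <= y -> x <= g x -> forall i, x <= (g ^+ i)%g x <= y.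
  move=> gy xy xg; elim=> [|i /andP[IH1 IH2]]; first by rewrite lexx.
  by rewrite expgSr plM -{1}gy pl_le IH2 andbT (le_trans xg)// pl_le.
have dn g : g y = y -> y <= x -> g x <= x -> forall i, y <= (g ^+ i)%g x <= x.
  move=> gy xy xg; elim=> [|i /andP[IH1 IH2]]; first by rewrite lexx xy.
  by rewrite expgSr plM -{1}gy pl_le IH1 /= (le_trans _ xg)// pl_le.
have vy := plV_fix fy.
have V1 : f x <= x -> x <= f^-1%g x by move=> h; rewrite -(pl_le f) plVK.
have V2 : x <= f x -> f^-1%g x <= x by move=> h; rewrite -(pl_le f) plVK.
have [xy|/ltW xy] := leP x y; have [xf|/ltW xf] := leP x (f x).
- by exists f; [left|move=> i; exact: up].
- by exists f^-1%g; [right|move=> i; apply: up => //; exact: V1].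
- by exists f^-1%g; [right|move=> i; apply: dn => //; exact: V2].
- by exists f; [left|move=> i; exact: dn].
Qed.

Lemma avoid (s : seq R) (B : nat -> R -> Prop) :
  (forall i j x, B i x -> B j x -> i = j) -> exists i, forall t, t \in s -> ~ B i t.
Proof.
move=> dB; suff [i0 Hi] : exists i0, forall i, (i0 <= i)%N -> forall t, t \in s -> ~ B i t.
  by exists i0; exact: Hi.
elim: s => [|t s [i0 Hi]]; first by exists 0%N.
have [[i Bi]|nB] := pselect (exists i, B i t).
  exists (maxn i0 i.+1) => j; rewrite geq_max => /andP[/Hi{}Hi ij] t'.
  rewrite inE => /orP[/eqP ->|/Hi//] /(dB _ _ _ Bi) e.
  by rewrite e ltnn in ij.
exists i0 => j /Hi{}Hi t'; rewrite inE => /orP[/eqP -> Bj|/Hi//].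
by apply: nB; exists j.
Qed.

Lemma orbital_between N u e1 e2 (q : R * R) x : N u -> (forall f, N f -> f e1 = e1 /\ f e2 = e2) ->
  orb [set u] q.1 q.2 -> q.1 < x < q.2 -> e1 < x < e2 -> e1 < (q.1 + q.2) / 2 < e2.
Proof.
move=> Nu He /orb1P[q12 _ _ mv] /andP[qx xq] /andP[ex xe]; have [ue1 ue2] := He _ Nu.
have h1 : e1 <= q.1 by rewrite leNgt; apply/negP => ?; apply: (mv e1) => //; lra.
have h2 : q.2 <= e2 by rewrite leNgt; apply/negP => ?; apply: (mv e2) => //; lra.
by apply/andP; split; lra.
Qed.

Definition block_kernel N t : set (PLo R) := [set f | N f /\
  forall e1 e2, orb N e1 e2 -> e1 < t < e2 -> forall x, e1 < x < e2 -> f x = x].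

(* If N fixes a point of p, its orbitals in p are permuted by H. A fixed point q of
   block_kernel N t yields fixed points F^i q of the kernels on infinitely many
   blocks, all in the compact interval between q and the fixed point z0 of F; but
   an element of N moving this whole interval is trivial on almost all blocks. *)
Lemma block_kernel_nofix N (p : R * R) x t : big H N -> orb H p.1 p.2 ->
  p.1 < x < p.2 -> (forall f, N f -> f x = x) -> p.1 < t < p.2 ->
  (exists2 f, N f & f t <> t) -> nofix (block_kernel N t).
Proof.
move=> bN Hp px Nx pt tN; have [sN ND nN fN] := bN.
have NH f : N f -> H f by move=> /ND/derv_sub.
move=> q lq qr; apply: contrapT => Hq.
have {}Hq f : block_kernel N t f -> f q = q.
  by move=> Nf; apply: contrapT => fq; apply: Hq; exists f.
have [e1 [e2 [Ne e1t te2]]] := orb_ex tN.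
have Nfix w f y : H w -> N f -> (forall f, N f -> f y = y) -> f (w y) = w y.
  move=> Hw Nf Hy; have := Hy _ (nN _ _ Nf (subgroupV sH Hw)).
  by rewrite plJE invgK => /(congr1 w); rewrite plVK.
(* N is normal in H, so translates of its fixed point x are fixed by N; two of them enclose t. *)
have [p1 [p2 [pp1 p1t tp2 pp2 Np]]] : exists p1 p2, [/\ p.1 < p1, p1 < t, t < p2, p2 < p.2 &
    forall f, N f -> f p1 = p1 /\ f p2 = p2].
  move: px pt => /andP[x1 x2] /andP[t1 t2].
  have [|w Hw wlt] := @displace_right _ H (Num.min x t) (Num.max x t) sH.
    move=> y y1 y2; have [_ _] := Hp; apply.
      by apply: lt_le_trans y1; rewrite lt_min x1.
    by apply: (le_lt_trans y2); rewrite gt_max x2.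
  have wx : t < w x.
    apply: (@le_lt_trans _ _ (Num.max x t)); first by rewrite le_max lexx orbT.
    by apply: (lt_le_trans wlt); rewrite pl_le ge_min lexx.
  have wVx : w^-1%g x < t.
    rewrite -(pl_lt w) plVK.
    apply: (@le_lt_trans _ _ (Num.max x t)); first by rewrite le_max lexx.
    by apply: (lt_le_trans wlt); rewrite pl_le ge_min lexx orbT.
  have HwV := subgroupV sH Hw.
  have /andP[? ?] : p.1 < w x < p.2 by apply: (H_in Hp) => //; rewrite x1.
  have /andP[? ?] : p.1 < w^-1%g x < p.2 by apply: (H_in Hp) => //; rewrite x1.
  exists (w^-1%g x), (w x); split => // f Nf; split; exact: Nfix.
have [|h Hh hp] := @displace_right _ H p1 p2 sH.
  by move=> y y1 y2; have [_ _] := Hp; apply; lra.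
have [eta Neta [z0 [lz0 z0r fz0]]] := fix_correct bN Hh.
(* The factor eta creates the fixed point z0 and does not change the image of p1, because [h p1] is
   fixed by N. *)
pose f' := (h * eta)%g; have f'z0 : f' z0 = z0 by [].
have Hf' : H f' by apply: subgroupM => //; exact: NH.
have f'p : p2 < f' p1.
  rewrite /f' plM (_ : eta (h p1) = h p1)//.
  by apply: Nfix => // f /Np[].
have [F FE HF] := monotone_orbit q f'z0.
have HFH : H F by case: FE => ->//; exact: subgroupV.
have dF : displaces F (p1, p2).
  case: FE => ->; first by left.
  by right; rewrite /= -(pl_lt f') plVK.
have [u Nu uK] : exists2 u, N u & Num.max q z0 < u (Num.min q z0).
  by apply: nofix_right => //; [rewrite lt_min lq|rewrite gt_max qr].
have [lu [lu1 lu2]] := orbitals u.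
(* The images of [p1, p2] under powers of F are disjoint, so one of them contains no midpoint of an
   orbital of u. An orbital of u meeting a component of N lies in it together with its midpoint, so
   u is trivial on the components inside that image. *)
have [|i Hi] := @avoid [seq (q.1 + q.2) / 2 | q <- lu]
  (fun i x => p1 <= ((F ^+ i)^-1)%g x <= p2).
  move=> i j y; wlog: i j / (i < j)%N => [wl Bi Bj|ij Bi Bj].
    have [lt|lt|//] := ltngtP i j; first exact: (wl i j).
    by apply/esym; exact: (wl j i).
  have /negP[] := displaces_pow (j - i.+1) (p := (p1, p2)) (ltW (lt_trans p1t tp2)) dF Bj.
  have -> : (F ^+ (j - i.+1).+1)%g (((F ^+ j)^-1)%g y) = ((F ^+ i)^-1)%g y => //.
  apply: (@pl_inj _ (F ^+ i)%g); rewrite plVK -plM -expgnDr.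
  by rewrite -subSn// subSS subnK ?plVK// ltnW.
set Fi := (F ^+ i)%g in Hi; have HFi : H Fi by exact: subgroupX.
have /andP[K1 K2] := HF i; rewrite -/Fi in K1 K2.
have uq : u (Fi q) <> Fi q.
  apply: (@displaces_moves _ (Num.min q z0, Num.max q z0)); first by rewrite K1.
  by left.
apply: uq; have : (u ^ Fi^-1)%g q = q.
  apply: Hq; split; first by apply: nN => //; exact: subgroupV.
  move=> e1' e2' Ne' te' y ye'; rewrite plJE invgK.
  suff -> : u (Fi y) = Fi y by rewrite plK.
  apply: contrapT => uFy; have [q' q'l qy] := lu2 _ uFy.
  have [_ Ne12 mN'] := Ne'.
  have e1p : p1 <= e1'.
    rewrite leNgt; apply/negP => lt; have [|g Ng] := mN' p1 lt; first lra.
    by case; case: (Np g Ng).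
  have e2p : e2' <= p2.
    rewrite leNgt; apply/negP => lt; have [|g Ng] := mN' p2 _ lt; first lra.
    by case; case: (Np g Ng).
  apply: (Hi ((q'.1 + q'.2) / 2)); first by apply/mapP; exists q'.
  have := @orbital_between N u (Fi e1') (Fi e2') q' (Fi y) Nu _ (lu1 _ q'l) qy.
  rewrite !pl_lt => /(_ _ ye') H1.
  have /andP[h1 h2] : Fi e1' < (q'.1 + q'.2) / 2 < Fi e2'.
    by apply: H1 => f Nf; split; apply: Nfix => // g /Ne12[].
  apply/andP; split; rewrite -(pl_le Fi) plVK.
    by apply: ltW; apply: le_lt_trans h1; rewrite pl_le.
  by apply: ltW; apply: (lt_le_trans h2); rewrite pl_le.
by rewrite -{1}[q](plK Fi) plJ => /(congr1 Fi); rewrite plVK.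
Qed.

Lemma comm_triv f g x : f x = x -> g x = x -> [~ f, g]%g x = x.
Proof. by move=> fx gx; rewrite plR plJE !(plV_fix fx, plV_fix gx) fx gx. Qed.

(** If N fixed a point of p, block kernels would provide a big M trivial on every component of N in
    p that contains an orbital of u. For n in M the commutator of u and n is trivial on p, since on
    each component u or n is trivial, and n can be chosen so that it moves all of [c, b]. This
    contradicts [unkillable_false]. *)
Lemma unkillable_nofix N (p : R * R) : big H N -> orb H p.1 p.2 -> unkillable p ->
  forall x, p.1 < x < p.2 -> exists2 f, N f & f x <> x.
Proof.
move=> bN Hp up x px; have [sN ND nN fN] := bN; apply: contrapT => Nx.
have NH : N `<=` H by move=> f /ND/derv_sub.
have {}Nx f : N f -> f x = x by move=> Nf; apply: contrapT => fx; apply: Nx; exists f.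
have [u Nu ucb] := nofix_right sN fN l0c br0.
have [lu [lu1 lu2]] := orbitals u.
pose mid (q : R * R) := (q.1 + q.2) / 2.
have [M bM HM] : exists2 M, big N M /\ M `<=` N & forall q, q \in lu -> p.1 < mid q < p.2 ->
    M `<=` block_kernel N (mid q).
  elim: lu lu1 {lu2} => [|q lu IH] lu1.
    exists N => //; split => //; split => //.
    by move=> f w Nf Nw; exact: subgroupJ.
  have [|M [bM MN] HM] := IH; first by move=> q' q'l; apply: lu1; rewrite inE q'l orbT.
  have [pq|npq] := pselect (p.1 < mid q < p.2); last first.
    by exists M => // q'; rewrite inE => /orP[/eqP ->|/HM].
  pose B := block_kernel N (mid q).
  have BN : B `<=` N by move=> f [].
  have bB : big N B.
    split; first split.
    - split => //; exact: subgroup1.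
    - move=> f g [Nf Hf] [Ng Hg]; split; first exact: subgroupM.
      by move=> e1 e2 Ne qe y ye; rewrite plM (Hf e1 e2)// (Hg e1 e2).
    - move=> f [Nf Hf]; split; first exact: subgroupV.
      by move=> e1 e2 Ne qe y ye; apply: plV_fix; exact: (Hf e1 e2).
    - by move=> f /BN/ND.
    - move=> f w [Nf Hf] Nw; split; first exact: subgroupJ.
      move=> e1 e2 Ne qe y ye; rewrite plJE (Hf e1 e2)// ?plVK//.
      by apply: (orb_in Ne) => //; exact: subgroupV.
    - apply: (block_kernel_nofix bN Hp px Nx pq); exists u => //.
      by have /orb1P[q12 _ _ mv] := lu1 q (mem_head _ _); apply: mv; rewrite /mid; lra.
  exists (M `&` B); first by split; [exact: bigI|by move=> f [/MN]].
  move=> q'; rewrite inE => /orP[/eqP -> _|/HM{}HM /HM{}HM]; first by move=> f [].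
  by move=> f [/HM].
case: bM => [[sM MD nM fM] MN].
have [y [z [ly yz zr Hyz]]] := derv_inner (ND _ Nu) H0.
have [n Mn zn] := nofix_right sM fM ly zr.
have Nn := MN _ Mn.
apply: (@unkillable_false N [~ u, n]%g 1%g p) => //; [exact: subgroupR|exact: subgroup1| |].
  move=> t tcb; rewrite pl1.
  have ut : u t <> t by apply: (@displaces_moves _ (c, b)) => //; left.
  rewrite (comm_displaced H0 _ _ Hyz zn _ ut); [|exact: NH|exact: NH|].
    by move=> /plV_fixE.
  exact: cb_in.
move=> v pv.
have [Nv|] := pselect (forall f, N f -> f v = v); first by apply: comm_triv; exact: Nv.
move=> /existsNP[f0 /not_implyP[Nf0 f0v]].
have [e1 [e2 [Ne e1v ve2]]] := orb_ex (ex_intro2 _ _ f0 Nf0 f0v).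
pose C := [set t | e1 < t < e2].
have CN f : N f -> stable C f by move=> Nf t; exact: (orb_in Ne).
have Cv : C v by rewrite /C /= e1v.
apply: (@commute_on_comm _ C) => //; try (by apply: CN; exact: subgroupV).
apply: commute_on_disjoint; [exact: CN|exact: CN|].
move=> t Ct ut; have [q ql qt] := lu2 _ ut.
have [_ Ne12 mN] := Ne.
have qmid := orbital_between Nu Ne12 (lu1 _ ql) qt Ct.
have e1p : p.1 <= e1.
  rewrite leNgt; apply/negP => lt; have [|g Ng []] := mN p.1 lt; first by move: pv; lra.
  by have [_ /(_ g (NH _ Ng))[]] := Hp.
have e2p : e2 <= p.2.
  rewrite leNgt; apply/negP => lt; have [|g Ng []] := mN p.2 _ lt; first by move: pv; lra.
  by have [_ /(_ g (NH _ Ng))[]] := Hp.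
have [|_ Hn] := HM q ql _ _ Mn; first by rewrite /mid; move: qmid; lra.
exact: (Hn e1 e2).
Qed.

(** A displaced interval lies in a single orbital of g and is attracted to one end of it. That end
    is interior to (l, r), because g is the identity near l and r. *)
Lemma displaces_limit g l r (q : R * R) : inner g l r -> g l = l -> g r = r ->
  l < q.1 -> q.1 <= q.2 -> q.2 < r -> displaces g q ->
  exists e, [/\ l < e, e < r & forall e1 e2, e1 < e -> e < e2 ->
    exists n0, forall n, (n0 <= n)%N -> forall x, q.1 <= x <= q.2 -> e1 < (g ^+ n)%g x < e2].
Proof.
move=> [y [z [ly yz zr Hyz]]] gl gr lq q12 qr [dq|dq].
  have [|al [be [gab aq qb]]] := @orb_ex _ [set g] q.1; first by exists g => //; move=> e; lra.
  have /orb1P[ab ga gb mv] := gab.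
  have qb2 : q.2 < be by apply: (lt_trans dq); rewrite -gb pl_lt.
  have br : be <= r by rewrite leNgt; apply/negP => ?; apply: (mv r) => //; lra.
  have bz : be <= z.
    rewrite leNgt; apply/negP => zb.
    pose m := Num.max z q.2.
    have mb : m < be by rewrite gt_max zb.
    have zm : z <= m by rewrite le_max lexx.
    have qm : q.2 <= m by rewrite le_max lexx orbT.
    by have [||||_ ?] := Hyz ((m + be) / 2) _ _ (mv _ _ _); lra.
  exists be; split; [lra|lra|] => e1 e2 e1b be2.
  have [up|dn] := orb_dir gab; last by have := dn _ aq qb; lra.
  have [n0 Hn] := attract_r gab up aq e1b.
  exists n0 => n /Hn lt x /andP[qx xq]; apply/andP; split.
    by apply: (lt_le_trans lt); rewrite pl_le.
  apply: lt_trans be2; rewrite -[X in _ < X](@plX_fix _ g be n)// pl_lt; lra.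
have [|al [be [gab aq qb]]] := @orb_ex _ [set g] q.2; first by exists g => //; move=> e; lra.
have /orb1P[ab ga gb mv] := gab.
have qb2 : al < q.1 by apply: lt_trans dq; rewrite -ga pl_lt.
have br : l <= al by rewrite leNgt; apply/negP => ?; apply: (mv l) => //; lra.
have bz : y <= al.
  rewrite leNgt; apply/negP => zb.
  pose m := Num.min y q.1.
  have mb : al < m by rewrite lt_min zb.
  have zm : m <= y by rewrite ge_min lexx.
  have qm : m <= q.1 by rewrite ge_min lexx orbT.
  by have [||||? _] := Hyz ((m + al) / 2) _ _ (mv _ _ _); lra.
exists al; split; [lra|lra|] => e1 e2 e1b be2.
have [up|dn] := orb_dir gab; first by have := up _ aq qb; lra.
have [n0 Hn] := attract_l gab dn qb be2.
exists n0 => n /Hn lt x /andP[qx xq]; apply/andP; split.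
  apply: (lt_trans e1b); rewrite -[X in X < _](@plX_fix _ g al n)// pl_lt; lra.
by apply: (le_lt_trans _ lt); rewrite pl_le.
Qed.

Variable cs : seq (R * R).
Hypothesis cs_orb : forall p, p \in cs -> orb H p.1 p.2.
Hypothesis cs_cover : forall w x, H w -> w x <> x -> exists2 p, p \in cs & p.1 < x < p.2.

(* g contracts hulls of supp f towards points e p, and d brings e (l0, r0) into
   [c, b]. If d (e p) were not in the hull Ku p for another component p, then u
   and its conjugate would commute on p but not on (l0, r0), against the choice
   of N. So f moves all the d (e p), and hence a neighbourhood of each off itself. *)
Lemma self_displacing : exists f v, [/\ H f, H v, f <> 1%g &
  scatters f [set y | exists2 x, supp f x & y = v x]].
Proof.
have [N bN HN] := kill cs; have [sN ND nN fN] := bN.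
have NH : N `<=` H by move=> f /ND/derv_sub.
pose cu := [seq p <- cs | `[< unkillable p >]].
have cuP p : p \in cu -> unkillable p /\ orb H p.1 p.2.
  by rewrite mem_filter => /andP[/asboolP ? /cs_orb].
have cuN p : p \in cu -> forall x, p.1 < x < p.2 -> exists2 f, N f & f x <> x.
  by move=> /cuP[up Hp]; exact: unkillable_nofix.
have cu_supp f x : N f -> f x <> x -> exists2 p, p \in cu & p.1 < x < p.2.
  move=> Nf fx; have [p pc px] := cs_cover (NH _ Nf) fx; exists p => //.
  have [tN|up] := HN p pc; first by case: fx; exact: (tN f x).
  by rewrite mem_filter pc andbT; apply/asboolP.
have [u Nu ucb] := nofix_right sN fN l0c br0.
have u_moves t : c <= t <= b -> u t <> t.
  by move=> tcb; apply: (@displaces_moves _ (c, b)) => //; left.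
have lrcu : (l0, r0) \in cu.
  have [|p pcu /andP[pb bp]] := cu_supp u b Nu; first by apply: u_moves; rewrite cb lexx.
  suff -> : (l0, r0) = p by [].
  have [_ Hp] := cuP _ pcu; have /andP[lb' br'] := @cb_in b (introT andP (conj cb (lexx b))).
  have [||-> ->] := orb_uniq H0 Hp; [lra|lra|].
  by rewrite -surjective_pairing.
have hullP f : N f -> exists K : R * R -> R * R, forall p, p \in cu ->
    [/\ p.1 < (K p).1, (K p).1 <= (K p).2, (K p).2 < p.2 &
      forall x, p.1 < x -> x < p.2 -> f x <> x -> (K p).1 < x /\ x < (K p).2].
  move=> Nf; suff /choice[K HK] : forall p : R * R, exists q : R * R, p \in cu ->
    [/\ p.1 < q.1, q.1 <= q.2, q.2 < p.2 &
      forall x, p.1 < x -> x < p.2 -> f x <> x -> q.1 < x /\ x < q.2] by exists K.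
  move=> p; have [pcu|] := boolP (p \in cu); last by exists p.
  have [_ Hp] := cuP _ pcu.
  by have [y [z yz]] := derv_inner (ND _ Nf) Hp; exists (y, z).
have disp (K : R * R -> R * R) : (forall p, p \in cu ->
    [/\ p.1 < (K p).1, (K p).1 <= (K p).2 & (K p).2 < p.2]) ->
    exists2 g, N g & forall p, p \in cu -> displaces g (K p).
  move=> HK; have [_ /mapP[p pcu ->]|g Ng Hg] := @displace_all _ N [seq K p | p <- cu] sN.
    have [K1 K12 K2] := HK _ pcu; split => // x Kx xK.
    by apply: (cuN p pcu); apply/andP; split; lra.
  by exists g => // p pcu; apply: Hg; exact: map_f.
have [Ku HKu] := hullP u Nu.
have [|f Nf fKu] := disp Ku; first by move=> p /HKu[].
have [Kf HKf] := hullP f Nf.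
(* f displaces [Ku p], hence moves both of its ends, which therefore lie inside the hull of the
   support of f. *)
have Kuf p : p \in cu -> (Kf p).1 < (Ku p).1 /\ (Ku p).2 < (Kf p).2.
  move=> pcu; have [a1 a2 a3 _] := HKu _ pcu; have [b1 b2 b3 Hf] := HKf _ pcu.
  have [|||h1 _] := Hf (Ku p).1; [lra|lra| |].
    by apply: (displaces_moves _ (fKu _ pcu)); rewrite lexx.
  have [|||_ h2] := Hf (Ku p).2; [lra|lra| |by []].
  by apply: (displaces_moves _ (fKu _ pcu)); rewrite lexx andbT.
have [|g Ng gKf] := disp Kf; first by move=> p /HKf[].
have /choice[e He] : forall p : R * R, exists e, p \in cu -> [/\ p.1 < e, e < p.2 &
    forall e1 e2, e1 < e -> e < e2 -> exists n0, forall n, (n0 <= n)%N ->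
    forall x, (Kf p).1 <= x <= (Kf p).2 -> e1 < (g ^+ n)%g x < e2].
  move=> p; have [pcu|] := boolP (p \in cu); last by exists 0.
  have [_ Hp] := cuP _ pcu; have [b1 b2 b3 _] := HKf _ pcu.
  have [_ /(_ _ (NH _ Ng))[gp1 gp2] _] := Hp.
  have [e0 He0] := displaces_limit (derv_inner (ND _ Ng) Hp) gp1 gp2 b1 b2 b3 (gKf _ pcu).
  by exists e0.
have [le0 e0r He0] := He _ lrcu.
have [d Hd dcb] := cocompact le0 e0r.
have pull p x1 x2 : p \in cu -> x1 < d (e p) -> d (e p) < x2 ->
    exists n0, forall n, (n0 <= n)%N ->
    forall x, (Kf p).1 <= x <= (Kf p).2 -> x1 < (g ^+ n * d)%g x < x2.
  move=> pcu h1 h2; have [_ _ /(_ (d^-1%g x1) (d^-1%g x2))] := He _ pcu.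
  rewrite -(pl_lt d) plVK => /(_ h1); rewrite -(pl_lt d) plVK => /(_ h2)[n0 Hn].
  by exists n0 => n /Hn{}Hn x /Hn; rewrite plM -(pl_lt d) plVK -(pl_lt d _ (d^-1%g x2)) plVK.
have [v1 [v2 [v1e ev2 duV]]] := move_nbhd (u_moves _ dcb).
have [n1 Hn1] := pull _ _ _ lrcu v1e ev2.
have HW n : H (g ^+ n * d)%g by apply: subgroupM => //; apply: subgroupX => //; exact: NH.
have meet p n : p \in cu -> (n1 <= n)%N ->
    exists2 x, (Ku p).1 <= x <= (Ku p).2 & (Ku p).1 <= (g ^+ n * d)%g x <= (Ku p).2.
  move=> pcu n1n; apply: contrapT => nmeet; set w := (g ^+ n * d)%g in nmeet.
  have Hw : H w := HW n.
  have [up Hp] := cuP _ pcu.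
  have Nuw : N (u ^ w)%g by exact: nN.
  have uw_in l r (K : R * R) y : orb H l r -> l < y < r ->
      (forall x, l < x -> x < r -> u x <> x -> K.1 < x /\ x < K.2) -> (u ^ w)%g y <> y ->
      exists2 x, K.1 <= x <= K.2 & y = w x.
    move=> Hlr lyr HK uwy; exists (w^-1%g y); last by rewrite plVK.
    have /andP[z1 z2] := H_in Hlr (subgroupV sH Hw) lyr.
    have [|? ?] := HK _ z1 z2; last by rewrite !ltW.
    by move=> ee; apply: uwy; rewrite plJE ee plVK.
  apply: (@unkillable_false N [~ u ^ w, u]%g w p) => //; first exact: subgroupR.
    move=> t tcb.
    have lt0r := cb_in tcb.
    have uwt : (u ^ w)%g (w t) <> w t by rewrite plJ => /pl_inj; exact: u_moves.
    have [_ _ _ HK0] := HKu _ lrcu.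
    (* On (l0, r0) the support of [u ^ w] lies in (v1, v2), which u displaces. So the commutator
       acts at w t as the inverse of [u ^ w] and moves it. *)
    have inV y : l0 < y < r0 -> (u ^ w)%g y <> y -> v1 < y < v2.
      move=> ylr /(uw_in _ _ _ _ H0 ylr HK0)[x /andP[xK1 xK2] ->]; apply: Hn1 => //.
      by have [? ?] := Kuf _ lrcu; apply/andP; split; lra.
    set x' := (u ^ w)^-1%g (w t).
    have uwx' : (u ^ w)%g x' <> x' by rewrite /x' plVK => ee; apply: uwt; rewrite {1}ee plVK.
    have wtin := H_in H0 Hw lt0r.
    have Huw : H (u ^ w)%g by exact: NH.
    have x'in : l0 < x' < r0 by apply: (H_in H0) => //; exact: subgroupV.
    have /andP[x'1 x'2] := inV _ x'in uwx'.
    have Huv := subgroupV sH (NH _ Nu).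
    have nV : (u ^ w)%g (u^-1%g x') = u^-1%g x'.
      apply: contrapT => /(inV _ (H_in H0 Huv x'in))/andP[y1 y2].
      have := @displaces_pow _ u (v1, v2) (u^-1%g x') 0 (ltW (lt_trans y1 y2)) duV.
      by rewrite expg1 plVK /= (ltW y1) (ltW y2) (ltW x'1) (ltW x'2) => /(_ isT).
    by rewrite plR plJE -/x' nV plVK => /plV_fixE.
  have [_ _ _ HK] := HKu _ pcu.
  pose C := [set x | p.1 < x < p.2].
  have CN k : N k -> stable C k by move=> Nk x; apply: (H_in Hp); exact: NH.
  move=> x px; apply: (@commute_on_comm _ C) => //; try (by apply: CN; exact: subgroupV).
  apply: commute_on_disjoint; [exact: CN|exact: CN|] => y Cy uwy.
  have [y' y'K yE] := uw_in _ _ _ _ Hp Cy HK uwy.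
  apply: contrapT => uy; move/andP: Cy => [c1 c2]; have [? ?] := HK _ c1 c2 uy.
  by apply: nmeet; exists y' => //; rewrite -yE !ltW.
(* For large n the map [g ^+ n * d] brings [Kf p], and with it [Ku p], arbitrarily close to d (e p).
   If that limit were outside [Ku p], this would contradict [meet]. *)
have eK p : p \in cu -> (Ku p).1 <= d (e p) <= (Ku p).2.
  move=> pcu; have [k1 k2] := Kuf _ pcu.
  apply/andP; split; rewrite leNgt; apply/negP => lt.
    have [|n0 Hn] := pull p (d (e p) - 1) _ pcu _ lt; first by lra.
    have [x /andP[xK1 xK2] /andP[wx _]] := meet p (maxn n1 n0) pcu (leq_maxl _ _).
    have xKf : (Kf p).1 <= x <= (Kf p).2 by apply/andP; split; lra.
    by have /andP[_] := Hn _ (leq_maxr n1 n0) x xKf; rewrite ltNge wx.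
  have [|n0 Hn] := pull p _ (d (e p) + 1) pcu lt; first by lra.
  have [x /andP[xK1 xK2] /andP[_ wx]] := meet p (maxn n1 n0) pcu (leq_maxl _ _).
  have xKf : (Kf p).1 <= x <= (Kf p).2 by apply/andP; split; lra.
  by have /andP[+ _] := Hn _ (leq_maxr n1 n0) x xKf; rewrite ltNge wx.
have [n Hn] : exists n, forall p, p \in cu -> exists q : R * R, [/\ q.1 <= q.2, displaces f q &
    forall x, (Kf p).1 <= x <= (Kf p).2 -> q.1 <= (g ^+ n * d)%g x <= q.2].
  suff [n0 Hn] : exists n0, forall n, (n0 <= n)%N -> forall p, p \in cu ->
      exists q : R * R, [/\ q.1 <= q.2, displaces f q &
      forall x, (Kf p).1 <= x <= (Kf p).2 -> q.1 <= (g ^+ n * d)%g x <= q.2].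
    by exists n0; exact: Hn.
  have : {subset cu <= cu} by [].
  elim: {1 3}cu => [|p s IH] ss; first by exists 0%N.
  have [|n0 Hn] := IH; first by move=> q qs; apply: ss; rewrite inE qs orbT.
  have pcu := ss _ (mem_head _ _).
  have [w1 [w2 [w1e ew2 dw]]] := move_nbhd (displaces_moves (eK _ pcu) (fKu _ pcu)).
  have [n2 Hn2] := pull _ _ _ pcu w1e ew2.
  exists (maxn n0 n2) => n; rewrite geq_max => /andP[/Hn{}Hn /Hn2{}Hn2] q.
  rewrite inE => /orP[/eqP ->|/Hn//]; exists (w1, w2); split => //=; first by lra.
  by move=> x /Hn2/andP[? ?]; rewrite !ltW.
exists f, (g ^+ n * d)%g; split; [exact: NH|exact: HW| |].
  have [? ? _ _] := HKu _ lrcu => fE.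
  by apply: (displaces_moves _ (fKu _ lrcu) (x := (Ku (l0, r0)).1)); rewrite ?lexx// fE.
move=> _ m [x fx ->] [x' fx' e'].
have [p pcu px] := cu_supp _ _ Nf fx; have [_ Hp] := cuP _ pcu.
have wx := H_in Hp (HW n) px.
have wx' : p.1 < (g ^+ n * d)%g x' < p.2.
  by rewrite -e'; apply: (H_in Hp) => //; apply: subgroupX => //; exact: NH.
have px' : p.1 < x' < p.2.
  by rewrite -(plK (g ^+ n * d)%g x'); apply: (H_in Hp) => //; exact: subgroupV.
have [q [q12 dq Hq]] := Hn _ pcu.
have [_ _ _ HK] := HKf _ pcu.
have xK y : p.1 < y < p.2 -> f y <> y -> (Kf p).1 <= y <= (Kf p).2.
  by move=> /andP[y1 y2] fy; have [? ?] := HK _ y1 y2 fy; rewrite !ltW.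
have := displaces_pow m q12 dq (Hq _ (xK _ px fx)).
by rewrite e' Hq//; exact: xK.
Qed.

End Ergodic.

(** * The group generated by two overlapping orbitals *)

Section ChainGroup.
Variable R : realType.
Implicit Types (G : set (PLo R)).

Lemma chain_nested G : is_subgroup G -> chain G ->
  exists2 h : int -> PLo R, nested setT h & forall i, G (h i).
Proof.
move=> sG [g [h [a [b [c [d [Gg Gh gab hcd [ac cb bd]]]]]]]].
have /orb1P[_ ga gb mg] := gab; have /orb1P[_ hc hd mh] := hcd.
pose H := generated [set g; h].
have sH : is_subgroup H by exact: generated_subgroup.
have Hg : H g by apply: (@sub_gen_smallest _ _ [set g; h]); left.
have Hh : H h by apply: (@sub_gen_smallest _ _ [set g; h]); right.
have Hind (P : set (PLo R)) : is_subgroup P -> P g -> P h -> H `<=` P.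
  by move=> sP Pg Ph; apply: smallest_sub => // _ [->|->].
have HG : H `<=` G by exact: Hind.
clearbody H.
have hb : h b <> b by exact: mh.
have [l0 [r0 [H0 l0b br0]]] : exists l0 r0, [/\ orb H l0 r0, l0 < b & b < r0].
  by apply: orb_ex; exists h.
have [_ Hlr mH] := H0.
have l0c : l0 < c.
  rewrite ltNge; apply/negP => cl; have [gl _] := Hlr _ Hg.
  by apply: (mg l0) => //; lra.
have cob x : l0 < x -> x < r0 -> exists2 w, H w & c <= w x <= b.
  move=> lx xr; apply: contrapT => noO.
  have noH w : H w -> w x < c \/ b < w x.
    move=> Hw; have [?|cw] := ltP (w x) c; first by left.
    by right; rewrite ltNge; apply/negP => wb; apply: noO; exists w => //; apply/andP.
  (* Since g fixes b and h fixes c, an orbit avoiding [c, b] cannot jump over it. *)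
  have side_inv (Q : R -> Prop) :
      (forall w, H w -> Q (w x) ->
        [/\ Q (g (w x)), Q (g^-1%g (w x)), Q (h (w x)) & Q (h^-1%g (w x))]) ->
      forall w, H w -> Q x -> Q (w x).
    (* P quantifies over all points of the orbit and over w with its inverse, which makes it a
       subgroup containing the generators. *)
    move=> HQ; pose P := [set w : PLo R | H w /\ forall v, H v -> Q (v x) ->
      Q (w (v x)) /\ Q (w^-1%g (v x))].
    suff HP : H `<=` P by move=> w /HP[_ Pw] Qx; have [] := Pw 1%g (subgroup1 sH) Qx.
    apply: Hind.
    - split; first by split; [exact: subgroup1|move=> v Hv Qv; rewrite invg1].
        move=> w w' [Hw Pw] [Hw' Pw']; split; first exact: subgroupM.
        move=> v Hv Qv; rewrite invgM !plM; split.
          have [Qw _] := Pw v Hv Qv.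
          by have [] := Pw' (v * w)%g (subgroupM sH Hv Hw) Qw.
        have [_ Qw] := Pw' v Hv Qv.
        by have [_] := Pw (v * w'^-1)%g (subgroupM sH Hv (subgroupV sH Hw')) Qw.
      move=> w [Hw Pw]; split; first exact: subgroupV.
      by move=> v Hv Qv; rewrite invgK; have [] := Pw v Hv Qv.
    - by split => // v Hv Qv; have [] := HQ v Hv Qv.
    - by split => // v Hv Qv; have [] := HQ v Hv Qv.
  have gV (k : PLo R) y z : k z = z -> (z < k^-1%g y) = (z < y).
    by move=> kz; rewrite -(pl_lt k) plVK kz.
  have gV' (k : PLo R) y z : k z = z -> (k^-1%g y < z) = (y < z).
    by move=> kz; rewrite -(pl_lt k) plVK kz.
  have gK (k : PLo R) y z : k z = z -> (z < k y) = (z < y).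
    by move=> kz; rewrite -{1}kz pl_lt.
  have gK' (k : PLo R) y z : k z = z -> (k y < z) = (y < z).
    by move=> kz; rewrite -{1}kz pl_lt.
  have [xc|bx] := noH 1%g (subgroup1 sH); [rewrite pl1 in xc|rewrite pl1 in bx].
    have Q w : H w -> w x < c.
      move=> Hw; apply: (side_inv (fun y => y < c)) => // v Hv vc.
      split; [| |by rewrite gK'|by rewrite gV'].
        have vb : g (v x) < b by rewrite gK'//; lra.
        have [out|out] := noH (v * g)%g (subgroupM sH Hv Hg); first exact: out.
        by have := lt_trans out vb; rewrite ltxx.
      have vb : g^-1%g (v x) < b by rewrite gV'//; lra.
      have [out|out] := noH (v * g^-1)%g (subgroupM sH Hv (subgroupV sH Hg)); first exact: out.
      by have := lt_trans out vb; rewrite ltxx.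
    have [|w Hw wx] := @displace_right _ H x c sH.
      by move=> y xy yc; apply: mH; lra.
    by have := Q w Hw; lra.
  have Q w : H w -> b < w x.
    move=> Hw; apply: (side_inv (fun y => b < y)) => // v Hv vc.
    split; [by rewrite gK|by rewrite gV| |].
      have vb : c < h (v x) by rewrite gK//; lra.
      have [out|out] := noH (v * h)%g (subgroupM sH Hv Hh); last exact: out.
      by have := lt_trans vb out; rewrite ltxx.
    have vb : c < h^-1%g (v x) by rewrite gV//; lra.
    have [out|out] := noH (v * h^-1)%g (subgroupM sH Hv (subgroupV sH Hh)); last exact: out.
    by have := lt_trans vb out; rewrite ltxx.
  have [|w Hw wx] := @displace_right _ H b x sH.
    by move=> y xy yc; apply: mH; lra.
  have := Q w^-1%g (subgroupV sH Hw); rewrite -(pl_lt w) plVK; lra.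
(* A fixed point of D(H) has its whole H-orbit fixed by D(H), as D(H) is normal. The orbit meets
   [c, b] and accumulates at b under g or its inverse, unless it contains b; so D(H) fixes b. But
   for v among h and its inverse with v b in (c, b), the commutator of [v^-1] and g fixes b only if
   g fixes v b, which lies in (a, b). *)
have nofixD : nofix l0 r0 (derv H).
  move=> x lx xr; apply: contrapT => Dx.
  have {}Dx f : derv H f -> f x = x.
    by move=> Df; apply: contrapT => fx; apply: Dx; exists f.
  have sD := derv_subgroup sH.
  have nD := derv_normal sH.
  have Dw w f : H w -> derv H f -> f (w x) = w x.
    move=> Hw Df; have := Dx _ (nD _ _ Df (subgroupV sH Hw)).
    by rewrite plJE invgK => /(congr1 w); rewrite plVK.
  have [w Hw /andP[cw wb]] := cob x lx xr.
  have Db f : derv H f -> f b = b.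
    move: wb; rewrite le_eqVlt => /orP[/eqP <-|wb]; first exact: Dw.
    have [g' Hg' [g'ab up]] : exists2 g', H g' & orb [set g'] a b /\
        forall y, a < y -> y < b -> y < g' y.
      have [up|dn] := orb_dir gab; first by exists g.
      exists g^-1%g; first exact: subgroupV.
      split; first exact: orb_V.
      move=> y ay yb; rewrite -(pl_lt g) plVK; exact: dn.
    have aw : a < w x by lra.
    have key k : derv H k -> b <= k b.
      move=> Dk; rewrite leNgt; apply/negP => kb.
      have [n /(_ n (leqnn _)) Hn] := attract_r g'ab up aw kb.
      have := Dw (w * g' ^+ n)%g k (subgroupM sH Hw (subgroupX n sH Hg')) Dk.
      rewrite plM => e; have /orb1P[_ _ g'b _] := g'ab.
      have : (g' ^+ n)%g (w x) < b by rewrite -[X in _ < X](@plX_fix _ g' b n)// pl_lt.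
      by rewrite -(pl_lt k) e; lra.
    move=> Df; apply/eqP; rewrite eq_le key// andbT -(pl_le f^-1%g) plK.
    by apply: key; exact: (subgroupV sD).
  have [v Hv [vb cv]] : exists2 v, H v & v b < b /\ c < v b.
    have hcb (k : PLo R) : k c = c -> c < k b by move=> kc; rewrite -{1}kc pl_lt.
    have [lt|lt|//] := ltgtP (h b) b; first by exists h => //; split => //; exact: hcb.
    exists h^-1%g; first exact: subgroupV.
    by split; [rewrite -(pl_lt h) plVK|apply: hcb; exact: plV_fix].
  have := Db _ (derv_comm sH (subgroupV sH Hv) Hg).
  have -> : [~ v^-1, g]%g b = g (v^-1%g (g^-1%g (v b))) by rewrite /commg /conjg invgK.
  move=> e; apply: (mg (v b)) => //; first lra.
  have {}e : v^-1%g (g^-1%g (v b)) = b by apply: (@pl_inj _ g); rewrite e gb.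
  have {}e : g^-1%g (v b) = v b by rewrite -{2}e plVK.
  exact/plV_fixE.
(* Every component of the support of H contains an orbital of g or of h, so there are finitely many;
   each is found from the midpoint of such an orbital. *)
have [cs [cs1 cs2]] : exists cs : seq (R * R), (forall p, p \in cs -> orb H p.1 p.2) /\
    forall (w : PLo R) x, H w -> w x <> x -> exists2 p, p \in cs & p.1 < x < p.2.
  have [lg [lg1 lg2]] := orbitals g; have [lh [lh1 lh2]] := orbitals h.
  pose l := lg ++ lh; pose mid (q : R * R) := (q.1 + q.2) / 2.
  have lP q : q \in l -> exists2 k, H k & orb [set k] q.1 q.2.
    by rewrite mem_cat => /orP[/lg1|/lh1]; [exists g|exists h].
  have /choice[I IP] : forall q : R * R, exists p : R * R, q \in l ->
      orb H p.1 p.2 /\ p.1 < mid q < p.2.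
    move=> q; have [ql|] := boolP (q \in l); last by exists q.
    have [k Hk /orb1P[q12 _ _ mk]] := lP q ql.
    have [|e1 [e2 [He e1q qe2]]] := @orb_ex _ H (mid q).
      by exists k => //; apply: mk; rewrite /mid; lra.
    by exists (e1, e2) => _; rewrite e1q.
  exists [seq I q | q <- l]; split; first by move=> _ /mapP[q /IP[? _] ->].
  move=> w x Hw wx.
  have [q ql qx] : exists2 q, q \in l & q.1 < x < q.2.
    have [gx|gx] := pselect (g x = x); last first.
      by have [q ql qx] := lg2 x gx; exists q; rewrite // mem_cat ql.
    have [hx|hx] := pselect (h x = x); last first.
      by have [q ql qx] := lh2 x hx; exists q; rewrite // mem_cat ql orbT.
    exfalso; apply: wx; apply: (Hind [set k : PLo R | k x = x]) => //.
    split => //; first by move=> k k' /= kx k'x; rewrite kx k'x.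
    by move=> k /= kx; exact: plV_fix.
  exists (I q); first exact: map_f.
  have [[_ He _] /andP[e1 e2]] := IP q ql; have [k Hk /orb1P[q12 _ _ mk]] := lP q ql.
  have [k1 k2] := He _ Hk.
  have h1 : (I q).1 <= q.1.
    rewrite leNgt; apply/negP => lt; apply: (mk (I q).1) => //.
    by apply: (lt_trans e1); rewrite /mid; lra.
  have h2 : q.2 <= (I q).2.
    rewrite leNgt; apply/negP => lt; apply: (mk (I q).2) => //.
    by apply: lt_trans e2; rewrite /mid; lra.
  by apply/andP; split; lra.
have [f [v [Hf Hv f1 sc]]] :=
  self_displacing sH H0 l0c (ltW cb) br0 cob nofixD cs1 cs2.
(* Since f displaces the image under v of its support, it is the conjugate of f by [v^-1] that
   displaces the support itself. *)
exists (fun i => f ^ expgz v^-1 i)%g.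
  apply: conj_nested => //; apply: (scattersJ sc) => x fx.
  by exists x => //; rewrite invgK.
move=> i; apply: HG; apply: subgroupJ => //.
have HvV := subgroupV sH Hv.
case: i => n /=; first exact: subgroupX.
by apply: subgroupV => //; exact: subgroupX.
Qed.

End ChainGroup.

(** * Towers of signed orbitals *)

Section Towers.
Variable R : realType.
Implicit Types (G : set (PLo R)) (A : set R) (g : PLo R).

Lemma orbital_orb g A : is_orbital g A ->
  exists a b, orb [set g] a b /\ A = [set x | a < x < b].
Proof.
move=> [x [xI gx] ->].
have [|a [b [gab ax xb]]] := @orb_ex _ [set g] x; first by exists g.
exists a, b; split => //; have /orb1P[ab ga gb mv] := gab.
apply/seteqP; split=> [y [C [Cx Cm /connected_intervalP iC] Cy]|y /andP[ay yb]].
  apply/andP; split; rewrite ltNge; apply/negP => le.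
    by have [] := Cm a (iC _ _ Cy Cx _ (introT andP (conj le (ltW ax)))).
  by have [] := Cm b (iC _ _ Cx Cy _ (introT andP (conj (ltW xb) le))).
exists [set z | a < z < b]; last by rewrite /= ay.
split; first by rewrite /= ax.
  move=> z /andP[az zb]; have gz := mv _ az zb; split => //.
  by apply/I01E; apply: (@pl_moved_in _ g); apply/eqP.
apply/connected_intervalP => u v /andP[au ub] /andP[av vb] w /andP[uw wv].
by apply/andP; split; lra.
Qed.

Lemma itv_proper (a b c d : R) : a < b -> c < d ->
  [set x | a < x < b] `<` [set x | c < x < d] -> [/\ c <= a, b <= d & c < a \/ b < d].
Proof.
move=> ab cd [sub nsub].
have {}sub x : a < x -> x < b -> c < x /\ x < d.
  by move=> ax xb; apply/andP; apply: sub; rewrite /= ax.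
have ca : c <= a.
  rewrite leNgt; apply/negP => ac; have [cb|bc] := leP c b.
    by have [||] := sub ((a + c) / 2); lra.
  by have [||] := sub ((a + b) / 2); lra.
have bd : b <= d.
  rewrite leNgt; apply/negP => db; have [ad|da] := leP a d.
    by have [||] := sub ((d + b) / 2); lra.
  by have [||] := sub ((a + b) / 2); lra.
split => //; have [|ac] := ltP c a; first by left.
have [|db] := ltP b d; first by right.
by case: nsub => x /andP[cx xd]; apply/andP; split; lra.
Qed.

Variable ord : rel (PLo R).

(** Condition (ii) of towers excludes equal orbitals, and a common end of strictly nested ones would
    give a chain, so both ends differ. The relation [lt_] is a parameter to cover increasing,
    decreasing and bi-infinite sequences alike. *)
Lemma tower_seq G T (I : Type) (lt_ : I -> I -> Prop) (f : I -> set R * PLo R) :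
  is_subgroup G -> ~ chain G -> is_tower ord G T -> (forall i, T (f i)) ->
  (forall i j, lt_ i j -> f i <> f j /\ signed_orbital_le ord (f i) (f j)) ->
  exists a b : I -> R, (forall i, G (f i).2 /\ orb [set (f i).2] (a i) (b i)) /\
    forall i j, lt_ i j -> a j < a i /\ b i < b j.
Proof.
move=> sG lam [T1 _ T3] Tf flt.
have /choice[ab Hab] : forall i, exists p : R * R, orb [set (f i).2] p.1 p.2 /\
    (f i).1 = [set x | p.1 < x < p.2].
  by move=> i; have [_ /orbital_orb[a [b abP]]] := T1 _ (Tf i); exists (a, b).
exists (fun i => (ab i).1), (fun i => (ab i).2); split.
  by move=> i; have [? _] := T1 _ (Tf i); have [? _] := Hab i; split.
move=> i j /flt[nij [sub|[e _]]]; last first.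
  have e2 : (f i).2 = (f j).2.
    apply: (T3 (f i).1); first by rewrite -surjective_pairing.
    by rewrite e -surjective_pairing.
  by case: nij; rewrite [LHS]surjective_pairing e e2 -surjective_pairing.
have [[oi ei] [oj ej]] := (Hab i, Hab j).
have [Gi _] := T1 _ (Tf i); have [Gj _] := T1 _ (Tf j).
have [abi _ _] := oi; have [abj _ _] := oj.
rewrite ei ej in sub; have [l1 l2 l3] := itv_proper abi abj sub.
split; rewrite lt_neqAle ?l1 ?l2 andbT; apply/eqP => e.
  case: l3 => [|l3]; first by rewrite e ltxx.
  by apply: lam; apply: (shared_l sG Gi Gj oi _ l3); rewrite -e.
case: l3 => [l3|]; last by rewrite e ltxx.
by apply: lam; apply: (shared_r sG Gi Gj oi _ l3); rewrite e.
Qed.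

End Towers.

Theorem theorem1p6 (R : realType) (ord : rel (PLo R)) (ordP : is_total_order ord)
    (G : set (PLo R)) (GP : is_subgroup G) :
  [/\ (exists T, is_tower ord G T /\ is_tall ord T) ->
        contains_copy_of G (Zwr_infty R),
      (exists T, is_tower ord G T /\ is_deep ord T) ->
        contains_copy_of G (infty_wrZ R) &
      (exists T, is_tower ord G T /\ is_bi_infinite ord T) ->
        contains_copy_of G (wrZwr_infty R)].
Proof.
have ZwrE : Zwr_infty R = generated (beta R @` [set i | 0 <= i]).
  congr generated; apply/seteqP; split=> [_ [n _ <-]|_ [[n|//] _ <-]].
    by exists n%:Z.
  by exists n.
have nb Idx : nested Idx (beta R) by exact: nested_sub (nested_beta R).
(* A chain yields a family indexed by all integers, whose restrictions serve the three cases. *)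
have [cG|lam] := pselect (chain G).
  have [h nh Gh] := chain_nested GP cG.
  have copy Idx : contains_copy_of G (generated (beta R @` Idx)).
    by apply: (nested_copy GP (nb _) (h := h)) => //; exact: nested_sub nh.
  by split => _; rewrite ?ZwrE; exact: copy.
split=> [[T [twT [f [Tf finj fle]]]]|[T [twT [f [Tf finj fle]]]]|[T [twT [f [Tf finj fle]]]]].
- have [i j ij|a [b [fab lt]]] := tower_seq GP lam twT Tf (lt_ := fun i j : nat => (i < j)%N).
    by split; [move=> /finj e; rewrite e ltnn in ij|apply: fle; exact: ltnW].
  have [n|n|L [sL LG stL tL]] := laminar_star (nx := S) GP lam (a := a) (b := b).
  + exact: lt.
  + by have [? ?] := fab n; exists (f n).2.
  have [f0 Lf0 f0ab] := tL 0%N.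
  have f01 : f0 <> 1%g.
    move=> e; have /orb1P[ab _ _ mv] := f0ab.
    by apply: (mv ((a 0%N + b 0%N) / 2)); rewrite ?e//; lra.
  have [h [h0 Lh h1 sch]] := star_tower sL stL Lf0 f01.
  rewrite ZwrE; apply: (nested_copy GP (nb _) (h := fun i => h (absz i))).
    move=> [[|k]|//] _; split => //.
      by move=> x n [[i|i] [//]].
    apply: scatters_sub (sch k) => x [[i|i] [//] _ ik ix]; exists i => //.
  by move=> i _; exact/LG.
- have [i j ij|a [b [fab lt]]] := tower_seq GP lam twT Tf (lt_ := fun i j : nat => (j < i)%N).
    by split; [move=> /finj e; rewrite e ltnn in ij|apply: fle; exact: ltnW].
  have [n|h [Gh h1 hS hsc]] := laminar_deep GP lam (a := a) (b := b) (g := fun n => (f n).2).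
    by have [? ?] := fab n; have [? ?] := lt n.+1 n (leqnn _).
  have hmono m n : (n <= m)%N -> supp (h m) `<=` supp (h n).
    by move=> /subnK <-; elim: (m - n)%N => [//|k IH] x /hS/IH.
  (* [Negz n] is -(n + 1), so the largest index -1 receives h 0; the value at nonnegative indices is
     a default. *)
  pose h' (i : int) := if i is Negz n then h n else h 0%N.
  apply: (nested_copy GP (nb _) (h := h')); last by move=> [n|n] _; exact: Gh.
  move=> [//|k] _; split; first exact: h1.
  apply: scatters_sub (hsc k) => x [[i|i] [//] _ ik]; apply: hmono.
  by move: ik; rewrite !NegzE ltrN2.
- have [i j ij|a [b [fab lt]]] := tower_seq GP lam twT Tf (lt_ := fun i j : int => i < j).
    by split; [move=> /finj e; rewrite e ltxx in ij|apply: fle; exact: ltW].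
  have [n|n|L [sL LG stL tL]] :=
      laminar_star (nx := fun i : int => i + 1) GP lam (a := a) (b := b).
  + by apply: lt; rewrite ltrDl.
  + by have [? ?] := fab n; exists (f n).2.
  have lamL : ~ chain L.
    move=> [g [h [a' [b' [c' [d' [Lg Lh ? ? ?]]]]]]]; apply: lam.
    by exists g, h, a', b', c', d'; split => //; exact: LG.
  have /choice[g gP] : forall n : nat, exists g, L g /\ orb [set g] (a (- n%:Z)) (b (- n%:Z)).
    by move=> n; have [g Lg gab] := tL (- n%:Z); exists g.
  have [n|h [Lh h1 hS hsc]] := laminar_deep sL lamL (a := fun n => a (- n%:Z))
      (b := fun n => b (- n%:Z)) (g := g).
    have [? ?] := gP n; have [|? ?] := lt (- n.+1%:Z) (- n%:Z); last by split.
    by rewrite ltrN2 ltz_nat.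
  have hmono m n : (n <= m)%N -> supp (h m) `<=` supp (h n).
    by move=> /subnK <-; elim: (m - n)%N => [//|k IH] x /hS/IH.
  have [u [u0 Lu u1 usc]] := star_tower sL stL (Lh 0%N) (h1 0%N).
  (* The two sequences are glued at index 0, where u 0 is h 0; hence the shift in [h n.+1]. *)
  pose h' (i : int) := match i with Posz n => u n | Negz n => h n.+1 end.
  have -> : wrZwr_infty R = generated (beta R @` setT) by [].
  apply: (nested_copy GP (nb _) (h := h')); last first.
    by move=> [n|n] _; apply: LG; rewrite /h'.
  move=> [[|k]|k] _; (split; first by first [exact: u1|exact: h1]).
  + rewrite /= u0; apply: scatters_sub (hsc 0%N) => x [[i|i] [_ ik] //]; exact: hmono.
  + apply: scatters_sub (usc k) => x [[i|i] [_ ik]] ix; first by exists i.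
    by exists 0%N => //; rewrite u0; apply: hmono ix.
  + apply: scatters_sub (hsc k.+1) => x [[i|i] [_ ik] //]; apply: hmono.
    by move: ik; rewrite !NegzE ltrN2.
Qed.
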